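(* Let $(\mathfrak G^\bullet,\{\theta_k\}_{k\ge1})$ be a Leibniz$_\infty$-algebra, and let $d$, $\Phi$, $\Psi$ be as in the context. Then $\Psi^{-1}\circ\Phi\circ d\circ\Phi^{-1}\circ\Psi$ is a codifferential of the coalgebra $\bar{\mathrm S}^c(\mathrm{Lie}(\mathfrak G^\bullet))$. It gives an $L_\infty$-algebra structure on the graded vector space $\mathrm{Lie}(\mathfrak G^\bullet)$.
   Context: Ground field of characteristic $0$; graded means $\mathbb Z$-graded; exponents of $-1$ denote degrees; $\varepsilon(\sigma)$ is the Koszul sign; $\mathbb S_{(i,j)}$ is the set of $(i,j)$-shuffles; $\bar{\mathrm T}(V)=\bigoplus_{i\ge1}V^{\otimes i}$, $\bar{\mathrm S}(V)=\bigoplus_{i\ge1}\mathrm S^i(V)$. A Leibniz$_\infty$-algebra is a graded space $\mathfrak G^\bullet$ with degree $1$ maps $\theta_k:\otimes^k\mathfrak G\to\mathfrak G$, $k\ge1$, such that for all $n\ge1$ and homogeneous $x_1,\dots,x_n$, $$\sum_{i=1}^n\sum_{k=1}^{n-i+1}\sum_{\sigma\in\mathbb S_{(k-1,i-1)}}(-1)^{x_{\sigma(1)}+\dots+x_{\sigma(k-1)}}\varepsilon(\sigma)\theta_{n-i+1}(x_{\sigma(1)},\dots,x_{\sigma(k-1)},\theta_i(x_{\sigma(k)},\dots,x_{\sigma(k+i-2)},x_{k+i-1}),x_{k+i},\dots,x_n)=0.$$ On $\bar{\mathrm T}(\mathfrak G)$ put $d=\sum_{k\ge1}d_k$, with $d_k(x_1\otimes\cdots\otimes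 x_n)=0$ for $n<k$ and, for $n\ge k$, $$d_k(x_1\otimes\cdots\otimes x_n)=\sum_{j=1}^{n+1-k}\sum_{\sigma\in\mathbb S_{(j-1,k-1)}}(-1)^{x_{\sigma(1)}+\dots+x_{\sigma(j-1)}}\varepsilon(\sigma)\,x_{\sigma(1)}\otimes\cdots\otimes x_{\sigma(j-1)}\otimes\theta_k(x_{\sigma(j)},\dots,x_{\sigma(j+k-2)},x_{j+k-1})\otimes x_{j+k}\otimes\cdots\otimes x_n.$$ $\mathrm{Lie}(V)$ is the free graded Lie algebra on a graded space $V$ (the graded Lie subalgebra of $\mathrm T(V)$ with graded commutator generated by $V$); $\mathrm U(\mathrm{Lie}(V))$ is its universal enveloping algebra, i.e. the quotient of $\mathrm T(\mathrm{Lie}(V))$ by the ideal generated by $a\otimes b-(-1)^{ab}b\otimes a-[a,b]$, with product $*$ and coproduct for which elements of $\mathrm{Lie}(V)$ are primitive; $\bar{\mathrm U}$ is the corresponding reduced (noncounital) coalgebra. $\Phi:\mathrm T(V)\to\mathrm U(\mathrm{Lie}(V))$, $\Phi(1)=1$, $\Phi(v_1\otimes\cdots\otimes v_n)=v_1*\cdots*v_n$, is an isomorphism of graded bialgebras ($\mathrm T(V)$ with concatenation and the coshuffle coproduct). $\Psi:\mathrm S(\mathrm{Lie}(V))\to\mathrm U(\mathrm{Lie}(V))$, $\Psi(1)=1$, $\Psi(x_1\odot\cdots\odot x_m)=\frac1{m!}\sum_{\sigma\in\mathbb S_m}\varepsilon(\sigma)x_{\sigma(1)}*\cdots*x_{\sigma(m)}$,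 is the Poincaré-Birkhoff-Witt isomorphism of graded coalgebras. Here $V=\mathfrak G^\bullet$, and both maps are restricted to the reduced coalgebras $\bar{\mathrm T}(\mathfrak G)$, $\bar{\mathrm S}^c(\mathrm{Lie}(\mathfrak G))$, $\bar{\mathrm U}(\mathrm{Lie}(\mathfrak G))$. A codifferential of a graded coalgebra is a degree $1$ coderivation squaring to zero. $\bar{\mathrm S}^c(\mathfrak g)$ is the cofree conilpotent cocommutative coalgebra on $\mathfrak g$; an $L_\infty$-algebra structure on $\mathfrak g$ (degree $1$ graded symmetric maps $l_k$ satisfying the generalized Jacobi identities $\sum_{i=1}^n\sum_{\sigma\in\mathbb S_{(i,n-i)}}\varepsilon(\sigma)l_{n-i+1}(l_i(x_{\sigma(1)},\dots,x_{\sigma(i)}),x_{\sigma(i+1)},\dots,x_{\sigma(n)})=0$) is equivalent to a codifferential on $\bar{\mathrm S}^c(\mathfrak g)$. *)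

(* Defs.v *)
From HB Require Import structures.
From mathcomp Require Import all_boot all_order all_algebra perm.
From mathcomp Require Import finmap monalg.
From mathcomp Require Import boolp classical_sets functions.

Set Implicit Arguments.
Unset Strict Implicit.
Unset Printing Implicit Defensive.

Import GRing.Theory.
Local Open Scope ring_scope.

(* -------------------------------------------------------------------- *)
Definition submod_of (K : fieldType) (V : lmodType K) (p : V -> bool)
    (h : GRing.submod_closed p) : submodClosed V :=
  HB.pack_for (submodClosed V) p (GRing.isSubmodClosed.Build K V p h).

(* Subspaces are the boolean predicates of MathComp's submodClosed; [span X]
   is the intersection of all of them that contain X, made boolean
   classically. *)
Section Span.
Variables (K : fieldType) (V : lmodType K).

Definition span (X : set V) : {pred V} :=
  fun y => `[< forall S : submodClosed V,
                 (forall x, X x -> x \in S) -> y \in S >].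

Lemma mem_span (X : set V) x : X x -> x \in span X.
Proof. by move=> Xx; apply/asboolP => S; apply. Qed.

Lemma span_ind (X : set V) (P : V -> Prop) :
    P 0 -> (forall a x y, P x -> P y -> P (a *: x + y)) ->
    (forall x, X x -> P x) ->
  forall y, y \in span X -> P y.
Proof.
move=> P0 PD XP y /asboolP yX; apply/asboolP.
have clP : GRing.submod_closed (fun x => `[< P x >]).
  split=> [|a x z]; first exact/asboolP.
  by move=> /asboolP Px /asboolP Pz; apply/asboolP/PD.
by apply: (yX (submod_of clP)) => x /XP Px; apply/asboolP.
Qed.

Lemma span_submod_closed (X : set V) : GRing.submod_closed (span X).
Proof.
split=> [|a x y]; first by apply/asboolP => S _; apply: rpred0.
move=> /asboolP xS /asboolP yS; apply/asboolP => S XS.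
by rewrite rpredD ?rpredZ ?xS ?yS.
Qed.

HB.instance Definition _ (X : set V) :=
  GRing.isSubmodClosed.Build K V (span X) (span_submod_closed X).

End Span.

(* -------------------------------------------------------------------- *)
Definition subsp (K : fieldType) (V : lmodType K) (S : submodClosed V) : Type :=
  {x : V | x \in S}.

Section Subspace.
Variables (K : fieldType) (V : lmodType K) (S : submodClosed V).

HB.instance Definition _ := [isSub of subsp S for @sval V (fun x => x \in S)].
HB.instance Definition _ := [Choice of subsp S by <:].
HB.instance Definition _ := [SubChoice_isSubLmodule of subsp S by <:].

End Subspace.

(* -------------------------------------------------------------------- *)
Section SubmodZmod.
Variables (K : fieldType) (V : lmodType K) (S : submodClosed V).

Definition submod_zmod : zmodClosed V :=
  HB.pack_for (zmodClosed V) (fun x => x \in S)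
    (GRing.isZmodClosed.Build V (fun x => x \in S)
       (GRing.submod_closedB (submodClosedP S))).

End SubmodZmod.

Definition quo (K : fieldType) (V : lmodType K) (S : submodClosed V) : Type :=
  Quotient.quot (submod_zmod S).

Section QuotientSpace.
Variables (K : fieldType) (V : lmodType K) (S : submodClosed V).

HB.instance Definition _ := GRing.Zmodule.on (quo S).

Definition quo_pi (x : V) : quo S := (\pi_(Quotient.quot (submod_zmod S)) x)%qT.
Definition quo_repr (u : quo S) : V := repr (u : Quotient.quot (submod_zmod S)).

Lemma quo_reprK : cancel quo_repr quo_pi. Proof. exact: reprK. Qed.

Lemma quo_piP x y : reflect (quo_pi x = quo_pi y) (x - y \in S).
Proof.
rewrite -[x - y \in S]/(x - y \in submod_zmod S) Quotient.idealrBE.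
exact: eqP.
Qed.

Lemma quo_piB : zmod_morphism quo_pi.
Proof. by move=> x y; rewrite /quo_pi raddfB. Qed.

HB.instance Definition _ := GRing.isZmodMorphism.Build V (quo S) quo_pi quo_piB.

Definition quo_scale (a : K) (u : quo S) : quo S := quo_pi (a *: quo_repr u).

Lemma quo_scale_pi a x : quo_scale a (quo_pi x) = quo_pi (a *: x).
Proof.
apply/quo_piP; rewrite -scalerBr rpredZ //; apply/quo_piP.
by rewrite quo_reprK.
Qed.

Fact quo_scaleA a b u : quo_scale a (quo_scale b u) = quo_scale (a * b) u.
Proof. by rewrite -(quo_reprK u) !quo_scale_pi scalerA. Qed.
Fact quo_scale1 : left_id 1 quo_scale.
Proof. by move=> u; rewrite -(quo_reprK u) quo_scale_pi scale1r. Qed.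
Fact quo_scaleDr : right_distributive quo_scale +%R.
Proof.
move=> a u v; rewrite -(quo_reprK u) -(quo_reprK v).
by rewrite -raddfD !quo_scale_pi -raddfD scalerDr.
Qed.
Fact quo_scaleDl u : {morph quo_scale^~ u : a b / a + b}.
Proof.
by move=> a b; rewrite -(quo_reprK u) !quo_scale_pi -raddfD scalerDl.
Qed.

HB.instance Definition _ := GRing.Zmodule_isLmodule.Build K (quo S)
  quo_scaleA quo_scale1 quo_scaleDr quo_scaleDl.

Fact quo_piZ : scalable quo_pi.
Proof. by move=> a x; rewrite -quo_scale_pi. Qed.

HB.instance Definition _ := GRing.isScalable.Build K V (quo S) *:%R quo_pi quo_piZ.

End QuotientSpace.

(* -------------------------------------------------------------------- *)
(* MathComp's algType requires 1 != 0.  The augmentation (the counit of the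
   bialgebras below) is carried along so that the quotient by an ideal
   generated by elements of its kernel is visibly nontrivial. *)
HB.mixin Record Algebra_hasAug (K : fieldType) A of GRing.Algebra K A := {
  aug : A -> K;
  aug_scalar_subproof : scalar aug;
  aug_monoid_subproof : monoid_morphism aug
}.

#[short(type="augAlgType")]
HB.structure Definition AugAlgebra (K : fieldType) :=
  { A of GRing.Algebra K A & Algebra_hasAug K A }.

Section AugTheory.
Variables (K : fieldType) (A : augAlgType K).
HB.instance Definition _ := GRing.isLinear.Build K A K *%R (@aug K A) aug_scalar_subproof.
HB.instance Definition _ := GRing.isMonoidMorphism.Build A K (@aug K A) aug_monoid_subproof.
End AugTheory.

(* -------------------------------------------------------------------- *)
(* The two-sided ideal generated by R. *)
Definition ideal (K : fieldType) (A : algType K) (R : set A) : {pred A} :=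
  span [set y : A | exists a b r, R r /\ y = a * r * b].

HB.instance Definition _ (K : fieldType) (A : algType K) (R : set A) :=
  GRing.SubmodClosed.on (ideal R).

Record relators (K : fieldType) (A : augAlgType K) := Relators {
  relset :> set A;
  aug_relset : forall r, relset r -> aug r = 0 }.

Definition quoalg (K : fieldType) (A : augAlgType K) (R : relators A) : Type :=
  quo (ideal R).

Section QuotientAlgebra.
Variables (K : fieldType) (A : augAlgType K) (R : relators A).
Local Notation I := (ideal R).
Local Notation Q := (quoalg R).

HB.instance Definition _ := GRing.Lmodule.on Q.

Definition qpi : A -> Q := @quo_pi K A I.
HB.instance Definition _ := GRing.Linear.on qpi.
Definition qrepr : Q -> A := @quo_repr K A I.

Lemma qreprK : cancel qrepr qpi. Proof. exact: quo_reprK. Qed.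

Lemma qpiP x y : reflect (qpi x = qpi y) (x - y \in I).
Proof. exact: quo_piP. Qed.

Lemma aug_ideal x : x \in I -> aug x = 0.
Proof.
move: x; apply: span_ind => [|a x y x0 y0|y [a [b [r [Rr ->]]]]].
- exact: raddf0.
- by rewrite linearP /= x0 y0 mulr0 addr0.
- by rewrite !rmorphM /= (aug_relset Rr) mulr0 mul0r.
Qed.

Lemma idealMl a x : x \in I -> a * x \in I.
Proof.
move: x; apply: span_ind => [|c x y xI yI|y [b [c [r [Rr ->]]]]].
- by rewrite mulr0 rpred0.
- by rewrite mulrDr -scalerAr rpredD ?rpredZ.
- by rewrite !mulrA; apply: mem_span; exists (a * b), c, r.
Qed.

Lemma idealMr a x : x \in I -> x * a \in I.
Proof.
move: x; apply: span_ind => [|c x y xI yI|y [b [c [r [Rr ->]]]]].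
- by rewrite mul0r rpred0.
- by rewrite mulrDl -scalerAl rpredD ?rpredZ.
- by rewrite -mulrA; apply: mem_span; exists b, (c * a), r.
Qed.

Definition qone : Q := qpi 1.
Definition qmul (u v : Q) : Q := qpi (qrepr u * qrepr v).

Lemma qmul_pi x y : qmul (qpi x) (qpi y) = qpi (x * y).
Proof.
apply/qpiP; set x' := qrepr _; set y' := qrepr _.
have -> : x' * y' - x * y = (x' - x) * y' + x * (y' - y).
  by rewrite mulrBl mulrBr addrA addrNK.
rewrite rpredD //; [apply: idealMr | apply: idealMl]; apply/qpiP;
  exact: qreprK.
Qed.

Fact qmulA : associative qmul.
Proof.
move=> u v w; rewrite -(qreprK u) -(qreprK v) -(qreprK w).
by rewrite !qmul_pi mulrA.
Qed.
Fact qmul1 : left_id qone qmul.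
Proof. by move=> u; rewrite -(qreprK u) qmul_pi mul1r. Qed.
Fact qmulr1 : right_id qone qmul.
Proof. by move=> u; rewrite -(qreprK u) qmul_pi mulr1. Qed.
Fact qmulDl : left_distributive qmul +%R.
Proof.
move=> u v w; rewrite -(qreprK u) -(qreprK v) -(qreprK w).
by rewrite -raddfD !qmul_pi -raddfD mulrDl.
Qed.
Fact qmulDr : right_distributive qmul +%R.
Proof.
move=> u v w; rewrite -(qreprK u) -(qreprK v) -(qreprK w).
by rewrite -raddfD !qmul_pi -raddfD mulrDr.
Qed.
Fact qone_neq0 : qone != 0.
Proof.
apply/eqP; rewrite /qone -(raddf0 qpi) => /qpiP /aug_ideal /eqP.
by rewrite subr0 rmorph1 oner_eq0.
Qed.

HB.instance Definition _ := GRing.Zmodule_isNzRing.Build Q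
  qmulA qmul1 qmulr1 qmulDl qmulDr qone_neq0.

Lemma qpiM x y : qpi x * qpi y = qpi (x * y) :> Q.
Proof. exact: qmul_pi. Qed.

Fact qscaleAl (a : K) (u v : Q) : a *: (u * v) = a *: u * v.
Proof.
by rewrite -(qreprK u) -(qreprK v) qpiM -!linearZ qpiM /= scalerAl.
Qed.
HB.instance Definition _ := GRing.Lmodule_isLalgebra.Build K Q qscaleAl.

Fact qscaleAr (a : K) (u v : Q) : a *: (u * v) = u * (a *: v).
Proof.
by rewrite -(qreprK u) -(qreprK v) qpiM -!linearZ qpiM /= scalerAr.
Qed.
HB.instance Definition _ := GRing.Lalgebra_isAlgebra.Build K Q qscaleAr.

Fact qpi_monoid : monoid_morphism qpi.
Proof. by split=> // x y; rewrite qpiM. Qed.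
HB.instance Definition _ := GRing.isMonoidMorphism.Build A Q qpi qpi_monoid.

Definition qaug (u : Q) : K := aug (qrepr u).

Lemma qaug_pi x : qaug (qpi x) = aug x.
Proof.
apply/eqP; rewrite -subr_eq0 -raddfB; apply/eqP/aug_ideal/qpiP.
exact: qreprK.
Qed.

Fact qaug_scalar : scalar qaug.
Proof.
move=> a u v; rewrite -(qreprK u) -(qreprK v) -linearP !qaug_pi.
by rewrite linearP.
Qed.
Fact qaug_monoid : monoid_morphism qaug.
Proof.
split=> [|u v]; first by rewrite -[1]/(qpi 1) qaug_pi rmorph1.
by rewrite -(qreprK u) -(qreprK v) -rmorphM !qaug_pi rmorphM.
Qed.
HB.instance Definition _ := Algebra_hasAug.Build K Q qaug_scalar qaug_monoid.

End QuotientAlgebra.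

(* -------------------------------------------------------------------- *)
Definition freealg (K : fieldType) (X : choiceType) : Type :=
  {malg K[{fmonom X}]}.

Section FreeAlgebra.
Variables (K : fieldType) (X : choiceType).
Local Notation F := (freealg K X).

HB.instance Definition _ := GRing.Lalgebra.on F.

Fact freealg_scaleAr (a : K) (u v : F) : a *: (u * v) = u * (a *: v).
Proof.
have aC (c : K) (w : {malg K[{fmonom X}]}) : c%:MP * w = w * c%:MP.
  rewrite !malgM_def fgmulUg fgmulgU; apply: eq_bigr => k _.
  by rewrite mul1m mulm1 mulrC.
rewrite -[a *: v]mul_malgC -[LHS]mul_malgC aC -mulrA; congr (_ * _).
by rewrite aC.
Qed.
HB.instance Definition _ := GRing.Lalgebra_isAlgebra.Build K F freealg_scaleAr.

Definition freeaug (u : F) : K := mcoeff (mone : {fmonom X}) u.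

Fact freeaug_scalar : scalar freeaug.
Proof. by move=> a u v; rewrite /freeaug mcoeffD mcoeffZ. Qed.
Fact freeaug_monoid : monoid_morphism freeaug.
Proof.
have [mM m1] := @mcoeff1g_is_multiplicative {fmonom X} K.
by split=> [|u v]; [exact: m1 | exact: mM].
Qed.
HB.instance Definition _ := Algebra_hasAug.Build K F freeaug_scalar freeaug_monoid.

Definition freegen (x : X) : F := << fmu x >>.

Lemma aug_freegen x : aug (freegen x) = 0.
Proof. by rewrite /aug /= /freeaug mcoeffU1 -fdeg_eq0 fdegU. Qed.

End FreeAlgebra.

Arguments freegen {K X} x.

(* -------------------------------------------------------------------- *)
Section TensorProduct.
Variables (K : fieldType) (V W : lmodType K).

Definition bilin_rel : set {malg K[(V * W)%type]} :=
  [set r | (exists a v v' w,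
              r = << (a *: v + v', w) >> - a *: << (v, w) >> - << (v', w) >>)
        \/ (exists a v w w',
              r = << (v, a *: w + w') >> - a *: << (v, w) >> - << (v, w') >>)].

Definition tprod : Type := quo (span bilin_rel).
HB.instance Definition _ := GRing.Lmodule.on tprod.

Definition tpure (v : V) (w : W) : tprod := quo_pi _ << (v, w) >>.

End TensorProduct.

(* -------------------------------------------------------------------- *)
(* T(V) is the free associative algebra on the set V modulo linearity of the
   inclusion of V. *)
Section TensorAlgebra.
Variables (K : fieldType) (V : lmodType K).

Definition tens_rel : set (freealg K V) :=
  [set r | exists a x y,
             r = freegen (a *: x + y) - a *: freegen x - freegen y].

Fact aug_tens_rel r : tens_rel r -> aug r = 0.
Proof.
move=> [a [x [y ->]]].
by rewrite !raddfB /= linearZ /= !aug_freegen mulr0 !subr0.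
Qed.

Definition tensalg : Type := quoalg (Relators aug_tens_rel).
HB.instance Definition _ := AugAlgebra.on tensalg.

Definition tens_in (v : V) : tensalg := qpi _ (freegen v).

Lemma aug_tens_in v : aug (tens_in v) = 0.
Proof. by rewrite [LHS]qaug_pi aug_freegen. Qed.

End TensorAlgebra.

Arguments tens_in {K V} v.

(* With i the inclusion of generators, [word i [:: x_1; ..; x_n]] is
   x_1 (x) .. (x) x_n in T(W), the symmetric product in S(W), and
   x_1 * .. * x_n in U(W). *)
Definition word (K : fieldType) (W : lmodType K) (A : algType K) (i : W -> A)
  (x : seq W) : A := \prod_(w <- x) i w.

(* The positive part: (+)_{n >= 1} of the n-fold products. *)
Definition reduced (K : fieldType) (W : lmodType K) (A : algType K)
    (i : W -> A) : submodClosed A :=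
  span [set y | exists2 x : seq W, x != [::] & y = word i x].

(* A word viewed in the positive part; the default value 0 of [insubd] is
   only used for the empty word. *)
Definition rword (K : fieldType) (W : lmodType K) (A : algType K) (i : W -> A)
  (x : seq W) : subsp (reduced i) := insubd 0 (word i x).

(* The graded commutator of a and b, homogeneous of degrees p and q. *)
Definition gcomm (K : fieldType) (A : algType K) (p q : int) (a b : A) : A :=
  a * b - ((-1 : K) ^ (p * q)) *: (b * a).

(* -------------------------------------------------------------------- *)
Section Graded.
Variables (K : fieldType) (V : lmodType K) (gr : int -> submodClosed V).

Record is_graded : Prop := {
  graded_dec : forall x : V, exists (s : seq int) (f : int -> V),
    (forall p, f p \in gr p) /\ x = \sum_(p <- s) f p;
  graded_free : forall (s : seq int) (f : int -> V),
    uniq s -> (forall p, f p \in gr p) -> \sum_(p <- s) f p = 0 ->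
    forall p, p \in s -> f p = 0 }.

(* x_i is homogeneous of degree e_i for each i, and the sizes agree. *)
Definition homog (e : seq int) (x : seq V) : bool :=
  all2 (fun p v => v \in gr p) e x.

Definition word_gr (A : algType K) (i : V -> A) (p : int) : submodClosed A :=
  span [set y | exists e x,
          [/\ homog e x, \sum_(q <- e) q = p & y = word i x]].

Lemma sub_gr_closed (S : submodClosed V) p :
  GRing.submod_closed (fun x : subsp S => val x \in gr p).
Proof.
split=> [|a x y xp yp].
  by rewrite -[_ \in _]/(val (0 : subsp S) \in gr p) raddf0 rpred0.
rewrite -[_ \in _]/(val (a *: x + y) \in gr p) linearP.
by rewrite rpredD ?rpredZ.
Qed.

Definition sub_gr (S : submodClosed V) (p : int) : submodClosed (subsp S) :=
  submod_of (sub_gr_closed S p).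

(* A family of maps f_k on the k-fold tensor powers, k >= 1, is encoded as one
   function on sequences: f_k (x_1, .., x_k) is [f [:: x_1; ..; x_k]].  The
   value at the empty sequence is never used. *)
Definition multilinear (U : lmodType K) (f : seq V -> U) : Prop :=
  forall s1 s2 a x y,
    f (s1 ++ (a *: x + y) :: s2) = a *: f (s1 ++ x :: s2) + f (s1 ++ y :: s2).

Definition degree1 (f : seq V -> V) : Prop :=
  forall e x, homog e x -> x != [::] -> f x \in gr (\sum_(p <- e) p + 1).

End Graded.

(* -------------------------------------------------------------------- *)
(* Positions are numbered from 0: s is increasing on the first p of them and
   on the last q. *)
Definition shuffle (p q : nat) (s : 'S_(p + q)) : bool :=
  [forall i : 'I_(p + q), forall j : 'I_(p + q),
     (i < j)%N && ((j < p)%N || (p <= i)%N) ==> (s i < s j)%N].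

(* (x_{s(1)}, .., x_{s(n)}); x may be longer than n, its tail is dropped. *)
Definition permute (Z : zmodType) n (s : 'S_n) (x : seq Z) : seq Z :=
  [seq x`_(s i) | i <- enum 'I_n].

(* The sign with x_1 .. x_n = koszul s e *: x_{s(1)} .. x_{s(n)} in the graded
   symmetric algebra. *)
Definition koszul (K : fieldType) n (s : 'S_n) (e : seq int) : K :=
  \prod_(i < n) \prod_(j < n | (i < j)%N && (s j < s i)%N)
    (-1) ^ (e`_(s i) * e`_(s j)).
Arguments koszul {K n} s e.

(* -------------------------------------------------------------------- *)
Section Leibniz.
Variables (K : fieldType) (V : lmodType K) (gr : int -> submodClosed V).
Variable theta : seq V -> V.

(* For a (p,q)-shuffle s of the first p+q arguments, [leib_word] is
     x_{s(1)}, .., x_{s(p)},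
       theta_{q+1}(x_{s(p+1)}, .., x_{s(p+q)}, x_{p+q+1}), x_{p+q+2}, .., x_n
   and [leib_sign] is (-1)^{x_{s(1)} + .. + x_{s(p)}} times the Koszul sign. *)
Definition leib_sign p q (s : 'S_(p + q)) (e : seq int) : K :=
  (-1) ^ (\sum_(d <- take p (permute s e)) d) * koszul s e.
Arguments leib_sign {p q} s e.

Definition leib_word p q (s : 'S_(p + q)) (x : seq V) : seq V :=
  let y := permute s x in
  take p y ++ theta (rcons (drop p y) x`_(p + q)%N) :: drop (p + q).+1 x.

Record Leibniz_infty : Prop := {
  leib_graded : is_graded gr;
  leib_multilinear : multilinear theta;
  leib_degree : degree1 gr theta;
  leib_identity : forall e x, homog gr e x -> x != [::] ->
    \sum_(1 <= i < (size x).+1) \sum_(1 <= k < (size x - i + 1).+1)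
      \sum_(s : 'S_(k.-1 + i.-1) | shuffle s)
        leib_sign s e *: theta (leib_word s x) = 0 }.

Definition rtens : lmodType K := subsp (reduced (@tens_in K V)).

(* d_k vanishes on words of length n < k, hence the bound k <= n. *)
Definition is_leib_d (f : rtens -> rtens) : Prop :=
  linear f /\ forall e x, homog gr e x -> x != [::] ->
    f (rword tens_in x) =
    \sum_(1 <= k < (size x).+1) \sum_(1 <= j < (size x + 1 - k).+1)
      \sum_(s : 'S_(j.-1 + k.-1) | shuffle s)
        leib_sign s e *: rword tens_in (leib_word s x).

(* Here and for [rsym_coprod], [Phi] and [Psi] below: THE linear map with the
   given values on words.  It is unique because those words span, and it
   exists because the formula is multilinear (and compatible with the
   relations of S(L) in the case of [rsym_coprod] and [Psi]). *)
Definition leib_d : rtens -> rtens :=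
  xget (fun=> 0) [set f | is_leib_d f].

End Leibniz.

(* -------------------------------------------------------------------- *)
Section Linfty.
Variables (K : fieldType) (L : lmodType K) (gr : int -> submodClosed L).
Variable l : seq L -> L.

Record Linfty : Prop := {
  linf_graded : is_graded gr;
  linf_multilinear : multilinear l;
  linf_degree : degree1 gr l;
  linf_sym : forall e x (s : 'S_(size x)), homog gr e x -> x != [::] ->
    l x = koszul s e *: l (permute s x);
  linf_identity : forall e x, homog gr e x -> x != [::] ->
    \sum_(1 <= i < (size x).+1) \sum_(s : 'S_(i + (size x - i)) | shuffle s)
      koszul s e *: l (l (take i (permute s x)) :: drop i (permute s x)) = 0 }.

End Linfty.

(* -------------------------------------------------------------------- *)
Section Coalgebra.
Variables (K : fieldType) (C : lmodType K) (gr : int -> submodClosed C).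
Variables (Delta : C -> tprod C C) (D : C -> C).

(* [codiff_coder] is Delta D = (D (x) id + id (x) D) Delta in Sweedler notation:
   Delta x is written with left factors c.1.2 homogeneous of degree c.1.1,
   and id (x) D, D being of degree 1, acquires the sign (-1)^c.1.1. *)
Record codifferential : Prop := {
  codiff_linear : linear D;
  codiff_degree : forall p x, x \in gr p -> D x \in gr (p + 1);
  codiff_square : forall x, D (D x) = 0;
  codiff_coder : forall x (s : seq (int * C * C)),
    (forall c, c \in s -> c.1.2 \in gr c.1.1) ->
    Delta x = \sum_(c <- s) tpure c.1.2 c.2 ->
    Delta (D x) = \sum_(c <- s) (tpure (D c.1.2) c.2
                                 + (-1 : K) ^ c.1.1 *: tpure c.1.2 (D c.2)) }.

End Coalgebra.

(* -------------------------------------------------------------------- *)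
(* The reduced symmetric coalgebra: positive part of S(L) = T(L)/(graded
   commutators) with the reduced unshuffle coproduct. *)
Section SymmetricCoalgebra.
Variables (K : fieldType) (L : lmodType K) (gr : int -> submodClosed L).

Definition sym_rel : set (tensalg L) :=
  [set r | exists p q a b,
             [/\ a \in gr p, b \in gr q & r = gcomm p q (tens_in a) (tens_in b)]].

Fact aug_gcomm p q (a b : L) : aug (gcomm p q (tens_in a) (tens_in b)) = 0.
Proof.
by rewrite raddfB /= linearZ /= !rmorphM /= !aug_tens_in !mul0r mulr0 subr0.
Qed.

Fact aug_sym_rel r : sym_rel r -> aug r = 0.
Proof. by move=> [p [q [a [b [_ _ ->]]]]]; apply: aug_gcomm. Qed.

Definition symalg : Type := quoalg (Relators aug_sym_rel).
HB.instance Definition _ := AugAlgebra.on symalg.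

Definition sym_in (a : L) : symalg := qpi _ (tens_in a).

Definition rsym : lmodType K := subsp (reduced sym_in).
Definition rsym_gr : int -> submodClosed rsym :=
  sub_gr (word_gr gr sym_in) (reduced sym_in).

Definition is_rsym_coprod (f : rsym -> tprod rsym rsym) : Prop :=
  linear f /\ forall e x, homog gr e x -> x != [::] ->
    f (rword sym_in x) =
    \sum_(1 <= i < size x) \sum_(s : 'S_(i + (size x - i)) | shuffle s)
      koszul s e *: tpure (rword sym_in (take i (permute s x)))
                            (rword sym_in (drop i (permute s x))).

Definition rsym_coprod : rsym -> tprod rsym rsym :=
  xget (fun=> 0) [set f | is_rsym_coprod f].

(* D is the coderivation whose Taylor coefficients are the l_k. *)
Definition coder_of (l : seq L -> L) (D : rsym -> rsym) : Prop :=
  forall e x, homog gr e x -> x != [::] ->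
    D (rword sym_in x) =
    \sum_(1 <= i < (size x).+1) \sum_(s : 'S_(i + (size x - i)) | shuffle s)
      koszul s e *:
        rword sym_in (l (take i (permute s x)) :: drop i (permute s x)).

End SymmetricCoalgebra.

Arguments rsym {K L} gr.
Arguments rsym_gr {K L} gr p.
Arguments rsym_coprod {K L} gr x.
Arguments sym_in {K L} gr a.

(* -------------------------------------------------------------------- *)
Section FreeLie.
Variables (K : fieldType) (V : lmodType K) (gr : int -> submodClosed V).

Definition tens_gr : int -> submodClosed (tensalg V) := word_gr gr tens_in.

(* The smallest subspace containing V and closed under brackets of homogeneous
   elements; it is automatically a graded subspace, spanned by the iterated
   brackets of homogeneous elements of V. *)
Definition freelie_pred : {pred tensalg V} :=
  fun y => `[< forall S : submodClosed (tensalg V),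
    (forall v, tens_in v \in S) ->
    (forall p q a b, a \in tens_gr p -> b \in tens_gr q ->
       a \in S -> b \in S -> gcomm p q a b \in S) ->
    y \in S >].

Fact freelie_closed : GRing.submod_closed freelie_pred.
Proof.
split=> [|a x y]; first by apply/asboolP => S _ _; apply: rpred0.
move=> /asboolP xS /asboolP yS; apply/asboolP => S SV SL.
by rewrite rpredD ?rpredZ ?xS ?yS.
Qed.

Definition freelie : lmodType K := subsp (submod_of freelie_closed).
Definition freelie_gr : int -> submodClosed freelie :=
  sub_gr tens_gr (submod_of freelie_closed).

Fact tens_in_freelie v : tens_in v \in submod_of freelie_closed.
Proof. by apply/asboolP => S SV _; apply: SV. Qed.

Definition lie_in (v : V) : freelie := exist _ (tens_in v) (tens_in_freelie v).

(* a (x) b - (-1)^{pq} b (x) a - [a, b], where c = [a, b] in Lie(V). *)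
Definition uea_rel : set (tensalg freelie) :=
  [set r | exists p q (a b c : freelie),
     [/\ a \in freelie_gr p, b \in freelie_gr q,
         val c = gcomm p q (val a) (val b)
       & r = gcomm p q (tens_in a) (tens_in b) - tens_in c]].

Fact aug_uea_rel r : uea_rel r -> aug r = 0.
Proof.
move=> [p [q [a [b [c [_ _ _ ->]]]]]].
by rewrite raddfB /= aug_gcomm aug_tens_in subr0.
Qed.

Definition uea : Type := quoalg (Relators aug_uea_rel).
HB.instance Definition _ := AugAlgebra.on uea.

Definition uea_in (a : freelie) : uea := qpi _ (tens_in a).
Definition ruea : lmodType K := subsp (reduced uea_in).

Definition is_Phi (f : tensalg V -> uea) : Prop :=
  linear f /\ forall x : seq V,
    f (word tens_in x) = word uea_in (map lie_in x).

Definition Phi : tensalg V -> uea := xget (fun=> 0) [set f | is_Phi f].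

Definition is_Psi (f : symalg freelie_gr -> uea) : Prop :=
  linear f /\ forall e x, homog freelie_gr e x ->
    f (word (sym_in freelie_gr) x) =
    ((size x)`!%:R : K)^-1 *:
      \sum_(s : 'S_(size x)) koszul s e *: word uea_in (permute s x).

Definition Psi : symalg freelie_gr -> uea := xget (fun=> 0) [set f | is_Psi f].

End FreeLie.

Arguments freelie {K V} gr.
Arguments freelie_gr {K V} gr p.
Arguments uea {K V} gr.
Arguments uea_in {K V} gr a.
Arguments ruea {K V} gr.
Arguments Phi {K V} gr x.
Arguments Psi {K V} gr x.

(* The default value 0 of [insubd] is only used where f x is not in T. *)
Definition restrict (K : fieldType) (V W : lmodType K) (S : submodClosed V)
  (T : submodClosed W) (f : V -> W) (x : subsp S) : subsp T :=
  insubd 0 (f (val x)).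
Arguments restrict {K V W} S T f x.

Section Transported.
Variables (K : fieldType) (V : lmodType K) (gr : int -> submodClosed V).
Variable theta : seq V -> V.

Definition rPhi : rtens V -> ruea gr :=
  restrict (reduced tens_in) (reduced (uea_in gr)) (Phi gr).

Definition rPsi : rsym (freelie_gr gr) -> ruea gr :=
  restrict (reduced (sym_in (freelie_gr gr))) (reduced (uea_in gr)) (Psi gr).

(* Psi^-1 o Phi o d o Phi^-1 o Psi; ['pinv_(_) setT f] is the inverse of the
   bijection f. *)
Definition transported : rsym (freelie_gr gr) -> rsym (freelie_gr gr) :=
  'pinv_(fun=> 0) setT rPsi \o rPhi \o leib_d gr theta
    \o 'pinv_(fun=> 0) setT rPhi \o rPsi.

End Transported.

Arguments transported {K V} gr theta x.

(* Main.v *)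
(* The formula for d says that d is the coderivation of the cofree Zinbiel
   coalgebra on V with corestriction theta; it is therefore also a coderivation
   of the coshuffle coproduct, and d^2 = 0 because the Leibniz identities say
   that theta vanishes on the image of d.

   Phi identifies U(Lie V) with T(V), so that Psi becomes the symmetrization
   S(Lie V) -> T(V).  Elements of Lie V are primitive, hence the square of the
   identity for the convolution product acts on symmetrized words of length n
   as 2^n; in characteristic 0 this splits T(V) into the symmetric powers of
   its primitive part, and an induction on the length shows that
   symmetrization is an isomorphism of coalgebras.

   The transported map is then a coderivation of S(Lie V) of square 0.  A
   coderivation is determined by its corestriction to Lie V, whose values on
   words are the brackets l_k; the generalized Jacobi identities are the
   corestriction of the square. *)

Require Import Defs.
From HB Require Import structures.
From mathcomp Require Import all_boot all_order all_algebra perm.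
From mathcomp Require Import finmap monalg.
From mathcomp Require Import boolp classical_sets functions.
From mathcomp Require Import zify ssrAC.
Import Defs.

Set Implicit Arguments.
Unset Strict Implicit.
Unset Printing Implicit Defensive.

Import GRing.Theory.
Local Open Scope ring_scope.

(** * Linear maps out of spans, quotients and tensor products *)

(** Koszul signs make sense only for homogeneous vectors, so everything is computed on words whose
    letters carry a degree. Sums over shuffles are handled by [conv], a recursion on the first
    letter; permutations reappear only when results are compared with the definitions. T and S enter
    through the universal property [galg] alone and come without a basis, so directness of a grading
    is read off an operator with distinct eigenvalues 2^p, for degrees as well as for numbers of Lie
    factors. Primitivity of x is expressed by left multiplication by x being a coderivation: this
    avoids a signed product on the tensor square and turns closure under brackets into a statement
    on commutators of operators. No Poincare-Birkhoff-Witt theorem is assumed: symmetrized words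
    span because reordering Lie factors costs only shorter words, and the inverse is a convolution
    exponential of the projection onto Lie(V). Commutators of Zinbiel coderivations are computed for
    arbitrary corestrictions, because removing the first letter of a word changes the
    corestriction. *)

Definition mklin (K : fieldType) (U V : lmodType K) (f : U -> V)
    (lf : linear f) : {linear U -> V} :=
  HB.pack_for {linear U -> V} f (GRing.isLinear.Build K U V *:%R f lf).

Section SpanTheory.
Variables (K : fieldType) (V : lmodType K).

Lemma span_sub (X : set V) (S : submodClosed V) :
  (forall x, X x -> x \in S) -> forall y, y \in span X -> y \in S.
Proof. by move=> XS y /asboolP; apply. Qed.

Lemma span_mono (X Y : set V) y :
  (forall x, X x -> Y x) -> y \in span X -> y \in span Y.
Proof. by move=> XY; apply: span_sub => x /XY; apply: mem_span. Qed.

Lemma eq_lin_span (W : lmodType K) (f g : {linear V -> W}) (X : set V) :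
  (forall x, X x -> f x = g x) -> forall y, y \in span X -> f y = g y.
Proof.
move=> fg; apply: span_ind => [|a x y fx fy|]; rewrite ?linear0 //.
by rewrite !linearP fx fy.
Qed.

Lemma span_lin (W : lmodType K) (f : {linear V -> W}) (X : set V)
    (S : submodClosed W) :
  (forall x, X x -> f x \in S) -> forall y, y \in span X -> f y \in S.
Proof.
move=> fS; apply: span_ind => [|a x y fx fy|]; rewrite ?linear0 ?rpred0 //.
by rewrite linearP rpredD ?rpredZ.
Qed.

End SpanTheory.

Section FreeModule.
Variables (K : fieldType) (I : choiceType) (Z : lmodType K).

Definition malg_lift_fun (h : I -> Z) (g : {malg K[I]}) : Z :=
  \sum_(k <- msupp g) mcoeff k g *: h k.

Lemma malg_liftEw (h : I -> Z) (d : {fset I}) g :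
  fsubset (msupp g) d -> malg_lift_fun h g = \sum_(k <- d) mcoeff k g *: h k.
Proof.
move=> sgd; apply: (big_fset_incl _ sgd) => k _ /mcoeff_outdom ->.
by rewrite scale0r.
Qed.

Lemma malg_lift_linear h : linear (malg_lift_fun h).
Proof.
move=> a x y; pose d := fsetU (msupp x) (msupp y).
have xd : fsubset (msupp x) d by apply: fsubsetUl.
have yd : fsubset (msupp y) d by apply: fsubsetUr.
have xyd : fsubset (msupp (a *: x + y)) d.
  apply: fsubset_trans (msuppD_le _ _) _; rewrite fsubUset yd andbT.
  exact: fsubset_trans (msuppZ_le _ _) xd.
rewrite !(malg_liftEw h (d := d)) // scaler_sumr -big_split /=.
by apply: eq_bigr => k _; rewrite mcoeffD mcoeffZ scalerDl scalerA.
Qed.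

Definition malg_lift h := mklin (malg_lift_linear h).

Lemma malg_liftU h k : malg_lift h << k >> = h k.
Proof.
rewrite -[LHS]/(malg_lift_fun h << k >>) /malg_lift_fun msuppU oner_eq0 big_seq_fset1.
by rewrite mcoeffUU scale1r.
Qed.

Lemma malg_span (x : {malg K[I]}) : x \in span [set y | exists k, y = << k >>].
Proof.
rewrite [x]monalgE; apply: rpred_sum => k _.
have -> : << mcoeff k x *g k >> = mcoeff k x *: << k >>.
  by apply/malgP=> l; rewrite mcoeffZ !mcoeffU mulr_natr.
by apply: rpredZ; apply: mem_span; exists k.
Qed.

End FreeModule.

Section QuotientLift.
Variables (K : fieldType) (V : lmodType K) (S : submodClosed V).
Variables (Z : lmodType K) (f : {linear V -> Z}).
Hypothesis fS : forall x, x \in S -> f x = 0.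

Lemma quo_liftE x : f (quo_repr (quo_pi S x)) = f x.
Proof.
apply/eqP; rewrite -subr_eq0 -linearB; apply/eqP/fS/quo_piP.
exact: quo_reprK.
Qed.

Lemma quo_lift_linear : linear (f \o @quo_repr K V S).
Proof.
move=> a u v; rewrite -(quo_reprK u) -(quo_reprK v) -linearP /=.
by rewrite !quo_liftE linearP.
Qed.

Definition quo_lift : {linear quo S -> Z} := mklin quo_lift_linear.

Lemma quo_lift_pi x : quo_lift (quo_pi S x) = f x.
Proof. exact: quo_liftE. Qed.

End QuotientLift.

Section TensorProductTheory.
Variables (K : fieldType) (V W : lmodType K).

Lemma tpurePl (a : K) (v v' : V) (w : W) :
  tpure (a *: v + v') w = a *: tpure v w + tpure v' w.
Proof.
rewrite /tpure -linearP; apply/quo_piP; rewrite opprD addrA.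
by apply: mem_span; left; exists a, v, v', w.
Qed.

Lemma tpurePr (a : K) (v : V) (w w' : W) :
  tpure v (a *: w + w') = a *: tpure v w + tpure v w'.
Proof.
rewrite /tpure -linearP; apply/quo_piP; rewrite opprD addrA.
by apply: mem_span; right; exists a, v, w, w'.
Qed.

Definition tpurel (w : W) : {linear V -> tprod V W} :=
  mklin (fun a v v' => tpurePl a v v' w).
Definition tpurer (v : V) : {linear W -> tprod V W} :=
  mklin (fun a w w' => tpurePr a v w w').

Lemma tprod_span (x : tprod V W) :
  x \in span [set y | exists v w, y = tpure v w].
Proof.
rewrite -(quo_reprK x); move: (quo_repr x) (malg_span (quo_repr x)) => {x}.
apply: (span_lin (f := quo_pi (span (@bilin_rel K V W)))) => _ [[v w] ->].
by apply: mem_span; exists v, w.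
Qed.

Lemma eq_lin_tprod (Z : lmodType K) (f g : {linear tprod V W -> Z}) :
  (forall v w, f (tpure v w) = g (tpure v w)) -> f =1 g.
Proof. by move=> fg x; apply: eq_lin_span (tprod_span x) => _ [v [w ->]]. Qed.

Section Lift.
Variables (Z : lmodType K) (b : V -> W -> Z).
Hypothesis bl : forall a v v' w, b (a *: v + v') w = a *: b v w + b v' w.
Hypothesis br : forall a v w w', b v (a *: w + w') = a *: b v w + b v w'.

Lemma tprod_lift0 x :
  x \in span (@bilin_rel K V W) -> malg_lift (fun p => b p.1 p.2) x = 0.
Proof.
move: x; apply: span_ind => [|a x y x0 y0|x]; first exact: linear0.
  by rewrite linearP x0 y0 scaler0 addr0.
case=> [[a [v [v' [w ->]]]]|[a [v [w [w' ->]]]]].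
  by rewrite !linearB linearZ !malg_liftU /= bl -addrA -opprD subrr.
by rewrite !linearB linearZ !malg_liftU /= br -addrA -opprD subrr.
Qed.

Definition tprod_lift : {linear tprod V W -> Z} :=
  quo_lift tprod_lift0.

Lemma tprod_liftE v w : tprod_lift (tpure v w) = b v w.
Proof. by rewrite [LHS]quo_lift_pi malg_liftU. Qed.

End Lift.
End TensorProductTheory.

Section LinearFunctions.
Variable K : fieldType.

Fact lmul_linear (A : algType K) (a : A) : linear (fun x : A => a * x).
Proof. by move=> c x y; rewrite mulrDr scalerAr. Qed.
Definition lmul (A : algType K) (a : A) : {linear A -> A} :=
  mklin (lmul_linear a).

Fact idl_linear (V : lmodType K) : linear (fun x : V => x).
Proof. by []. Qed.
Definition idl (V : lmodType K) : {linear V -> V} := mklin (@idl_linear V).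

Fact comp_linear (U V W : lmodType K) (f : {linear V -> W})
  (g : {linear U -> V}) : linear (fun x => f (g x)).
Proof. by move=> a x y; rewrite !linearP. Qed.
Definition compl (U V W : lmodType K) (f : {linear V -> W})
  (g : {linear U -> V}) : {linear U -> W} := mklin (comp_linear f g).

End LinearFunctions.

(* Sealing the tensor product keeps unification from unfolding tprod. *)
Record tensor (K : fieldType) (V W : lmodType K) := Tensor {
  tens_sort :> lmodType K;
  tens_pure : V -> W -> tens_sort;
  tens_purePl : forall a v v' w,
    tens_pure (a *: v + v') w = a *: tens_pure v w + tens_pure v' w;
  tens_purePr : forall a v w w',
    tens_pure v (a *: w + w') = a *: tens_pure v w + tens_pure v w';
  tens_eq : forall (Z : lmodType K) (f g : {linear tens_sort -> Z}),
    (forall v w, f (tens_pure v w) = g (tens_pure v w)) -> f =1 g;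
  tens_ex : forall (Z : lmodType K) (b : V -> W -> Z),
    (forall a v v' w, b (a *: v + v') w = a *: b v w + b v' w) ->
    (forall a v w w', b v (a *: w + w') = a *: b v w + b v w') ->
    exists f : {linear tens_sort -> Z}, forall v w, f (tens_pure v w) = b v w }.

(** Opaque on purpose, although it is data: afterwards only the fields of [tensor] can be used. *)
Lemma tens (K : fieldType) (V W : lmodType K) : tensor V W.
Proof.
apply: (@Tensor K V W (tprod V W) (@tpure K V W)).
- exact: tpurePl.
- exact: tpurePr.
- exact: eq_lin_tprod.
- by move=> Z b bl br; exists (tprod_lift bl br) => v w; apply: tprod_liftE.
Qed.

Section TensorMaps.
Variables (K : fieldType) (V W : lmodType K).

Definition tp (v : V) (w : W) : tens V W := tens_pure (tens V W) v w.
Definition tpl (w : W) : {linear V -> tens V W} :=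
  mklin (fun a v v' => tens_purePl (tens V W) a v v' w).
Definition tpr (v : V) : {linear W -> tens V W} :=
  mklin (fun a w w' => tens_purePr (tens V W) a v w w').

Lemma tpBl v v' w : tp (v - v') w = tp v w - tp v' w.
Proof. exact: (linearB (tpl w)). Qed.
Lemma tpBr v w w' : tp v (w - w') = tp v w - tp v w'.
Proof. exact: (linearB (tpr v)). Qed.
Lemma tpZl a v w : tp (a *: v) w = a *: tp v w.
Proof. exact: (linearZZ (tpl w)). Qed.
Lemma tpZr a v w : tp v (a *: w) = a *: tp v w.
Proof. exact: (linearZZ (tpr v)). Qed.
Lemma tp0l w : tp 0 w = 0.
Proof. exact: (linear0 (tpl w)). Qed.
Lemma tp0r v : tp v 0 = 0.
Proof. exact: (linear0 (tpr v)). Qed.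
Lemma tpPl a v v' w : tp (a *: v + v') w = a *: tp v w + tp v' w.
Proof. exact: (linearP (tpl w)). Qed.
Lemma tpPr a v w w' : tp v (a *: w + w') = a *: tp v w + tp v w'.
Proof. exact: (linearP (tpr v)). Qed.

Lemma eq_tens (Z : lmodType K) (f g : {linear tens V W -> Z}) :
  (forall v w, f (tp v w) = g (tp v w)) -> f =1 g.
Proof. exact: tens_eq. Qed.

Section Lift.
Variables (Z : lmodType K) (b : V -> W -> Z).
Hypothesis bl : forall a v v' w, b (a *: v + v') w = a *: b v w + b v' w.
Hypothesis br : forall a v w w', b v (a *: w + w') = a *: b v w + b v w'.

Definition tens_lift : {linear tens V W -> Z} := sval (cid (tens_ex (tens V W) bl br)).

Lemma tens_liftE v w : tens_lift (tp v w) = b v w.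
Proof. exact: (svalP (cid (tens_ex (tens V W) bl br))). Qed.

End Lift.

End TensorMaps.

Lemma eq_tens_comp (K : fieldType) (V W A B Z : lmodType K)
    (f1 : {linear A -> Z}) (f2 : {linear tens V W -> A})
    (g1 : {linear B -> Z}) (g2 : {linear tens V W -> B}) :
  (forall v w, f1 (f2 (tp v w)) = g1 (g2 (tp v w))) ->
  forall z, f1 (f2 z) = g1 (g2 z).
Proof. exact: (@eq_tens _ _ _ _ (compl f1 f2) (compl g1 g2)). Qed.

Section TensorMap.
Variables (K : fieldType) (V W V' W' : lmodType K).
Variables (f : {linear V -> V'}) (g : {linear W -> W'}).

Fact tmap_linl a v v' w :
  tp (f (a *: v + v')) (g w) = a *: tp (f v) (g w) + tp (f v') (g w).
Proof. by rewrite linearP tpPl. Qed.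
Fact tmap_linr a v w w' :
  tp (f v) (g (a *: w + w')) = a *: tp (f v) (g w) + tp (f v) (g w').
Proof. by rewrite linearP tpPr. Qed.

Definition tmap : {linear tens V W -> tens V' W'} :=
  tens_lift tmap_linl tmap_linr.

Lemma tmapE v w : tmap (tp v w) = tp (f v) (g w).
Proof. exact: tens_liftE. Qed.

End TensorMap.

Section TensorMul.
Variables (K : fieldType) (V W : lmodType K) (A : algType K).
Variables (f : {linear V -> A}) (g : {linear W -> A}).

Fact tmul_linl a v v' w :
  f (a *: v + v') * g w = a *: (f v * g w) + f v' * g w.
Proof. by rewrite linearP mulrDl scalerAl. Qed.
Fact tmul_linr a v w w' :
  f v * g (a *: w + w') = a *: (f v * g w) + f v * g w'.
Proof. by rewrite linearP mulrDr scalerAr. Qed.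

Definition tmul : {linear tens V W -> A} := tens_lift tmul_linl tmul_linr.

Lemma tmulE v w : tmul (tp v w) = f v * g w.
Proof. exact: tens_liftE. Qed.

End TensorMul.

(** An ideal is spanned by products around its generators, so a linear map out of a quotient algebra
    has to be tested on all [x * r * y]; this reduces [x] and [y] to a spanning set, in practice to
    words. *)
Lemma lin_mul_span0 (K : fieldType) (A : algType K) (Z : lmodType K)
    (f : {linear A -> Z}) (X : set A) (r : A) :
  (forall x, x \in span X) ->
  (forall x y, X x -> X y -> f (x * r * y) = 0) ->
  forall x y, f (x * r * y) = 0.
Proof.
move=> sX fX x y; move: x (sX x).
apply: span_ind => [|c x x' x0 x'0|x Xx].
- by rewrite !mul0r linear0.
- by rewrite !mulrDl -!scalerAl linearP x0 x'0 scaler0 addr0.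
move: y (sX y); apply: span_ind => [|c y y' y0 y'0|y Xy].
- by rewrite mulr0 linear0.
- by rewrite mulrDr -scalerAr linearP y0 y'0 scaler0 addr0.
exact: fX.
Qed.

Lemma lin_mul_rel0 (K : fieldType) (A : algType K) (Z : lmodType K)
    (f : {linear A -> Z}) (a : K) (x y u v w : A) :
  f (x * u * y) = a *: f (x * v * y) + f (x * w * y) ->
  f (x * (u - a *: v - w) * y) = 0.
Proof.
move=> E; rewrite !mulrBr !mulrBl -scalerAr -scalerAl !linearB linearZ E.
by rewrite /= -addrA -opprD subrr.
Qed.

Section QuotientAlgebraLift.
Variables (K : fieldType) (A : augAlgType K) (R : relators A).
Variables (Z : lmodType K) (f : {linear A -> Z}).
Hypothesis fR : forall a b r, relset R r -> f (a * r * b) = 0.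

Lemma ideal_lift0 x : x \in ideal R -> f x = 0.
Proof.
move: x; apply: span_ind => [|a x y x0 y0|x [a [b [r [Rr ->]]]]].
- exact: linear0.
- by rewrite linearP x0 y0 scaler0 addr0.
- exact: fR.
Qed.

Definition qlift : {linear quoalg R -> Z} := quo_lift ideal_lift0.

Lemma qlift_pi x : qlift (qpi R x) = f x.
Proof. exact: quo_lift_pi. Qed.

End QuotientAlgebraLift.

Section Words.
Variables (K : fieldType) (W : lmodType K) (A : algType K) (i : W -> A).

Lemma word_nil : word i [::] = 1.
Proof. exact: big_nil. Qed.

Lemma word_cons x s : word i (x :: s) = i x * word i s.
Proof. exact: big_cons. Qed.

Lemma word_cat s t : word i (s ++ t) = word i s * word i t.
Proof. exact: big_cat. Qed.

Lemma word1 x : word i [:: x] = i x.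
Proof. by rewrite word_cons word_nil mulr1. Qed.

Lemma word_mid s x t : word i s * i x * word i t = word i (s ++ x :: t).
Proof. by rewrite word_cat word_cons mulrA. Qed.

Lemma word_multilinear : linear i -> multilinear (word i).
Proof.
move=> li s1 s2 a x y; rewrite !word_cat !word_cons li.
by rewrite mulrDl mulrDr -scalerAl -scalerAr.
Qed.

End Words.

Lemma word_map (K : fieldType) (V W : lmodType K) (A : algType K)
  (i : W -> A) (f : V -> W) (s : seq V) : word i (map f s) = word (i \o f) s.
Proof. exact: big_map. Qed.

Lemma word_rmorph (K : fieldType) (W : lmodType K) (A B : algType K)
  (i : W -> A) (f : A -> B) : f 1 = 1 -> {morph f : x y / x * y} ->
  forall s, f (word i s) = word (f \o i) s.
Proof. by move=> f1 fM s; rewrite [LHS](big_morph f fM f1). Qed.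

Lemma lin_word_rel0 (K : fieldType) (W : lmodType K) (A : algType K)
    (i : W -> A) (Z : lmodType K) (f : {linear A -> Z}) (h : seq W -> Z) :
  multilinear h ->
  (forall x, x \in span [set y | exists s, y = word i s]) ->
  (forall s, f (word i s) = h s) ->
  forall c x y a b, f (a * (i (c *: x + y) - c *: i x - i y) * b) = 0.
Proof.
move=> hm sA fh c x y; apply: lin_mul_span0 sA _ => _ _ [s ->] [t ->].
by apply: lin_mul_rel0; rewrite !word_mid !fh hm.
Qed.

Section TensorAlgebraLift.
Variables (K : fieldType) (V : lmodType K).
Local Notation T := (tensalg V).

Lemma tens_in_linear : linear (@tens_in K V).
Proof.
move=> a x y; rewrite /tens_in -[RHS](linearP (qpi _)).
apply/qpiP.
rewrite opprD addrA; apply: mem_span; exists 1, 1.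
exists (freegen (a *: x + y) - a *: freegen x - freegen y).
by rewrite mul1r mulr1; split=> //; exists a, x, y.
Qed.

Lemma freealgU (k : {fmonom V}) :
  << k >> = \prod_(x <- (k : seq V)) freegen x :> freealg K V.
Proof.
case: k => s; elim: s => [|x s IHs]; first by rewrite big_nil -fmoneE.
rewrite big_cons -IHs /= [RHS]malgM_def fgmulUU mulr1.
by congr << _ >>; rewrite [RHS]fmmulE fmuE.
Qed.

Lemma tens_word s : word (@tens_in K V) s =
  qpi (Relators (@aug_tens_rel K V)) (word freegen s).
Proof. by rewrite [RHS](@word_rmorph _ _ _ _ _ (qpi _) (rmorph1 _) (rmorphM _)). Qed.

Lemma tens_span (x : T) :
  x \in span [set y | exists s, y = word tens_in s].
Proof.
rewrite -(qreprK x); move: (qrepr x) (malg_span (qrepr x)) => {x}.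
apply: (span_lin (f := qpi (Relators (@aug_tens_rel K V)))) => _ [k ->].
by apply: mem_span; exists (k : seq V); rewrite tens_word freealgU.
Qed.

Section Lift.
Variables (Z : lmodType K) (h : seq V -> Z) (hm : multilinear h).

Definition free_lift : {linear freealg K V -> Z} :=
  malg_lift (fun k : {fmonom V} => h k).

Lemma free_lift_word s : free_lift (word freegen s) = h s.
Proof.
apply: etrans (congr1 free_lift (esym (freealgU (FMonom s)))) _.
exact: malg_liftU.
Qed.

Lemma freealg_span (x : freealg K V) :
  x \in span [set y | exists s, y = word freegen s].
Proof.
apply: span_mono (malg_span x) => _ [k ->].
by exists (k : seq V); rewrite freealgU.
Qed.

Lemma free_lift0 a b r : tens_rel r -> free_lift (a * r * b) = 0.
Proof.
case=> c [x [y ->]].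
exact: (lin_word_rel0 (f := free_lift) hm freealg_span free_lift_word).
Qed.

Definition tlift : {linear T -> Z} :=
  @qlift K _ (Relators (@aug_tens_rel K V)) Z free_lift free_lift0.

Lemma tlift_word s : tlift (word tens_in s) = h s.
Proof.
rewrite tens_word -(free_lift_word s).
exact: (@qlift_pi K _ (Relators (@aug_tens_rel K V))).
Qed.

End Lift.
End TensorAlgebraLift.

(** * Signed sums over unshuffles *)

Section Signs.
Variable K : fieldType.
Implicit Types V : lmodType K.

(** Signs are Booleans, so that a Koszul sign identity becomes a Boolean identity, settled by cases
    on parities. *)
Definition sg (Z : zmodType) (b : bool) (v : Z) : Z := if b then - v else v.

Lemma sg_sg (Z : zmodType) b c (v : Z) : sg b (sg c v) = sg (b (+) c) v.
Proof. by case: b; case: c; rewrite //= opprK. Qed.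

Lemma sgD (Z : zmodType) b : {morph @sg Z b : x y / x + y}.
Proof. by case: b => // x y; rewrite /= opprD. Qed.

Lemma sg0 (Z : zmodType) b : sg b 0 = 0 :> Z.
Proof. by case: b; rewrite //= oppr0. Qed.

Lemma sgN (Z : zmodType) b (v : Z) : sg b (- v) = - sg b v.
Proof. by case: b. Qed.

Lemma raddf_sg (Z Z' : zmodType) (f : {additive Z -> Z'}) b v :
  f (sg b v) = sg b (f v).
Proof. by case: b; rewrite //= raddfN. Qed.

Lemma lin_sg V (W : lmodType K) (f : {linear V -> W}) b v :
  f (sg b v) = sg b (f v).
Proof. exact: raddf_sg. Qed.

Lemma sgZ V b a (v : V) : sg b (a *: v) = a *: sg b v.
Proof. by case: b; rewrite //= scalerN. Qed.

Lemma sg_mull (A : pzRingType) b (x y : A) : sg b x * y = sg b (x * y).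
Proof. by case: b; rewrite //= mulNr. Qed.

Lemma sg_mulr (A : pzRingType) b (x y : A) : x * sg b y = sg b (x * y).
Proof. by case: b; rewrite //= mulrN. Qed.

Lemma sg_mem V (S : submodClosed V) b x : x \in S -> sg b x \in S.
Proof. by case: b => // xS; rewrite /= -scaleN1r rpredZ. Qed.

Lemma sg_tpl V (W : lmodType K) b (v : V) (w : W) :
  tp (sg b v) w = sg b (tp v w).
Proof. exact: (raddf_sg (tpl V w)). Qed.

Lemma sg_tpr V (W : lmodType K) b (v : V) (w : W) :
  tp v (sg b w) = sg b (tp v w).
Proof. exact: (raddf_sg (tpr W v)). Qed.

Lemma sg_scale V b (v : V) : sg b v = (-1) ^+ b *: v.
Proof. by rewrite scaler_sign. Qed.

Definition oddz (p : int) : bool := odd `|p|.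

Lemma oddzD p q : oddz (p + q) = oddz p (+) oddz q.
Proof.
by rewrite /oddz; lia.
Qed.

Lemma exprz_sg V (p : int) (v : V) : (-1 : K) ^ p *: v = sg (oddz p) v.
Proof.
rewrite sg_scale; congr (_ *: _); rewrite /oddz; case: p => n.
  by rewrite -exprnP signr_odd.
by rewrite NegzE abszN -exprnN signr_odd -[in RHS](invr_sign _ n.+1).
Qed.

Lemma exprzM_sg V (p q : int) (v : V) :
  (-1 : K) ^ (p * q) *: v = sg (oddz p && oddz q) v.
Proof. by rewrite exprz_sg /oddz abszM oddM. Qed.

End Signs.

Section Convolution.
Variables (X : eqType) (par : X -> bool).

Definition pw (w : seq X) : bool := \big[addb/false]_(x <- w) par x.

Lemma pw_nil : pw [::] = false. Proof. exact: big_nil. Qed.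
Lemma pw_cons x w : pw (x :: w) = par x (+) pw w. Proof. exact: big_cons. Qed.
Lemma pw_cat u v : pw (u ++ v) = pw u (+) pw v. Proof. exact: big_cat. Qed.

(* The signed sum of beta u v over the unshuffles (u, v) of w. *)
Fixpoint conv (Z : zmodType) (beta : seq X -> seq X -> Z) (w : seq X) : Z :=
  if w is x :: w' then
    conv (fun u v => beta (x :: u) v) w'
    + conv (fun u v => sg (par x && pw u) (beta u (x :: v))) w'
  else beta [::] [::].

(** The permutation hypothesis is how homogeneity, size, degree and parity pass from [w] to its two
    parts. *)
Lemma eq_conv (Z : zmodType) (b c : seq X -> seq X -> Z) w :
  (forall u v, perm_eq (u ++ v) w -> b u v = c u v) -> conv b w = conv c w.
Proof.
elim: w b c => [|x w IHw] b c bc /=; first exact: bc.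
congr (_ + _); apply: IHw => u v uvw; first by rewrite bc //= perm_cons.
by rewrite bc // -cat1s perm_catCA /= perm_cons.
Qed.

Lemma conv_raddf (Z Z' : zmodType) (f : {additive Z -> Z'}) b w :
  f (conv b w) = conv (fun u v => f (b u v)) w.
Proof.
elim: w b => [//|x w IHw] b /=; rewrite raddfD !IHw; congr (_ + _).
by apply: eq_conv => u v _; rewrite raddf_sg.
Qed.

Lemma conv_lin (K : fieldType) (V W : lmodType K) (f : {linear V -> W}) b w :
  f (conv b w) = conv (fun u v => f (b u v)) w.
Proof. exact: conv_raddf. Qed.

Lemma conv_scale (K : fieldType) (V : lmodType K) (a : K) b w :
  a *: conv b w = conv (fun u v => a *: b u v : V) w.
Proof. exact: (conv_raddf (GRing.scale a)). Qed.

Lemma convD (Z : zmodType) (b c : seq X -> seq X -> Z) w :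
  conv (fun u v => b u v + c u v) w = conv b w + conv c w.
Proof.
elim: w b c => [//|x w IHw] b c /=; rewrite IHw addrACA; congr (_ + _).
by rewrite -IHw; apply: eq_conv => u v _; rewrite sgD.
Qed.

Lemma conv_sg (Z : zmodType) e (b : seq X -> seq X -> Z) w :
  conv (fun u v => sg e (b u v)) w = sg e (conv b w).
Proof.
elim: w b => [//|x w IHw] b /=; rewrite IHw sgD; congr (_ + _).
by rewrite -IHw; apply: eq_conv => u v _; rewrite !sg_sg addbC.
Qed.

Lemma conv_mem (K : fieldType) (Z : lmodType K) (S : submodClosed Z)
    (b : seq X -> seq X -> Z) w :
  (forall u v, perm_eq (u ++ v) w -> b u v \in S) -> conv b w \in S.
Proof.
elim: w b => [|x w IHw] b bS /=; first exact: bS.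
apply: rpredD; apply: IHw => u v uvw; first by rewrite bS //= perm_cons.
by apply: sg_mem; rewrite bS // -cat1s perm_catCA /= perm_cons.
Qed.

Lemma conv_eq0 (Z : zmodType) (b : seq X -> seq X -> Z) w :
  (forall u v, perm_eq (u ++ v) w -> b u v = 0) -> conv b w = 0.
Proof.
elim: w b => [|x w IHw] b b0 /=; first exact: b0.
rewrite !IHw ?addr0 // => u v uvw; last by rewrite b0 //= perm_cons.
by rewrite b0 ?sg0 // -cat1s perm_catCA /= perm_cons.
Qed.

Lemma conv_sum (Z : zmodType) (I : Type) (r : seq I)
    (b : I -> seq X -> seq X -> Z) w :
  conv (fun u v => \sum_(k <- r) b k u v) w = \sum_(k <- r) conv (b k) w.
Proof.
elim: r => [|k r IHr].
  by rewrite big_nil conv_eq0 // => u v _; rewrite big_nil.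
by rewrite big_cons -IHr -convD; apply: eq_conv => u v _; rewrite big_cons.
Qed.

Lemma conv_nil (Z : zmodType) (b : seq X -> seq X -> Z) w :
  (forall x u v, b (x :: u) v = 0) -> conv b w = b [::] w.
Proof.
elim: w b => [//|x w IHw] b b0 /=; rewrite conv_eq0 ?add0r //.
rewrite IHw => [|y u v]; first by rewrite pw_nil andbF.
by rewrite b0 sg0.
Qed.

Lemma pw_perm u v w : perm_eq (u ++ v) w -> pw w = pw u (+) pw v.
Proof. by move=> /(perm_big w) /= E; rewrite /pw -E big_cat. Qed.

(** Coassociativity of unshuffling: both sides run over the signed splittings of [w] into three
    words. *)
Lemma convA (Z : zmodType) (b : seq X -> seq X -> seq X -> Z) w :
  conv (fun u v => conv (b u) v) w =
  conv (fun c v => conv (fun u u' => b u u' v) c) w.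
Proof.
elim: w b => [//|x w IHw] b /=.
rewrite IHw [in RHS]convD -addrA; congr (_ + _).
have -> : conv (fun u v => sg (par x && pw u)
      (conv (fun u0 v0 => b u (x :: u0) v0) v
       + conv (fun u0 v0 => sg (par x && pw u0) (b u u0 (x :: v0))) v)) w
  = conv (fun u v => conv (fun u0 v0 => sg (par x && pw u)
      (b u (x :: u0) v0 + sg (par x && pw u0) (b u u0 (x :: v0)))) v) w.
  by apply: eq_conv => u v _; rewrite -convD conv_sg.
rewrite IHw -convD; apply: eq_conv => c v _.
rewrite -conv_sg -convD; apply: eq_conv => u u' E.
by rewrite (pw_perm E) sgD sg_sg -andb_addr.
Qed.

(** Graded cocommutativity: exchanging the parts costs the sign of moving one past the other. *)
Lemma convC (Z : zmodType) (b : seq X -> seq X -> Z) w :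
  conv b w = conv (fun u v => sg (pw u && pw v) (b v u)) w.
Proof.
elim: w b => [|x w IHw] b /=; first by rewrite pw_nil.
rewrite addrC; congr (_ + _); rewrite IHw; apply: eq_conv => u v _;
  rewrite ?sg_sg pw_cons; congr (sg _ _).
by case: (par x); case: (pw u); case: (pw v).
by case: (par x); case: (pw u); case: (pw v).
Qed.

End Convolution.

Lemma big_uniq_sub (I : eqType) (Z : nmodType) (s t : seq I) (F : I -> Z) :
  uniq s -> uniq t -> {subset s <= t} -> (forall p, p \notin s -> F p = 0) ->
  \sum_(p <- s) F p = \sum_(p <- t) F p.
Proof.
move=> us ut st F0; rewrite [RHS](bigID (mem s)) /= [X in _ + X]big1 // addr0.
rewrite -[RHS]big_filter; apply/perm_big/uniq_perm; rewrite ?filter_uniq // => p.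
rewrite mem_filter /=; case: (boolP (p \in s)) => //= ps.
by rewrite (st _ ps).
Qed.

(** * Multilinear functions on homogeneous words *)

Section Graded.
Variables (K : fieldType) (V : lmodType K) (gr : int -> submodClosed V).

(** Vanishing off [t] makes [f] a function on all degrees, which depends on [x] alone once the sum
    is direct; see [decomposes_uniq]. *)
Definition decomposes (x : V) (t : seq int) (f : int -> V) :=
  [/\ uniq t, forall p, f p \in gr p, forall p, p \notin t -> f p = 0
    & x = \sum_(p <- t) f p].

Lemma decomposes_cat x t f t' : decomposes x t f -> uniq t' ->
  {subset t <= t'} -> x = \sum_(p <- t') f p.
Proof. by case=> ut fg f0 -> ut' tt'; apply: big_uniq_sub. Qed.

Lemma decomposesD a x y tx ty fx fy :
  decomposes x tx fx -> decomposes y ty fy ->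
  decomposes (a *: x + y) (undup (tx ++ ty)) (fun p => a *: fx p + fy p).
Proof.
move=> dx dy; have [ux gx x0 _] := dx; have [uy gy y0 _] := dy.
split=> [||p|]; first exact: undup_uniq.
- by move=> p; rewrite rpredD ?rpredZ.
- by rewrite mem_undup mem_cat negb_or => /andP[/x0-> /y0->]; rewrite scaler0 addr0.
rewrite big_split -scaler_sumr /=; congr (_ *: _ + _).
  by apply: decomposes_cat dx _ _; rewrite ?undup_uniq // => p;
    rewrite mem_undup mem_cat => ->.
by apply: decomposes_cat dy _ _; rewrite ?undup_uniq // => p;
  rewrite mem_undup mem_cat orbC => ->.
Qed.

Lemma decomposes1 p x : x \in gr p ->
  decomposes x [:: p] (fun q => if q == p then x else 0).
Proof.
move=> xp; split=> // [q|q|]; last by rewrite big_seq1 eqxx.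
  by case: eqP => [->|_]; rewrite ?rpred0.
by rewrite inE => /negPf->.
Qed.

Lemma decomposesP : (forall x, exists t f, decomposes x t f) <->
  (forall x : V, exists (s : seq int) (f : int -> V),
    (forall p, f p \in gr p) /\ x = \sum_(p <- s) f p).
Proof.
split=> H x; first by have [t [f [_ fg _ ->]]] := H x; exists t, f.
have [s [f [fg ->]]] := H x; elim: s => [|p s [t [g dg]]].
  exists [::], (fun=> 0); split=> // [q|]; first exact: rpred0.
  by rewrite !big_nil.
rewrite big_cons -[f p]scale1r.
exists (undup ([:: p] ++ t)); eexists; exact: (decomposesD 1 (decomposes1 (fg p)) dg).
Qed.

Lemma graded_dec_span (I : Type) (F : I -> V) (d : I -> int) :
  (forall i, F i \in gr (d i)) ->
  (forall x, x \in span [set y | exists i, y = F i]) ->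
  forall x : V, exists (s : seq int) (f : int -> V),
    (forall p, f p \in gr p) /\ x = \sum_(p <- s) f p.
Proof.
move=> Fd sF; apply/decomposesP => x; move: x (sF x).
apply: span_ind => [|a y z [ty [fy dy]] [tz [fz dz]]|_ [i ->]].
- exists [::], (fun=> 0); split=> // [q|]; first exact: rpred0.
  by rewrite big_nil.
- by exists (undup (ty ++ tz)); eexists; exact: (decomposesD a dy dz).
by exists [:: d i]; eexists; exact: (decomposes1 (Fd i)).
Qed.

(* Components in distinct degrees are eigenvectors of P for distinct
   eigenvalues. *)
Lemma graded_free_eigen (P : {linear V -> V}) (c : int -> K) :
  injective c -> (forall p x, x \in gr p -> P x = c p *: x) ->
  forall (s : seq int) (f : int -> V),
    uniq s -> (forall p, f p \in gr p) -> \sum_(p <- s) f p = 0 ->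
    forall p, p \in s -> f p = 0.
Proof.
move=> c_inj Pc; elim=> [//|q s IHs] f /andP[qs us] fg f0.
have {}IHs p : p \in s -> f p = 0.
  move=> ps; apply: (scalerI (a := c p - c q)).
    by rewrite subr_eq0; apply: contraNneq qs => /c_inj <-.
  rewrite scaler0; move: p ps; apply: IHs => // [p|]; first exact: rpredZ.
  have E : P (\sum_(p <- q :: s) f p) = 0 by rewrite f0 linear0.
  transitivity (P (\sum_(p <- q :: s) f p) - c q *: \sum_(p <- q :: s) f p);
    last by rewrite E f0 scaler0 subr0.
  rewrite linear_sum scaler_sumr -sumrB big_cons (Pc q) // subrr add0r.
  by apply: eq_bigr => p _; rewrite (Pc p) // scalerBl.
move=> p; rewrite inE => /predU1P[->|]; last exact: IHs.
by move: f0; rewrite big_cons big_seq big1 // addr0.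
Qed.

Hypothesis grV : is_graded gr.

Lemma decomposes_uniq x t f t' f' :
  decomposes x t f -> decomposes x t' f' -> f =1 f'.
Proof.
move=> d d' p; apply/eqP; rewrite -subr_eq0; apply/eqP.
have := decomposesD (-1) d d'; rewrite scaleN1r addNr.
case=> u g z0 z; have [pt|/z0 z1] := boolP (p \in undup (t ++ t')); last first.
  by apply/eqP; rewrite -oppr_eq0 opprB addrC -scaleN1r z1.
have := graded_free grV u g (esym z) pt.
by rewrite scaleN1r addrC => /eqP; rewrite subr_eq0 => /eqP->; rewrite subrr.
Qed.

Section Components.
Variables (t : V -> seq int) (f : V -> int -> V).
Hypothesis d : forall x, decomposes x (t x) (f x).
Variables (Z : lmodType K) (G : int -> V -> Z).
Hypothesis Gl : forall p a x y, x \in gr p -> y \in gr p ->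
  G p (a *: x + y) = a *: G p x + G p y.

Definition comp_sum x := \sum_(p <- t x) G p (f x p).

Let G0 p : G p 0 = 0.
Proof.
have := @Gl p (-1) 0 0; rewrite scaler0 addr0 scaleN1r addNr.
by apply; apply: rpred0.
Qed.

Let comp_sumE x t' f' :
  decomposes x t' f' -> comp_sum x = \sum_(p <- t') G p (f' p).
Proof.
move=> d'; have [u' g' z' _] := d'; have [u _ z _] := d x.
have ff' := decomposes_uniq (d x) d'; pose t2 := undup (t x ++ t').
transitivity (\sum_(p <- t2) G p (f' p)).
  under [RHS]eq_bigr do rewrite -ff'.
  apply: big_uniq_sub; rewrite ?undup_uniq // => p; last by move/z->.
  by rewrite mem_undup mem_cat => ->.
apply/esym/big_uniq_sub; rewrite ?undup_uniq // => p; last by move/z'->.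
by rewrite mem_undup mem_cat orbC => ->.
Qed.

Lemma comp_sum_linear : linear comp_sum.
Proof.
move=> a x y; rewrite (comp_sumE (decomposesD a (d x) (d y))).
have [ux fx zx _] := d x; have [uy fy zy _] := d y.
under eq_bigr do rewrite Gl //.
rewrite big_split -scaler_sumr /comp_sum /=; congr (_ *: _ + _); apply/esym;
  apply: big_uniq_sub; rewrite ?undup_uniq // => p; rewrite ?mem_undup ?mem_cat.
- by move=> ->.
- by move/zx->.
- by rewrite orbC => ->.
- by move/zy->.
Qed.

Lemma comp_sum_hom p x : x \in gr p -> comp_sum x = G p x.
Proof.
by move=> xp; rewrite (comp_sumE (decomposes1 xp)) big_seq1 eqxx.
Qed.

End Components.

Lemma graded_comp : exists t f, forall x, decomposes x (t x) (f x).
Proof.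
have /choice[t /choice[f d]] : forall x, exists t f, decomposes x t f.
  by apply/decomposesP; apply: graded_dec grV.
by exists t, f.
Qed.

(** Sum [G] over homogeneous components. Directness makes the result independent of the chosen
    decomposition, and this gives linearity. *)
Lemma graded_lin_ex (Z : lmodType K) (G : int -> V -> Z) :
  (forall p a x y, x \in gr p -> y \in gr p ->
     G p (a *: x + y) = a *: G p x + G p y) ->
  exists g : {linear V -> Z}, forall p x, x \in gr p -> g x = G p x.
Proof.
move=> Gl; have [t [f d]] := graded_comp.
exists (mklin (comp_sum_linear d Gl)) => p x; exact: comp_sum_hom.
Qed.

End Graded.

(** * Words of homogeneous letters *)

Section Letters.
Variables (K : fieldType) (V : lmodType K) (gr : int -> submodClosed V).

(** The degree is stored with the vector because 0 is homogeneous of every degree: no degree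
    function on vectors would do. *)
Definition letter : Type := (int * V)%type.
HB.instance Definition _ := Choice.on letter.

Definition par (l : letter) : bool := oddz l.1.
Definition homw (w : seq letter) : bool := all (fun l => l.2 \in gr l.1) w.
Definition deg (w : seq letter) : int := \sum_(l <- w) l.1.
Definition lw (A : algType K) (i : V -> A) (w : seq letter) : A :=
  word i (unzip2 w).

Lemma deg_nil : deg [::] = 0. Proof. exact: big_nil. Qed.
Lemma deg_cons l w : deg (l :: w) = l.1 + deg w. Proof. exact: big_cons. Qed.
Lemma deg_cat u v : deg (u ++ v) = deg u + deg v. Proof. exact: big_cat. Qed.
Lemma oddz_deg w : oddz (deg w) = pw par w.
Proof.
elim: w => [|l w IHw]; first by rewrite deg_nil pw_nil.
by rewrite deg_cons oddzD IHw pw_cons.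
Qed.
Lemma deg_perm u v w : perm_eq (u ++ v) w -> deg w = deg u + deg v.
Proof. by move=> E; rewrite -deg_cat /deg (perm_big _ E). Qed.

Lemma homw_cat u v : homw (u ++ v) = homw u && homw v.
Proof. exact: all_cat. Qed.
Lemma homw_perm u v w : perm_eq (u ++ v) w -> homw w -> homw u /\ homw v.
Proof. by move=> /perm_all E; rewrite /homw -E all_cat => /andP. Qed.

Lemma homogE (w : seq letter) : homog gr (unzip1 w) (unzip2 w) = homw w.
Proof. by elim: w => [//|l w IHw] /=; rewrite IHw. Qed.

Lemma homog_zip e x : homog gr e x ->
  [/\ homw (zip e x), unzip1 (zip e x) = e, unzip2 (zip e x) = x
    & size (zip e x) = size x].
Proof.
move=> ex; have sz : size e = size x by move: ex; rewrite /homog all2E => /andP[/eqP].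
have e1 : unzip1 (zip e x) = e by rewrite unzip1_zip ?sz.
have e2 : unzip2 (zip e x) = x by rewrite unzip2_zip ?sz.
by split=> //; rewrite -?homogE ?e1 ?e2 // size_zip sz minnn.
Qed.

Lemma lw_nil (A : algType K) (i : V -> A) : lw i [::] = 1.
Proof. exact: word_nil. Qed.
Lemma lw_cons (A : algType K) (i : V -> A) l w : lw i (l :: w) = i l.2 * lw i w.
Proof. exact: word_cons. Qed.
Lemma lw_cat (A : algType K) (i : V -> A) u v : lw i (u ++ v) = lw i u * lw i v.
Proof. by rewrite /lw /unzip2 map_cat word_cat. Qed.

Definition mlin (Z : lmodType K) (F : seq letter -> Z) : Prop :=
  forall u v p a x y, homw u -> homw v -> x \in gr p -> y \in gr p ->
    F (u ++ (p, a *: x + y) :: v) =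
    a *: F (u ++ (p, x) :: v) + F (u ++ (p, y) :: v).

(** Adjacent swaps suffice: they are the relations of the symmetric algebra, read inside a word. *)
Definition msym (Z : lmodType K) (F : seq letter -> Z) : Prop :=
  forall u v l m, homw u -> homw v -> l.2 \in gr l.1 -> m.2 \in gr m.1 ->
    F (u ++ l :: m :: v) = sg (par l && par m) (F (u ++ m :: l :: v)).

Lemma lw_mlin (A : algType K) (i : V -> A) : linear i -> mlin (lw i).
Proof.
move=> li u v p a x y _ _ _ _; rewrite /lw /unzip2 !map_cat /=.
exact: word_multilinear.
Qed.

Lemma mlin_cons (Z : lmodType K) (F : seq letter -> Z) l :
  l.2 \in gr l.1 -> mlin F -> mlin (fun w => F (l :: w)).
Proof. by move=> hl mF u v p a x y hu; apply: (mF (l :: u)); rewrite /= hl. Qed.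

Lemma msym_cons (Z : lmodType K) (F : seq letter -> Z) l :
  l.2 \in gr l.1 -> msym F -> msym (fun w => F (l :: w)).
Proof. by move=> hl mF u v m n hu; apply: (mF (l :: u)); rewrite /= hl. Qed.

Lemma mlin_lin (Z Z' : lmodType K) (f : {linear Z -> Z'}) F :
  mlin F -> mlin (fun w => f (F w)).
Proof. by move=> mF u v p a x y *; rewrite mF // linearP. Qed.

Lemma msym_lin (Z Z' : lmodType K) (f : {linear Z -> Z'}) F :
  msym F -> msym (fun w => f (F w)).
Proof. by move=> mF u v l m *; rewrite mF // raddf_sg. Qed.

Lemma pw_lin u v p q x y :
  pw par (u ++ (p, x) :: v) = pw par (u ++ (p, y) :: v) /\
  deg (u ++ (q, x) :: v) = deg (u ++ (q, y) :: v).
Proof. by rewrite !pw_cat !pw_cons !deg_cat !deg_cons. Qed.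

Lemma mlin_conv (Z : lmodType K) (b : seq letter -> seq letter -> Z) :
  (forall v, homw v -> mlin (b^~ v)) -> (forall u, homw u -> mlin (b u)) ->
  mlin (conv par b).
Proof.
move=> bl br u; elim: u b bl br => [|l u IHu] b bl br v p a x y hu hv hx hy /=.
  transitivity (conv par (fun u v0 => a *: b ((p, x) :: u) v0 + b ((p, y) :: u) v0) v
    + conv par (fun u v0 => a *: sg (oddz p && pw par u) (b u ((p, x) :: v0))
        + sg (oddz p && pw par u) (b u ((p, y) :: v0))) v).
    congr (_ + _); apply: eq_conv => s t /homw_perm/(_ hv)[hs ht].
      exact: (bl t ht [::]).
    by rewrite (br s hs [::]) // sgD sgZ.
  rewrite !convD -!(conv_raddf par (GRing.scale a)) scalerDr.
  by rewrite addrACA.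
case/andP: hu => hl hu.
rewrite [X in X + _]IHu // => [|w hw|w hw]; last 2 first.
- exact: (mlin_cons hl (bl w hw)).
- by apply: br; rewrite /= hl.
rewrite [X in _ + X = _]IHu // => [|w hw|w hw]; last 2 first.
- move=> s t q c z z' hs ht hz hz'; have [E1 _] := pw_lin s t q q (c *: z + z') z.
  have [E2 _] := pw_lin s t q q z z'.
  rewrite -E2 -E1 (bl _ _ s t q c) //=; last by rewrite hl.
  by rewrite sgD sgZ.
- move=> s t q c z z' hs ht hz hz'.
  by rewrite (mlin_cons hl (br w hw)) // sgD sgZ.
by rewrite scalerDr addrACA.
Qed.

(** Two letters sent to the same part are swapped by the hypotheses on [b]. The two terms that
    separate them are exchanged, and the crossing sign built into [conv] accounts for the swap. *)
Lemma msym_conv (Z : lmodType K) (b : seq letter -> seq letter -> Z) :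
  (forall v, homw v -> msym (b^~ v)) -> (forall u, homw u -> msym (b u)) ->
  msym (conv par b).
Proof.
move=> bl br u; elim: u b bl br => [|l u IHu] b bl br v m n hu hv hm hn /=.
  rewrite -!convD -conv_sg.
  apply: eq_conv => s t /homw_perm/(_ hv)[hs ht].
  rewrite (bl t ht [::]) // (br s hs [::]) // !sgD !sg_sg [RHS]addrACA !pw_cons.
  congr (_ + _ + (_ + _)); congr (sg _ _);
    by case: (par m); case: (par n); case: (pw par s).
case/andP: hu => hl hu.
rewrite [X in X + _]IHu // => [|w hw|w hw]; last 2 first.
- exact: (msym_cons hl (bl w hw)).
- by apply: br; rewrite /= hl.
rewrite [X in _ + X = _]IHu // => [|w hw|w hw]; last 2 first.
- move=> s t q c hs ht hq hc.
  rewrite (bl _ _ s t q c) //=; last by rewrite hl.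
  rewrite !sg_sg !pw_cat !pw_cons; congr (sg _ _).
  by rewrite (addbCA (par q)) addbC.
- move=> s t q c hs ht hq hc.
  by rewrite (msym_cons hl (br w hw)) // !sg_sg addbC.
by rewrite sgD.
Qed.

(** Bridge to the universal property of the tensor algebra, which wants a multilinear function of
    arbitrary vectors while signs exist only on homogeneous words: each vector is expanded into its
    components, slot by slot. *)
Lemma mlin_ext (Z : lmodType K) (F : seq letter -> Z) :
  is_graded gr -> mlin F ->
  exists2 h : seq V -> Z, multilinear h
    & forall w, homw w -> h (unzip2 w) = F w.
Proof.
move=> grV mF; have [t [f d]] := graded_comp grV.
(* A component of the head becomes a letter of [F], together with its degree, before the tail is
   expanded. *)
pose fix ext (F : seq letter -> Z) (s : seq V) : Z :=
  if s is x :: s' then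
    comp_sum t f (fun p y => ext (fun w => F ((p, y) :: w)) s') x
  else F [::].
have fg x p : f x p \in gr p by have [] := d x.
have ext_eq s : forall F G, (forall w, homw w -> F w = G w) -> ext F s = ext G s.
  elim: s => [|x s IHs] F1 F2 F12; first exact: F12.
  apply: eq_bigr => p _; apply: IHs => w hw; apply: F12.
  by rewrite /= fg.
have ext_lin s : forall a F G, ext (fun w => a *: F w + G w) s = a *: ext F s + ext G s.
  elim: s => [//|x s IHs] a F1 F2 /=.
  rewrite /comp_sum scaler_sumr -big_split; apply: eq_bigr => p _.
  exact: IHs.
have ext_hd s F1 : mlin F1 -> forall p a x y, x \in gr p -> y \in gr p ->
  ext (fun w => F1 ((p, a *: x + y) :: w)) s =
  a *: ext (fun w => F1 ((p, x) :: w)) s + ext (fun w => F1 ((p, y) :: w)) s.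
  move=> m1 p a x y xp yp; rewrite -ext_lin; apply: ext_eq => w hw.
  exact: (m1 [::]).
exists (ext F).
  move=> s1; elim: s1 F mF => [|z s1 IHs] F1 m1 s2 a x y.
    exact: (comp_sum_linear grV d (ext_hd s2 F1 m1)).
  rewrite /= /comp_sum scaler_sumr -big_split; apply: eq_bigr => p _.
  exact: (IHs _ (@mlin_cons _ F1 (p, f z p) (fg z p) m1)).
move=> w; elim: w F mF => [//|[p x] w IHw] F1 m1 /andP[/= xp hw].
rewrite (comp_sum_hom grV d (ext_hd (unzip2 w) F1 m1) xp).
by rewrite IHw //; apply: (@mlin_cons _ F1 (p, x)).
Qed.

End Letters.

Lemma natfS_neq0 (K : fieldType) : [pchar K] =i pred0 ->
  forall n, (n.+1%:R : K) != 0.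
Proof. by move=> /pcharf0P K0 n; rewrite K0. Qed.

(** The natural number 2^n - 1 vanishes in characteristic 0 only for n = 0. Degrees may be negative,
    hence the reduction to the difference [q - p]. *)
Lemma exp2z_inj (K : fieldType) : [pchar K] =i pred0 ->
  injective (fun p : int => (2 : K) ^ p).
Proof.
move=> /pcharf0P K0; have n2 : (2 : K) != 0 by rewrite K0.
have E1 (n : nat) : (2 : K) ^ n%:Z = 1 -> n = 0%N.
  have n1 : (0 < 2 ^ n)%N by rewrite expn_gt0.
  rewrite -exprnP -natrX => /eqP; rewrite -subr_eq0 -(natrB _ n1) K0.
  by case: n n1 => // n; rewrite subn_eq0 expnS => _; have := expn_gt0 2 n; lia.
have key p q : (2 : K) ^ p = 2 ^ q -> (p <= q)%R -> p = q.
  move=> E pq; have : (2 : K) ^ (`|q - p|%N%:Z) = 1.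
    rewrite gez0_abs ?Num.Theory.subr_ge0 //; apply: (mulfI (expfz_neq0 p n2)).
    by rewrite -expfzDr // addrCA subrr addr0 E mulr1.
  by move=> /E1 /eqP; rewrite absz_eq0 subr_eq0 => /eqP.
move=> p q E; have [pq|/Order.POrderTheory.ltW qp] := Order.TotalTheory.leP p q; first exact: key.
by apply/esym/key.
Qed.

Section DegreeSpan.
Variables (K : fieldType) (V : lmodType K) (gr : int -> submodClosed V).
Variables (A : algType K) (i : V -> A).

Lemma lw_word_gr w : homw gr w -> lw i w \in word_gr gr i (deg w).
Proof.
move=> hw; apply: mem_span; exists (unzip1 w), (unzip2 w).
by rewrite homogE hw /deg big_map.
Qed.

Lemma word_gr_ind (Z : lmodType K) (f : {linear A -> Z}) (S : submodClosed Z) p :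
  (forall w, homw gr w -> deg w = p -> f (lw i w) \in S) ->
  forall x, x \in word_gr gr i p -> f x \in S.
Proof.
move=> fS; apply: span_lin => _ [e [x [/homog_zip[hw E1 E2 _] dp ->]]].
rewrite -E2; apply: fS => //.
by rewrite -dp -[in RHS]E1 /deg big_map.
Qed.

Lemma word_grE p x : x \in word_gr gr i p <->
  x \in span [set y | exists w, [/\ homw gr w, deg w = p & y = lw i w]].
Proof.
split; last by apply: span_sub => _ [w [hw <- ->]]; apply: lw_word_gr.
apply: (word_gr_ind (f := idl A)) => w hw dw.
by apply: mem_span; exists w.
Qed.

Lemma word_gr1 : 1 \in word_gr gr i 0.
Proof. by rewrite -(lw_nil i) -(@deg_nil K V); apply: lw_word_gr. Qed.

Lemma word_grM p q x y : x \in word_gr gr i p -> y \in word_gr gr i q ->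
  x * y \in word_gr gr i (p + q).
Proof.
move=> /word_grE + /word_grE yq; move: x.
apply: span_ind => [|a x x' xp xp'|_ [u [hu <- ->]]].
- by rewrite mul0r rpred0.
- by rewrite mulrDl -scalerAl rpredD ?rpredZ.
move: y yq; apply: span_ind => [|a y y' yq yq'|_ [v [hv <- ->]]].
- by rewrite mulr0 rpred0.
- by rewrite mulrDr -scalerAr rpredD ?rpredZ.
by rewrite -lw_cat -deg_cat; apply: lw_word_gr; rewrite homw_cat hu.
Qed.

Lemma gen_hom : is_graded gr -> linear i ->
  (forall x, x \in span [set y | exists s, y = word i s]) ->
  forall x, x \in span [set y | exists w, homw gr w /\ y = lw i w].
Proof.
move=> grV li sA x; apply: span_sub (sA x) => _ [s ->]; elim: s => [|z s IHs].
  by apply: mem_span; exists [::]; rewrite lw_nil word_nil.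
rewrite word_cons; move: (word i s) IHs; apply: (span_lin (f := lmul (i z))).
move=> _ [w [hw ->]]; have [t [f [fg ->]]] := graded_dec grV z.
have -> : i (\sum_(p <- t) f p) = \sum_(p <- t) i (f p).
  by rewrite -[i]/(mklin li : _ -> _) linear_sum.
rewrite [lmul _ _]mulr_suml; apply: rpred_sum => p _.
by apply: mem_span; exists ((p, f p) :: w); rewrite /= fg lw_cons.
Qed.

End DegreeSpan.

(** * Coproduct and coderivations of T(V) and S(V) *)

(* The tensor algebra (c = false) or graded symmetric algebra (c = true) on V,
   by its universal property for maps multilinear on homogeneous words. *)
Record galg (K : fieldType) (c : bool) (V : lmodType K)
    (gr : int -> submodClosed V) (A : algType K) (i : V -> A) : Prop := {
  galg_graded : is_graded gr;
  galg_linear : linear i;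
  galg_gen : forall x, x \in span [set y | exists w, homw gr w /\ y = lw i w];
  galg_comm : c -> forall l m : letter V, l.2 \in gr l.1 -> m.2 \in gr m.1 ->
    i l.2 * i m.2 = sg (par l && par m) (i m.2 * i l.2);
  galg_univ : forall (Z : lmodType K) (F : seq (letter V) -> Z),
    mlin gr F -> (c -> msym gr F) ->
    exists f : {linear A -> Z}, forall w, homw gr w -> f (lw i w) = F w }.

Section Galg.
Variables (K : fieldType) (c : bool) (V : lmodType K).
Variables (gr : int -> submodClosed V) (A : algType K) (i : V -> A).
Hypothesis gA : galg c gr i.
Local Notation homV := (homw gr).
Local Notation wd := (lw i).
Local Notation parV := (@par K V).
Local Notation agr := (word_gr gr i).

Lemma eq_galg (Z : lmodType K) (f g : {linear A -> Z}) :
  (forall w, homV w -> f (wd w) = g (wd w)) -> f =1 g.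
Proof.
by move=> fg x; apply: eq_lin_span (galg_gen gA x) => _ [w [hw ->]]; apply: fg.
Qed.

Definition glift (Z : lmodType K) (F : seq (letter V) -> Z)
    (mF : mlin gr F) (sF : c -> msym gr F) : {linear A -> Z} :=
  sval (cid (galg_univ gA mF sF)).

Lemma gliftE (Z : lmodType K) F (mF : mlin gr F) (sF : c -> msym gr F) w :
  homV w -> glift mF sF (wd w) = F w :> Z.
Proof. exact: (svalP (cid (galg_univ gA mF sF))). Qed.

Lemma mlin_lw : mlin gr wd.
Proof. exact/lw_mlin/galg_linear/gA. Qed.

Lemma lw_swap (b : c) u v l m : l.2 \in gr l.1 -> m.2 \in gr m.1 ->
  wd (u ++ l :: m :: v) = sg (parV l && parV m) (wd (u ++ m :: l :: v)).
Proof.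
move=> hl hm; rewrite !lw_cat !lw_cons !mulrA -(mulrA (wd u)).
by rewrite (galg_comm gA b hl hm) sg_mulr sg_mull !mulrA.
Qed.

Lemma msym_lw (b : c) : msym gr wd.
Proof. by move=> u v l m _ _ hl hm; apply: lw_swap. Qed.

Section Diag.
Variable d : int -> K.

Fact diag_mlin : mlin gr (fun w => d (deg w) *: wd w).
Proof.
move=> u v p a x y hu hv hx hy; rewrite mlin_lw // !deg_cat !deg_cons.
by rewrite scalerDr !scalerA mulrC.
Qed.

Fact diag_msym (b : c) : msym gr (fun w => d (deg w) *: wd w).
Proof.
move=> u v l m hu hv hl hm; rewrite lw_swap // sgZ !deg_cat !deg_cons.
by rewrite (addrCA l.1).
Qed.

(** One construction for three operators: the projection [proj] onto a degree, the sign operator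
    [tau], and the operator with eigenvalues 2^p that separates degrees. *)
Definition diag := glift diag_mlin diag_msym.

Lemma diag_lw w : homV w -> diag (wd w) = d (deg w) *: wd w.
Proof. exact: gliftE. Qed.

Lemma diag_gr p x : x \in agr p -> diag x = d p *: x.
Proof.
move=> /word_grE; apply: (eq_lin_span (g := d p \*: idl A)) => _ [w [hw <- ->]].
exact: diag_lw.
Qed.

End Diag.

Lemma galg_span_gr (X : set A) :
  (forall w, homV w -> X (wd w)) -> forall x, x \in span X.
Proof.
by move=> XA x; apply: span_mono (galg_gen gA x) => _ [w [hw ->]]; apply: XA.
Qed.

Lemma galg_dec : forall x : A, exists (s : seq int) (f : int -> A),
  (forall p, f p \in agr p) /\ x = \sum_(p <- s) f p.
Proof.
pose I := {w | homV w}.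
apply: (@graded_dec_span _ _ _ I (fun w => wd (sval w)) (fun w => deg (sval w))).
  by case=> w hw; apply: lw_word_gr.
by apply: galg_span_gr => w hw; exists (exist _ w hw).
Qed.

(** No basis of [A] is at hand: directness comes from scaling words of degree p by 2^p, which
    respects the relations of [A]. *)
Lemma galg_is_graded : [pchar K] =i pred0 -> is_graded agr.
Proof.
move=> K0; split; first exact: galg_dec.
apply: (graded_free_eigen (P := diag (fun p => 2 ^ p)) (exp2z_inj K0)).
exact: diag_gr.
Qed.

Definition proj p := diag (fun q => (q == p)%:R).

Lemma proj_gr p q x : x \in agr q -> proj p x = if q == p then x else 0.
Proof. by move=> /diag_gr->; case: eqP; rewrite ?scale1r ?scale0r. Qed.

(** The sign paid by an operator of parity [e] for passing over an element, as a linear map; with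
    it, id (x) D needs no homogeneous decomposition of the left factor. *)
Definition tau (e : bool) := diag (fun p => (-1) ^ (p * e%:Z)).

Lemma tau_gr e p x : x \in agr p -> tau e x = sg (e && oddz p) x.
Proof.
move=> /diag_gr->; rewrite exprzM_sg andbC; congr (sg (_ && _) _).
by case: e.
Qed.

Lemma tau_lw e w : homV w -> tau e (wd w) = sg (e && pw parV w) (wd w).
Proof. by move=> hw; rewrite (tau_gr e (lw_word_gr i hw)) oddz_deg. Qed.

Lemma tauD e e' x : tau e (tau e' x) = tau (e (+) e') x.
Proof.
apply: (eq_galg (f := compl (tau e) (tau e'))) => w hw.
rewrite -[compl _ _ _]/(tau e (tau e' _)) !tau_lw // lin_sg tau_lw // sg_sg.
by congr (sg _ _); case: e; case: e'; case: pw.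
Qed.

Fact coprod_mlin :
  mlin gr (conv parV (fun u v => tp (wd u) (wd v))).
Proof.
by apply: mlin_conv => w hw; [apply: (mlin_lin (tpl _ _)) |
  apply: (mlin_lin (tpr _ _))]; apply: mlin_lw.
Qed.

Fact coprod_msym (b : c) :
  msym gr (conv parV (fun u v => tp (wd u) (wd v))).
Proof.
by apply: msym_conv => w hw; [apply: (msym_lin (tpl _ _)) |
  apply: (msym_lin (tpr _ _))]; apply: msym_lw.
Qed.

Definition coprod : {linear A -> tens A A} := glift coprod_mlin coprod_msym.

Lemma coprod_lw w : homV w ->
  coprod (wd w) = conv parV (fun u v => tp (wd u) (wd v)) w.
Proof. exact: gliftE. Qed.

Definition cprod (B : algType K) (f g : {linear A -> B}) : {linear A -> B} :=
  compl (tmul f g) coprod.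

Lemma cprodE (B : algType K) (f g : {linear A -> B}) x :
  cprod f g x = tmul f g (coprod x).
Proof. by []. Qed.

Lemma cprod_lw (B : algType K) (f g : {linear A -> B}) w : homV w ->
  cprod f g (wd w) = conv parV (fun u v => f (wd u) * g (wd v)) w.
Proof.
move=> hw; rewrite cprodE coprod_lw // conv_lin.
by apply: eq_conv => u v _; rewrite tmulE.
Qed.

Definition par_map (e : bool) (D : {linear A -> A}) : Prop :=
  forall b x, D (tau b x) = sg (b && e) (tau b (D x)).

Definition deg_map (p : int) (D : A -> A) : Prop :=
  forall q x, x \in agr q -> D x \in agr (p + q).

Lemma deg_par_map p (D : {linear A -> A}) : deg_map p D -> par_map (oddz p) D.
Proof.
move=> Dp b x; rewrite -[RHS]/(sg _ (compl (tau b) D x)).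
rewrite sg_scale -[LHS]/(compl D (tau b) x).
apply: (eq_galg (g := _ \*: compl (tau b) D)) => w hw.
have hx := lw_word_gr i hw; rewrite -[LHS]/(D (tau b _)) (tau_gr b hx).
rewrite -[RHS]/(_ *: tau b (D _)) -sg_scale (tau_gr b (Dp _ _ hx)) sg_sg lin_sg.
by rewrite oddzD; congr (sg _ _); case: b; case: (oddz p); case: oddz.
Qed.

Definition dmap (e : bool) (D : {linear A -> A}) :
    {linear tens A A -> tens A A} :=
  tmap D (idl A) \+ tmap (tau e) D.

Lemma dmapE e D x y :
  dmap e D (tp x y) = tp (D x) y + tp (tau e x) (D y).
Proof. by rewrite -[LHS]/(tmap _ _ _ + tmap _ _ _) !tmapE. Qed.

Definition coder (e : bool) (D : {linear A -> A}) : Prop :=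
  forall x, coprod (D x) = dmap e D (coprod x).

(** The mixed terms cancel: there [D] and [D'] act on different factors, and [tau] supplies exactly
    the sign of exchanging them. *)
Lemma dmap_comm e e' (D D' C : {linear A -> A}) :
  par_map e D -> par_map e' D' ->
  (forall x, C x = D (D' x) - sg (e && e') (D' (D x))) ->
  forall z, dmap e D (dmap e' D' z) =
    sg (e && e') (dmap e' D' (dmap e D z)) + dmap (e (+) e') C z.
Proof.
move=> pD pD' CE z.
rewrite sg_scale; move: z; apply: (eq_tens (f := compl (dmap e D) (dmap e' D'))
  (g := (_ \*: compl (dmap e' D') (dmap e D)) \+ dmap (e (+) e') C)) => x y.
rewrite -[LHS]/(dmap e D (dmap e' D' _)).
rewrite -[RHS]/(_ *: dmap e' D' (dmap e D (tp x y)) + dmap (e (+) e') C (tp x y)).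
rewrite -sg_scale !dmapE !linearD !dmapE !CE !sgD !tauD (addbC e').
rewrite tpBl tpBr pD' pD.
rewrite !sg_tpl !sg_tpr !sg_sg addbb (andbC e').
by rewrite [RHS](AC (2*2*(2*2)) (5*3*(2*7)*(1*6)*(4*8)))%AC /= !subrr !addr0.
Qed.

Lemma dmap_lin e a (D D' C : {linear A -> A}) :
  (forall x, C x = a *: D x + D' x) ->
  forall z, dmap e C z = a *: dmap e D z + dmap e D' z.
Proof.
move=> CE; apply: (eq_tens (g := (a \*: dmap e D) \+ dmap e D')) => x y.
rewrite -[RHS]/(a *: dmap e D (tp x y) + dmap e D' (tp x y)) !dmapE !CE.
by rewrite tpPl tpPr scalerDr addrACA.
Qed.

Lemma dmapD e (D D' C : {linear A -> A}) : (forall x, C x = D x + D' x) ->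
  forall z, dmap e C z = dmap e D z + dmap e D' z.
Proof.
by move=> CE z; rewrite (@dmap_lin e 1 D D' C) ?scale1r // => x; rewrite scale1r.
Qed.

Lemma coder_lmul_lin e a x y : coder e (lmul x) -> coder e (lmul y) ->
  coder e (lmul (a *: x + y)).
Proof.
move=> cx cy z; have E t : lmul (a *: x + y) t = a *: lmul x t + lmul y t.
  by rewrite /= mulrDl scalerAl.
by rewrite E linearP (dmap_lin e E) cx cy.
Qed.

Lemma coder_lmul0 e : coder e (lmul 0).
Proof.
have l0 (x : A) : lmul 0 x = 0 by apply: mul0r.
move=> x; rewrite l0 linear0.
have E t : lmul (0 : A) t = -1 *: lmul (0 : A) t + lmul (0 : A) t.
  by rewrite scaleN1r addNr l0.
by rewrite (dmap_lin e E) scaleN1r addNr.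
Qed.

Lemma coder_comm e e' (D D' C : {linear A -> A}) :
  par_map e D -> par_map e' D' -> coder e D -> coder e' D' ->
  (forall x, C x = D (D' x) - sg (e && e') (D' (D x))) -> coder (e (+) e') C.
Proof.
move=> pD pD' cD cD' CE x; rewrite CE linearB lin_sg cD cD' cD' cD.
by rewrite (dmap_comm pD pD' CE) addrC addKr.
Qed.

Lemma coprod1 : coprod 1 = tp 1 1.
Proof. by have := coprod_lw (w := [::]) isT; rewrite /= lw_nil. Qed.

Lemma lmul_deg_map p a : a \in agr p -> deg_map p (lmul a).
Proof. by move=> ap q x xq; apply: word_grM. Qed.

Lemma lmul_par_map p a : a \in agr p -> par_map (oddz p) (lmul a).
Proof. by move=> ap; apply/deg_par_map/lmul_deg_map. Qed.

(** Left multiplication turns the bracket of two elements into the commutator of two operators, so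
    this is an instance of [coder_comm]. *)
Lemma coder_bracket p q a b : a \in agr p -> b \in agr q ->
  coder (oddz p) (lmul a) -> coder (oddz q) (lmul b) ->
  coder (oddz (p + q)) (lmul (gcomm p q a b)).
Proof.
move=> ap bq ca cb; rewrite oddzD.
apply: (coder_comm (lmul_par_map ap) (lmul_par_map bq) ca cb) => x.
rewrite -[LHS]/(_ * _) /gcomm exprzM_sg mulrBl sg_mull.
by rewrite -!mulrA.
Qed.

Section CoproductOfProducts.
Variables (W : lmodType K) (j : W -> A).

(* Primitivity of j l.2, expressed through its left multiplication. *)
Definition prim (l : letter W) :=
  j l.2 \in agr l.1 /\ coder (oddz l.1) (lmul (j l.2)).

End CoproductOfProducts.

(** Takes the place of multiplicativity of the coproduct. The first letter joins one part or the
    other, and these two cases are the recursion of [conv]. Evaluated at 1, it says that the letter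
    is primitive. *)
Lemma coder_letter l : l.2 \in gr l.1 -> coder (parV l) (lmul (i l.2)).
Proof.
move=> hl x; rewrite -[LHS]/(compl coprod (lmul (i l.2)) x).
rewrite -[RHS]/(compl (dmap (parV l) (lmul (i l.2))) coprod x).
move: x; apply: eq_galg => w hw.
rewrite -[LHS]/(coprod (_ * _)) -[RHS]/(dmap _ _ (coprod _)).
have hlw : homV (l :: w) by rewrite /= hl.
rewrite -lw_cons !coprod_lw // conv_lin [LHS]/= -convD.
apply: eq_conv => u v /homw_perm/(_ hw)[hu hv].
by rewrite dmapE !lw_cons tau_lw // sg_tpl.
Qed.

Lemma letter_gr l : l.2 \in gr l.1 -> i l.2 \in agr l.1.
Proof.
move=> hl; have := @lw_word_gr _ _ gr _ i [:: l].
by rewrite /= hl lw_cons lw_nil mulr1 deg_cons deg_nil addr0; apply.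
Qed.

End Galg.

(** * Zinbiel coderivations of the tensor algebra *)

Section ZinbielCoderivations.
Variables (K : fieldType) (V : lmodType K) (gr : int -> submodClosed V).
Variables (T : algType K) (i : V -> T).
Hypothesis gT : galg false gr i.
Local Notation homV := (homw gr).
Local Notation wd := (lw i).
Local Notation parV := (@par K V).
Local Notation agr := (word_gr gr i).

Let il : {linear V -> T} := mklin (galg_linear gT).

(* The coderivation of the cofree Zinbiel coalgebra T(V) of degree p with
   corestriction phi: a letter x is passed over, absorbed as the first
   argument of phi, or is the last argument of phi. *)
Fixpoint zcoder_word (p : int) (phi : T -> V) (w : seq (letter V)) : T :=
  if w is l :: w' then
    sg (oddz p && parV l) (i l.2 * zcoder_word p phi w')
    + zcoder_word (p + l.1) (fun t => phi (i l.2 * t)) w'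
    + i (phi (i l.2)) * wd w'
  else 0.

Lemma zcoder_word_lin p a (phi psi : T -> V) w :
  zcoder_word p (fun t => a *: phi t + psi t) w =
  a *: zcoder_word p phi w + zcoder_word p psi w.
Proof.
elim: w p phi psi => [|l w IHw] p phi psi /=; first by rewrite scaler0 addr0.
rewrite (galg_linear gT) !IHw mulrDr mulrDl -scalerAr -scalerAl sgD sgZ !scalerDr.
by rewrite [RHS](AC (3*3) (1*4*(2*5)*(3*6)))%AC.
Qed.

Lemma zcoder_word_mlin p (phi : {linear T -> V}) :
  mlin gr (zcoder_word p phi).
Proof.
move=> u v q a x y; elim: u p phi => [|l u IHu] p phi hu hv hx hy.
  rewrite /= /par /=.
  have -> : (fun t => phi (i (a *: x + y) * t)) =
            (fun t => a *: phi (i x * t) + phi (i y * t)).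
    by apply/funext => t; rewrite (galg_linear gT) mulrDl -scalerAl linearP.
  rewrite zcoder_word_lin !(galg_linear gT) linearP (galg_linear gT).
  rewrite !mulrDl -!scalerAl sgD sgZ !scalerDr.
  by rewrite [RHS](AC (3*3) (1*4*(2*5)*(3*6)))%AC.
case/andP: hu => hl hu; rewrite /= IHu //.
have := IHu (p + l.1) (compl phi (lmul (i l.2))) hu hv hx hy => /= ->.
rewrite (mlin_lw gT) // !mulrDr -!scalerAr sgD sgZ !scalerDr.
by rewrite [RHS](AC (3*3) (1*4*(2*5)*(3*6)))%AC.
Qed.

Lemma zcoder_nsym p (phi : {linear T -> V}) :
  false -> msym gr (zcoder_word p phi).
Proof. by []. Qed.

Definition zcoder p (phi : {linear T -> V}) : {linear T -> T} :=
  glift gT (zcoder_word_mlin p phi) (@zcoder_nsym p phi).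

Lemma zcoder_lw p (phi : {linear T -> V}) w : homV w ->
  zcoder p phi (wd w) = zcoder_word p phi w.
Proof. exact: gliftE. Qed.

Lemma zcoder1 p (phi : {linear T -> V}) : zcoder p phi 1 = 0.
Proof. by rewrite -(lw_nil i) zcoder_lw. Qed.

(** The commutator with left multiplication by a letter is again a Zinbiel coderivation, with the
    letter fed to the corestriction, plus left multiplication by the letter that [phi] produces. The
    inductions below run along this identity. *)
Lemma zcoderM p (phi : {linear T -> V}) l t : l.2 \in gr l.1 ->
  zcoder p phi (i l.2 * t) = sg (oddz p && parV l) (i l.2 * zcoder p phi t)
    + (zcoder (p + l.1) (compl phi (lmul (i l.2))) t + i (phi (i l.2)) * t).
Proof.
move=> hl; rewrite sg_scale.
apply: (eq_galg gT (f := compl (zcoder p phi) (lmul (i l.2)))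
  (g := (_ \*: compl (lmul (i l.2)) (zcoder p phi)) \+
   (zcoder (p + l.1) (compl phi (lmul (i l.2))) \+ lmul (i (phi (i l.2)))))).
move=> w hw; have hlw : homV (l :: w) by rewrite /= hl.
rewrite -[LHS]/(zcoder p phi (_ * _)) -lw_cons zcoder_lw // [LHS]/=.
rewrite -[RHS]/(_ *: (_ * zcoder _ _ _) + (zcoder _ _ _ + _ * _)) -sg_scale.
by rewrite !zcoder_lw // addrA.
Qed.

Lemma zcoder_lin p a (phi psi chi : {linear T -> V}) :
  (forall t, chi t = a *: phi t + psi t) ->
  forall t, zcoder p chi t = a *: zcoder p phi t + zcoder p psi t.
Proof.
move=> E; apply: (eq_galg gT (g := (a \*: zcoder p phi) \+ zcoder p psi)) => w hw.
rewrite -[RHS]/(a *: zcoder p phi _ + zcoder p psi _) !zcoder_lw //.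
by rewrite -zcoder_word_lin; congr zcoder_word; apply/funext.
Qed.

Lemma zcoderD p (phi psi chi : {linear T -> V}) :
  (forall t, chi t = phi t + psi t) ->
  forall t, zcoder p chi t = zcoder p phi t + zcoder p psi t.
Proof.
move=> E t; rewrite (zcoder_lin p (a := 1) (phi := phi) (psi := psi)) ?scale1r //.
by move=> {}t; rewrite scale1r.
Qed.

Lemma zcoder_sg p b (phi chi : {linear T -> V}) :
  (forall t, chi t = sg b (phi t)) ->
  forall t, zcoder p chi t = sg b (zcoder p phi t).
Proof.
move=> E t; have E0 t' : chi t' = ((-1) ^+ b - 1) *: phi t' + phi t'.
  by rewrite E scalerBl scale1r subrK sg_scale.
by rewrite (zcoder_lin p E0) scalerBl scale1r subrK -sg_scale.
Qed.

Definition corestr_deg (p : int) (phi : T -> V) : Prop :=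
  forall q x, x \in agr q -> phi x \in gr (p + q).

Lemma corestr_deg_letter p (phi : {linear T -> V}) l : l.2 \in gr l.1 ->
  corestr_deg p phi -> corestr_deg (p + l.1) (compl phi (lmul (i l.2))).
Proof.
move=> hl dp q x xq; rewrite -addrA; apply: dp.
by apply: word_grM xq; apply: letter_gr.
Qed.

Lemma zcoder_deg p (phi : {linear T -> V}) :
  corestr_deg p phi -> deg_map gr i p (zcoder p phi).
Proof.
move=> dp q x; apply: (word_gr_ind (f := zcoder p phi)) => w hw <- {q x}.
elim: w p phi dp hw => [|l w IHw] p phi dp /=.
  by move=> _; rewrite lw_nil zcoder1 rpred0.
move=> /andP[hl hw]; rewrite lw_cons zcoderM // deg_cons.
apply: rpredD; [apply: sg_mem|apply: rpredD].
- by rewrite addrCA; apply: word_grM; [apply: letter_gr|apply: IHw].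
- by rewrite addrA; apply: IHw => //; apply: corestr_deg_letter.
rewrite addrA; apply: word_grM; last exact: lw_word_gr.
by apply: (letter_gr i (l := (_, _))); apply: dp; apply: letter_gr.
Qed.

(** Induction on the word with [p] and [phi] free. Left multiplication by a letter is a
    coderivation, its commutator [C] with [zcoder p phi] is covered by the induction hypothesis for
    the shifted corestriction, and [dmap_comm] assembles the two. *)
Lemma zcoder_coder p (phi : {linear T -> V}) :
  corestr_deg p phi -> coder gT (oddz p) (zcoder p phi).
Proof.
move=> dp x; apply: (eq_galg gT (f := compl (coprod gT) (zcoder p phi))
  (g := compl (dmap gT (oddz p) (zcoder p phi)) (coprod gT))) => w hw {x}.
rewrite -[LHS]/(coprod gT (zcoder _ _ _)).
rewrite -[RHS]/(dmap gT _ _ (coprod gT _)).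
elim: w p phi dp hw => [|l w IHw] p phi dp.
  by move=> _; rewrite lw_nil zcoder1 linear0 coprod1 dmapE zcoder1 tp0l tp0r addr0.
move=> /andP[hl hw]; rewrite lw_cons zcoderM //.
have dp' := corestr_deg_letter hl dp.
have cl := coder_letter gT hl.
have hm : phi (i l.2) \in gr (p + l.1) by apply/dp/letter_gr.
have cm := coder_letter gT (l := (p + l.1, phi (i l.2))) hm.
pose C := zcoder (p + l.1) (compl phi (lmul (i l.2))) \+ lmul (i (phi (i l.2))).
have CE x : C x = zcoder p phi (lmul (i l.2) x)
    - sg (oddz p && oddz l.1) (lmul (i l.2) (zcoder p phi x)).
  by rewrite /= zcoderM // addrC addKr.
have pl := lmul_par_map gT (letter_gr i hl).
rewrite -[i l.2 * wd w]/(lmul (i l.2) _) cl.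
rewrite (dmap_comm (deg_par_map gT (zcoder_deg dp)) pl CE).
rewrite linearD lin_sg -[i l.2 * zcoder _ _ _]/(lmul (i l.2) _) cl IHw //.
congr (_ + _); rewrite linearD -[i _ * wd w]/(lmul _ _) cm IHw //.
by rewrite -oddzD; apply/esym/dmapD.
Qed.

Lemma zcoder_letter p (phi : {linear T -> V}) l : l.2 \in gr l.1 ->
  zcoder p phi (i l.2) = i (phi (i l.2)).
Proof.
by move=> hl; rewrite -[i l.2]mulr1 zcoderM // !zcoder1 mulr0 sg0 !add0r !mulr1.
Qed.

(** This identity and the next are the sign bookkeeping of [zcoder_comm], placed in an arbitrary
    abelian group so that only Boolean identities remain. *)
Let zcomm_corestr (Z : zmodType) (p q r : bool) (a b c d e f : Z) :
  sg (q && r) a + (b + c) - sg (p && q) (sg (p && r) d + (e + f)) =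
  sg (q && r) (a - sg ((p (+) r) && q) e) + (b - sg (p && (q (+) r)) d) + c
  - sg (p && q) f.
Proof.
rewrite !sgD !sgN !sg_sg !opprD [LHS](AC (1*2*(1*2)) (1*5*(2*4)*3*6))%AC /=.
congr (_ - sg _ _ + (_ - sg _ _) + _ - _); by case: p; case: q; case: r.
Qed.

Let zcomm_sum (Z : zmodType) (p q r : bool) (A X B Be C F Al G Ga H De I : Z) :
  sg (q && r) (sg (p && r) (sg (p && q) A + X) + (sg ((p (+) r) && q) B + Be + C))
  + (sg (p && (q (+) r)) F + Al + (sg (p && (q (+) r)) G + (Ga + H))) =
  sg (p && q) (sg (p && r) (sg (q && r) A + (F + G))
               + (B + (sg (q && (p (+) r)) C + (De + I))))
  + (sg ((p (+) q) && r) X + (sg (q && r) Be + Al + Ga - sg (p && q) De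
                              + (H - sg (p && q) I))).
Proof.
rewrite !sgD !sg_sg.
rewrite [RHS](AC ((1*2)*(1*(1*2))*(1*(4*2)))
  ((1*8*(4*9*5))*(2*10*(3*(11*13)))*(6*12)*(7*14)))%AC /= !subrr !addr0.
by congr (sg _ _ + sg _ _ + (sg _ _ + _ + sg _ _) + (sg _ _ + _ + (sg _ _ + _)));
   case: p; case: q; case: r.
Qed.

(** Induction on the word for all degrees and corestrictions at once: according to which map absorbs
    the first letter, if any, the induction hypothesis is needed for the pairs ([phi], [psi]),
    ([phi], [psi']) and ([phi'], [psi]). *)
Lemma zcoder_comm p q (phi psi chi : {linear T -> V}) :
  corestr_deg p phi -> corestr_deg q psi ->
  (forall t, chi t = phi (zcoder q psi t)
                     - sg (oddz p && oddz q) (psi (zcoder p phi t))) ->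
  forall t, zcoder p phi (zcoder q psi t) =
    sg (oddz p && oddz q) (zcoder q psi (zcoder p phi t))
    + zcoder (p + q) chi t.
Proof.
move=> dp dq E t; rewrite sg_scale.
apply: (eq_galg gT (f := compl (zcoder p phi) (zcoder q psi))
  (g := (_ \*: compl (zcoder q psi) (zcoder p phi)) \+ zcoder (p + q) chi)) => w hw {t}.
rewrite -[LHS]/(zcoder p phi (zcoder q psi _)).
rewrite -[RHS]/(_ *: zcoder q psi (zcoder p phi _) + zcoder (p + q) chi _).
rewrite -sg_scale.
elim: w p q phi psi chi dp dq E hw => [|l w IHw] p q phi psi chi dp dq E.
  by move=> _; rewrite lw_nil !zcoder1 !linear0 sg0 addr0.
move=> /andP[hl hw]; rewrite lw_cons; set t := wd w; set x := i l.2.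
have hm : phi x \in gr (p + l.1) by apply/dp/letter_gr.
have hn : psi x \in gr (q + l.1) by apply/dq/letter_gr.
pose phi' := compl phi (lmul x); pose psi' := compl psi (lmul x).
have dp' : corestr_deg (p + l.1) phi' by apply: corestr_deg_letter.
have dq' : corestr_deg (q + l.1) psi' by apply: corestr_deg_letter.
(* [al] and [be] are the corestrictions of the commutators for the pairs ([phi], [psi']) and
   ([phi'], [psi]). *)
pose al := compl phi (zcoder (q + l.1) psi')
  \- ((-1) ^+ (oddz p && oddz (q + l.1)) \*: compl psi' (zcoder p phi)).
pose be := compl phi' (zcoder q psi)
  \- ((-1) ^+ (oddz (p + l.1) && oddz q) \*: compl psi (zcoder (p + l.1) phi')).
have alE s : al s = phi (zcoder (q + l.1) psi' s)
    - sg (oddz p && oddz (q + l.1)) (psi' (zcoder p phi s)).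
  by rewrite sg_scale.
have beE s : be s = phi' (zcoder q psi s)
    - sg (oddz (p + l.1) && oddz q) (psi (zcoder (p + l.1) phi' s)).
  by rewrite sg_scale.
have E0 := IHw p q phi psi chi dp dq E hw.
have E1 := IHw p (q + l.1) phi psi' al dp dq' alE hw.
have E2 := IHw (p + l.1) q phi' psi be dp' dq beE hw.
(* Here one map turns the first letter into a new letter, which the other map absorbs. *)
pose ga := compl phi (lmul (i (psi x))); pose de := compl psi (lmul (i (phi x))).
have chiE s : chi (x * s) = sg (oddz q && oddz l.1) (be s) + al s + ga s
    - sg (oddz p && oddz q) (de s).
  rewrite alE beE !oddzD -zcomm_corestr E !zcoderM //.
  rewrite [phi (_ + _)]linearD [psi (_ + _)]linearD !lin_sg.
  by rewrite [phi (_ + _)]linearD [psi (_ + _)]linearD.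
have chix : chi x = phi (i (psi x)) - sg (oddz p && oddz q) (psi (i (phi x))).
  by rewrite E !zcoder_letter.
have zchi : zcoder (p + q + l.1) (compl chi (lmul x)) t =
    sg (oddz q && oddz l.1) (zcoder (p + q + l.1) be t)
    + zcoder (p + q + l.1) al t + zcoder (p + q + l.1) ga t
    - sg (oddz p && oddz q) (zcoder (p + q + l.1) de t).
  move: (p + q + l.1) => n.
  pose b1 := (-1) ^+ (oddz q && oddz l.1) \*: be.
  pose d1 := (-1) ^+ (oddz p && oddz q) \*: de.
  have b1E : zcoder n b1 t = sg (oddz q && oddz l.1) (zcoder n be t).
    by apply: zcoder_sg => s; rewrite sg_scale.
  have d1E : zcoder n d1 t = sg (oddz p && oddz q) (zcoder n de t).
    by apply: zcoder_sg => s; rewrite sg_scale.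
  rewrite -b1E -d1E.
  pose b2 := b1 \+ al; pose b3 := b2 \+ ga.
  have -> : zcoder n b1 t + zcoder n al t = zcoder n b2 t by apply/esym/zcoderD.
  have -> : zcoder n b2 t + zcoder n ga t = zcoder n b3 t by apply/esym/zcoderD.
  apply/eqP; rewrite eq_sym subr_eq; apply/eqP; apply: zcoderD => s.
  rewrite -[LHS]/(_ *: be s + al s + ga s).
  by rewrite -[RHS]/(chi (x * s) + _ *: de s) -!sg_scale chiE addrNK.
rewrite !zcoderM // !linearD !lin_sg -/t -/x.
rewrite (@zcoderM _ _ (q + l.1, psi x) _ hn) (@zcoderM _ _ (p + l.1, phi x) _ hm).
rewrite !zcoderM // zchi -/phi' -/psi' -/ga -/de.
have ichi : i (chi x) = i (phi (i (psi x)))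
    - sg (oddz p && oddz q) (i (psi (i (phi x)))).
  by rewrite chix -[i _]/(il _) linearB lin_sg.
have n1 : p + (q + l.1) = p + q + l.1 by rewrite addrA.
have n2 : p + l.1 + q = p + q + l.1 by rewrite addrAC.
have n3 : q + (p + l.1) = p + q + l.1 by rewrite addrA (addrC q).
rewrite /par [(_, _).1]/= [(_, _).2]/= -/x ichi mulrBl sg_mull.
rewrite E0 E1 E2 n1 n2 n3 mulrDr sg_mulr !oddzD -/t.
exact: zcomm_sum.
Qed.

(** The commutator of an odd map with itself is twice its square. Here its corestriction vanishes,
    and 2 is invertible. *)
Lemma zcoder_square (phi : {linear T -> V}) :
  [pchar K] =i pred0 -> corestr_deg 1 phi ->
  (forall w, homV w -> phi (zcoder 1 phi (wd w)) = 0) ->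
  forall t, zcoder 1 phi (zcoder 1 phi t) = 0.
Proof.
move=> K0 dp phi0 t; have phiz s : phi (zcoder 1 phi s) = 0.
  rewrite -[RHS](scale0r (phi (zcoder 1 phi s))); move: s.
  apply: (eq_galg gT (f := compl phi (zcoder 1 phi))
                     (g := 0 \*: compl phi (zcoder 1 phi))) => w hw.
  by rewrite -[RHS]/(0 *: _) scale0r; apply: phi0.
(* The zero map, written as a multiple of [phi] to be linear at once. *)
pose chi := 0 \*: phi.
have E s : chi s = phi (zcoder 1 phi s) - sg (oddz 1 && oddz 1) (phi (zcoder 1 phi s)).
  by rewrite phiz sg0 subr0 -[chi s]/(0 *: _) scale0r.
have := zcoder_comm dp dp E t.
have chi0 s : chi s = -1 *: chi s + chi s.
  by rewrite -[chi s]/(0 *: _) scale0r scaler0 addr0.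
rewrite (zcoder_lin (1 + 1) chi0 t).
rewrite scaleN1r addNr addr0 /= => /eqP; rewrite -addr_eq0 -mulr2n -scaler_nat.
by rewrite scaler_eq0 (negPf (natfS_neq0 K0 1)) => /eqP.
Qed.

(** [n] is the position of the last argument of [phi]. Letters before it are passed over ([u]) or
    absorbed ([v]); letters after it stay. *)
Lemma zcoder_lw_conv p (phi : {linear T -> V}) w : homV w ->
  zcoder p phi (wd w) =
  \sum_(n < size w) conv parV (fun u v => sg (oddz p && pw parV u)
     (wd u * i (phi (wd (rcons v (nth (0, 0) w n)))) * wd (drop n.+1 w)))
     (take n w).
Proof.
elim: w p phi => [|l w IHw] p phi; first by rewrite lw_nil zcoder1 big_ord0.
move=> /andP[hl hw]; rewrite lw_cons zcoderM // !IHw // [size _]/= big_ord_recl.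
rewrite /= pw_nil andbF /= lw_nil mul1r drop0 lw_cons lw_nil mulr1.
rewrite addrA [RHS]addrC mulr_sumr sg_scale scaler_sumr; congr (_ + _).
rewrite -big_split; apply: eq_bigr => n _ /=.
congr (_ + _); last first.
  apply: eq_conv => u v _; rewrite lw_cons oddzD sg_sg -[oddz l.1]/(par l).
  congr (sg _ _).
  by case: (oddz p); case: (pw _ u); case: (par l).
rewrite -[_ *: _]/(_ *: lmul _ _) conv_lin -sg_scale -conv_sg.
apply: eq_conv => u v _; rewrite lin_sg sg_sg pw_cons -[lmul _ _]/(_ * _) !mulrA lw_cons.
by congr (sg _ _); case: (oddz p); case: (pw _ u); case: (par l).
Qed.

End ZinbielCoderivations.

Lemma conv_nilr (X : eqType) (par : X -> bool) (Z : zmodType)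
    (b : seq X -> seq X -> Z) w :
  (forall x u v, b u (x :: v) = 0) -> conv par b w = b w [::].
Proof.
move=> b0; rewrite convC conv_nil => [|x u v]; first by rewrite pw_nil.
by rewrite b0 sg0.
Qed.

Fact rmul_linear (K : fieldType) (A : algType K) (a : A) :
  linear (fun x : A => x * a).
Proof. by move=> c x y; rewrite mulrDl scalerAl. Qed.
Definition rmul (K : fieldType) (A : algType K) (a : A) : {linear A -> A} :=
  mklin (rmul_linear a).

(** * The symmetrization isomorphism *)

Section SingleLetters.
Variables (K : fieldType) (L : lmodType K) (grL : int -> submodClosed L).
Variables (A : algType K) (j : L -> A).

Definition single (w : seq (letter L)) : A := if w is [:: l] then j l.2 else 0.

Lemma single_size w : size w != 1%N -> single w = 0.
Proof. by case: w => [|l [|m w]]. Qed.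

Lemma single_mlin : linear j -> mlin grL single.
Proof.
move=> lj [|l u] [|m v] p a x y _ _ _ _ /=; rewrite ?scaler0 ?addr0 ?lj //.
by case: u => [|? ?]; rewrite /= scaler0 addr0.
by case: u => [|? ?]; rewrite /= scaler0 addr0.
Qed.

Lemma single_msym : msym grL single.
Proof.
move=> u v l m _ _ _ _; rewrite !single_size ?sg0 //;
  by rewrite size_cat /= !addnS.
Qed.

End SingleLetters.

Section SymmetricSingle.
Variables (K : fieldType) (L : lmodType K) (grL : int -> submodClosed L).
Variables (S : algType K) (s : L -> S) (gS : galg true grL s).
Local Notation homL := (homw grL).
Local Notation lws := (lw s).
Local Notation parL := (@par K L).

(** A letter pulled to the front can be put back at the cost of the same Koszul sign, so the
    [size w] terms all agree. *)
Lemma single_lws w : homL w ->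
  conv parL (fun u v => single s u * lws v) w = (size w)%:R *: lws w.
Proof.
elim: w => [|l w IHw] /=; first by rewrite mul0r scale0r.
move=> /andP[hl hw]; rewrite conv_nil => [|x u v]; last by case: u => [|? ?]; rewrite mul0r.
rewrite -[X in _ + X](_ : s l.2 * conv parL (fun u v => single s u * lws v) w = _).
  by rewrite IHw // -natr1 scalerDl scale1r lw_cons -scalerAr addrC.
rewrite -[LHS]/(lmul _ _) conv_lin; apply: eq_conv => u v uvw.
have [hu hv] := homw_perm uvw hw; have [u1|u1] := eqVneq (size u) 1%N; last first.
  by rewrite single_size // !mul0r linear0 sg0.
case: u hu u1 uvw => // m [] // /andP[hm _] _ _.
rewrite /= lw_cons !mulrA (galg_comm gS isT hl hm) pw_cons pw_nil addbF.
by rewrite sg_mull.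
Qed.

End SymmetricSingle.

(* U(L), in the guise of T = T(V) generated by its primitive elements j(L),
   compared with the graded symmetric algebra S on L. *)
Section PBW.
Variables (K : fieldType) (K0 : [pchar K] =i pred0).
Variables (V : lmodType K) (gr : int -> submodClosed V).
Variables (T : algType K) (i : V -> T) (gT : galg false gr i).
Variables (L : lmodType K) (grL : int -> submodClosed L).
Variables (S : algType K) (s : L -> S) (gS : galg true grL s).
Variable j : {linear L -> T}.
Hypothesis j_inj : injective j.
Hypothesis j_prim : forall l : letter L, l.2 \in grL l.1 -> prim gT j l.
Hypothesis j_br : forall p q a b, a \in grL p -> b \in grL q ->
  exists2 c, c \in grL (p + q) & j c = gcomm p q (j a) (j b).
Hypothesis j_gen : forall p v, v \in gr p ->
  exists2 a, a \in grL p & j a = i v.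
Variable e : {linear T -> S}.
Hypothesis e1 : e 1 = 1.
Hypothesis ej : forall a t, e (j a * t) = 0.

Local Notation homL := (homw grL).
Local Notation lwj := (lw j).
Local Notation lws := (lw s).
Local Notation parL := (@par K L).
Local Notation jl := (single j).

Lemma homw_prim w : homL w -> forall l, l \in w -> prim gT j l.
Proof. by move=> hw l lw; apply/j_prim/(allP hw). Qed.

(** The [n]-th convolution power of [jl]. As [jl] keeps single letters only, it is the signed sum
    over the permutations of [w] when [n = size w], and zero otherwise. *)
Fixpoint symw n (w : seq (letter L)) : T :=
  if n is n'.+1 then conv parL (fun u v => jl u * symw n' v) w
  else if w is [::] then 1 else 0.

Lemma symw_mlin n : mlin grL (symw n).
Proof.
elim: n => [|n IHn].
  by move=> u v p a x y _ _ _ _; case: u => [|l u]; rewrite /= scaler0 addr0.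
apply: mlin_conv => w hw.
  by apply: (mlin_lin (rmul (symw n w))); apply: single_mlin; apply: linearP.
exact: (mlin_lin (lmul (jl w))).
Qed.

Lemma symw_msym n : msym grL (symw n).
Proof.
elim: n => [|n IHn].
  by move=> u v l m _ _ _ _; case: u => [|? ?]; rewrite /= sg0.
apply: msym_conv => w hw; last exact: (msym_lin (lmul (jl w))).
by apply: (msym_lin (rmul (symw n w))); apply: single_msym.
Qed.

Lemma symwSr n w :
  symw n.+1 w = conv parL (fun u v => symw n u * jl v) w.
Proof.
elim: n w => [|n IHn] w.
  rewrite [LHS]conv_nilr => [|x u v]; last by rewrite mulr0.
  by rewrite conv_nil => [|x u v]; rewrite /= ?mulr1 ?mul1r ?mul0r.
rewrite -[LHS]/(conv _ (fun u v => jl u * symw n.+1 v) w).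
under eq_conv => u v _ do rewrite IHn -[jl u * _]/(lmul _ _) conv_lin.
rewrite convA; apply: eq_conv => u v _.
rewrite -[RHS]/(rmul _ _) conv_lin; apply: eq_conv => u1 u2 _.
by rewrite /= mulrA.
Qed.

Definition symn (w : seq (letter L)) : T :=
  ((size w)`!%:R : K)^-1 *: symw (size w) w.

Lemma factK n : (n`!%:R : K) != 0.
Proof. by case: n`! (fact_gt0 n) => // m _; apply: natfS_neq0. Qed.

Lemma symn_nil : symn [::] = 1.
Proof. by rewrite /symn /= invr1 scale1r. Qed.

Lemma symn1 l : symn [:: l] = j l.2.
Proof. by rewrite /symn /= pw_nil andbF /= mul0r addr0 mulr1 invr1 scale1r. Qed.

Lemma factS_inv n : (n.+1`!%:R : K)^-1 = (n.+1%:R)^-1 * (n`!%:R)^-1.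
Proof. by rewrite factS natrM invfM. Qed.

(** Multiplying by the length turns 1/n! into the 1/(n-1)! of the remaining letters. With its mirror
    image this drives the inductions on symmetrized words. *)
Lemma size_symnl w :
  (size w)%:R *: symn w = conv parL (fun u v => jl u * symn v) w.
Proof.
case: w => [|l w]; first by rewrite scale0r /= mul0r.
rewrite /symn [size _]/= factS_inv scalerA mulrA divff ?natfS_neq0 // mul1r.
rewrite -[symw _ _]/(conv _ (fun u v => jl u * symw (size w) v) (l :: w)).
rewrite conv_scale; apply: eq_conv => u v /perm_size.
rewrite size_cat [size (l :: w)]/= => uvw.
have [u1|/single_size->] := eqVneq (size u) 1%N; last first.
  by rewrite !mul0r scaler0.
have -> : size w = size v by move: uvw; rewrite u1 => -[].
by rewrite scalerAr.
Qed.

Lemma size_symnr w :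
  (size w)%:R *: symn w = conv parL (fun u v => symn u * jl v) w.
Proof.
case: w => [|l w]; first by rewrite scale0r /= mulr0.
rewrite /symn [size _]/= factS_inv scalerA mulrA divff ?natfS_neq0 // mul1r.
rewrite symwSr.
rewrite conv_scale; apply: eq_conv => u v /perm_size.
rewrite size_cat [size (l :: w)]/= => uvw.
have [v1|/single_size->] := eqVneq (size v) 1%N; last first.
  by rewrite !mulr0 scaler0.
have -> : size w = size u by move: uvw; rewrite v1 addn1 => -[].
by rewrite scalerAl.
Qed.

Lemma symn_mlin : mlin grL symn.
Proof.
move=> u v p a x y hu hv hx hy; rewrite /symn !size_cat /= symw_mlin //.
by rewrite scalerDr !scalerA mulrC.
Qed.

Lemma symn_msym : msym grL symn.
Proof.
by move=> u v l m hu hv hl hm; rewrite /symn !size_cat /= symw_msym // sgZ.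
Qed.

Lemma symw_gr n w : homL w -> symw n w \in word_gr gr i (deg w).
Proof.
elim: n w => [|n IHn] w hw.
  case: w hw => [_|l w _] /=; last exact: rpred0.
  by rewrite deg_nil word_gr1.
apply: conv_mem => u v uvw; have [hu hv] := homw_perm uvw hw.
rewrite (deg_perm uvw); apply: word_grM; last exact: IHn.
case: u hu {uvw} => [_|l [|? ?] hl]; [exact: rpred0| |exact: rpred0].
rewrite /= deg_cons deg_nil addr0.
by have [] := homw_prim hl (mem_head _ _).
Qed.

Lemma symn_gr w : homL w -> symn w \in word_gr gr i (deg w).
Proof. by move=> hw; apply/rpredZ/symw_gr. Qed.

(** Pull out a first letter; being primitive, it goes left or right. The splitting into [u] and [v]
    then arises [size u] times from the left and [size v] times from the right, in all [size w]
    times. *)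
Lemma coprod_symn w : homL w ->
  coprod gT (symn w) = conv parL (fun u v => tp (symn u) (symn v)) w.
Proof.
have [n] := ubnP (size w); elim: n w => // n IHn w wn hw.
case: (eqVneq w [::]) => [->|w0]; first by rewrite /= symn_nil coprod1.
have sw : ((size w)%:R : K) != 0 by case: (w) w0 => // l w' _; apply: natfS_neq0.
apply: (scalerI sw); rewrite -linearZZ size_symnl conv_lin.
transitivity (conv parL (fun u v =>
    conv parL (fun a b => tp (jl u * symn a) (symn b)) v
  + conv parL (fun a b => sg (pw parL u && pw parL a)
                             (tp (symn a) (jl u * symn b))) v) w).
  apply: eq_conv => u v uvw; have [hu hv] := homw_perm uvw hw.
  have [u1|u1] := eqVneq (size u) 1%N; last first.
    rewrite single_size // mul0r linear0 !conv_eq0 ?addr0 // => a b _.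
      by rewrite mul0r tp0r sg0.
    by rewrite mul0r tp0l.
  case: u u1 hu uvw => // l [] // _ hl uvw; have [_ cl] := homw_prim hl (mem_head _ _).
  rewrite -[jl _ * _]/(lmul (j l.2) _) cl IHn //; last first.
    by move/perm_size: uvw wn => <-.
  rewrite conv_lin -convD; apply: eq_conv => a b /homw_perm/(_ hv)[ha hb].
  rewrite dmapE (tau_gr _ _ (symn_gr ha)) oddz_deg sg_tpl pw_cons pw_nil addbF.
  by [].
rewrite convD; transitivity (conv parL (fun u v =>
    (size u)%:R *: tp (symn u) (symn v) + (size v)%:R *: tp (symn u) (symn v)) w).
  rewrite convD; congr (_ + _).
    rewrite convA; apply: eq_conv => u v _; rewrite -tpZl size_symnl.
    by rewrite -[tp _ _]/(tpl _ _ _) conv_lin.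
  (* Cocommutativity carries the extracted letter [u] past [a], so that it can be regrouped with
     [b]. *)
  rewrite convA; under eq_conv => c b _ do
    rewrite -(convC parL (fun a u => tp (symn a) (jl u * symn b))).
  rewrite -convA; apply: eq_conv => a d _; rewrite -tpZr size_symnl.
  by rewrite -[tp _ (conv _ _ _)]/(tpr _ _ _) conv_lin.
rewrite conv_scale; apply: eq_conv => u v /perm_size <-.
by rewrite -scalerDl -natrD size_cat.
Qed.

Lemma cprod_symn (B : algType K) (f g : {linear T -> B}) w : homL w ->
  cprod gT f g (symn w) = conv parL (fun u v => f (symn u) * g (symn v)) w.
Proof.
move=> hw; rewrite cprodE coprod_symn // conv_lin.
by apply: eq_conv => u v _; rewrite tmulE.
Qed.

(* The second Adams operation separates the symmetric powers of L in T. *)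
Lemma adams_symn w : homL w ->
  cprod gT (idl T) (idl T) (symn w) = 2 ^ (size w)%:Z *: symn w.
Proof.
move=> hw; rewrite cprod_symn // -exprnP.
have [n] := ubnP (size w); elim: n w hw => // n IHn w hw wn.
case: (eqVneq w [::]) => [->|w0].
  by rewrite /= symn_nil mul1r expr0 scale1r.
have sw : ((size w)%:R : K) != 0 by case: (w) w0 => // l w' _; apply: natfS_neq0.
apply: (scalerI sw); rewrite conv_scale /=.
have half (F : T) : 2 ^+ (size w) *: F = 2 ^+ (size w).-1 *: F + 2 ^+ (size w).-1 *: F.
  case: (w) w0 => // l w' _.
  by rewrite -scalerDl exprS mulrDl mul1r.
(* The length of [w] is split as [size u + size v]. The factor [size u] lets a letter out on the far
   left, the factor [size v] on the far right; what remains is the same convolution on a shorter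
   word. *)
have El : conv parL (fun u v => (size u)%:R *: (symn u * symn v)) w =
    conv parL (fun u v => jl u * conv parL (fun a b => symn a * symn b) v) w.
  transitivity (conv parL (fun u v =>
      conv parL (fun a b => jl u * symn a * symn b) v) w).
    rewrite convA; apply: eq_conv => u v _.
    by rewrite scalerAl size_symnl -[LHS]/(rmul _ _) conv_lin.
  apply: eq_conv => u v _; rewrite -[RHS]/(lmul _ _) conv_lin.
  by apply: eq_conv => a b _; rewrite /= mulrA.
have Er : conv parL (fun u v => (size v)%:R *: (symn u * symn v)) w =
    conv parL (fun u v => conv parL (fun a b => symn a * symn b) u * jl v) w.
  transitivity (conv parL (fun u v =>
      conv parL (fun a b => symn a * (symn b * jl v)) u) w).
    rewrite -convA; apply: eq_conv => u v _.
    by rewrite scalerAr size_symnr -[LHS]/(lmul _ _) conv_lin.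
  apply: eq_conv => u v _; rewrite -[RHS]/(rmul _ _) conv_lin.
  by apply: eq_conv => a b _; rewrite /= mulrA.
transitivity (conv parL (fun u v => (size u)%:R *: (symn u * symn v)) w
            + conv parL (fun u v => (size v)%:R *: (symn u * symn v)) w).
  rewrite -convD; apply: eq_conv => u v /perm_size <-.
  by rewrite size_cat natrD scalerDl.
rewrite {}El {}Er.
rewrite scalerA mulrC -scalerA half !size_symnl.
congr (_ + _); last rewrite -size_symnl size_symnr.
  rewrite conv_scale; apply: eq_conv => u v uvw; have [_ hv] := homw_perm uvw hw.
  have [u1|/single_size->] := eqVneq (size u) 1%N; last first.
    by rewrite !mul0r scaler0.
  move/perm_size: uvw wn => <-; rewrite size_cat u1 /= => vn.
  by rewrite IHn // scalerAr.
rewrite conv_scale; apply: eq_conv => u v uvw; have [hu _] := homw_perm uvw hw.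
have [v1|/single_size->] := eqVneq (size v) 1%N; last first.
  by rewrite !mulr0 scaler0.
move/perm_size: uvw wn => <-; rewrite size_cat v1 addn1 /= => vn.
by rewrite IHn // scalerAl.
Qed.

(** * Symmetrized words span: filtration by the number of Lie factors *)

Definition Lfilt n : {pred T} :=
  span [set y | exists w, [/\ homL w, (size w <= n)%N & y = lwj w]].
HB.instance Definition _ n := GRing.SubmodClosed.on (Lfilt n).

Lemma Lfilt_lw n w : homL w -> (size w <= n)%N -> lwj w \in Lfilt n.
Proof. by move=> hw wn; apply: mem_span; exists w. Qed.

Lemma LfiltM n l y : l.2 \in grL l.1 -> y \in Lfilt n -> j l.2 * y \in Lfilt n.+1.
Proof.
move=> hl; apply: (span_lin (f := lmul (j l.2))) => _ [w [hw wn ->]].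
by apply: mem_span; exists (l :: w); rewrite /= hl lw_cons.
Qed.

(** Moving a factor past another produces a commutator, which lies in the image of [L] by [j_br] and
    so replaces two factors by one. *)
Lemma Lfilt_insert w : homL w ->
  conv parL (fun u v => jl u * lwj v) w - (size w)%:R *: lwj w
    \in Lfilt (size w).-1.
Proof.
elim: w => [_|l w IHw /andP[hl hw]].
  by rewrite /= mul0r scale0r subr0 rpred0.
rewrite [conv _ _ _]/= conv_nil => [|x u v]; last by case: u => [|? ?]; rewrite mul0r.
(* The commutator of the head with the extracted letter, in the form in which [conv] produces it. *)
pose br u v := j l.2 * (jl u * lwj v) - sg (parL l && pw parL u) (jl u * lwj (l :: v)).
have brF : conv parL br w \in Lfilt (size w).
  apply: conv_mem => u v uvw; have [hu hv] := homw_perm uvw hw.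
  have [u1|u1] := eqVneq (size u) 1%N; last first.
    by rewrite /br single_size // !mul0r mulr0 sg0 subr0 rpred0.
  case: u hu u1 uvw => // m [] // /andP[hm _] _ /perm_size /= <-.
  have [c hc E] := j_br hl hm.
  have -> : br [:: m] v = lwj ((l.1 + m.1, c) :: v).
    rewrite /br /= pw_cons pw_nil addbF !lw_cons /= E /gcomm exprzM_sg mulrBl.
    by rewrite sg_mull !mulrA.
  by apply: Lfilt_lw; rewrite //= hc.
have -> : conv parL (fun u v => sg (parL l && pw parL u) (jl u * lwj (l :: v))) w
    = j l.2 * conv parL (fun u v => jl u * lwj v) w - conv parL br w.
  apply/eqP; rewrite eq_sym subr_eq -convD; apply/eqP.
  rewrite -[LHS]/(lmul _ _) conv_lin; apply: eq_conv => u v _.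
  by rewrite /br addrC subrK.
have IHl : j l.2 * (conv parL (fun u v => jl u * lwj v) w - (size w)%:R *: lwj w)
    \in Lfilt (size w).
  case: (w) (IHw) hw => [_ _|m w' IHw' hw'].
    by rewrite /= mul0r scale0r subr0 mulr0 rpred0.
  exact: LfiltM hl (IHw' hw').
move: IHl; rewrite mulrBr -scalerAr -[size (l :: w)]/(size w).+1 -natr1 scalerDl scale1r lw_cons.
rewrite -[(size w).+1.-1]/(size w).
set x := j l.2 * lwj w; set a := _ *: x; set c := j l.2 * conv _ _ _ => ca.
suff -> : x + (c - conv parL br w) - (a + x) = c - a - conv parL br w.
  exact: rpredB.
by rewrite opprD [LHS](AC (1*2*2) (2*4*3*(1*5)))%AC /= subrr addr0.
Qed.

(** Each of the n! orderings agrees, up to its sign, with the given one modulo shorter products. *)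
Lemma Lfilt_symw w : homL w ->
  symw (size w) w - (size w)`!%:R *: lwj w \in Lfilt (size w).-1.
Proof.
have [n] := ubnP (size w); elim: n w => // n IHn [_ _|l w wn hw].
  by rewrite /= lw_nil scale1r subrr rpred0.
set m := size w in wn *.
pose r (v : seq (letter L)) := symw m v - m`!%:R *: lwj v.
rewrite [size _]/= -/m [symw _ _](_ : _ =
    conv parL (fun u v => jl u * r v) (l :: w)
    + m`!%:R *: conv parL (fun u v => jl u * lwj v) (l :: w)); last first.
  rewrite conv_scale -convD; apply: eq_conv => u v _.
  by rewrite /r mulrBr scalerAr subrK.
rewrite -addrA factS mulnC natrM -scalerA -scalerBr; apply: rpredD; last first.
  exact/rpredZ/(Lfilt_insert hw).
apply: conv_mem => u v uvw; have [hu hv] := homw_perm uvw hw.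
have [u1|/single_size->] := eqVneq (size u) 1%N; last by rewrite mul0r rpred0.
case: u hu u1 uvw => // a [] // /andP[ha _] _ /perm_size [vm].
rewrite -[jl _]/(j a.2) /r.
have vn : (size v < n)%N by rewrite vm.
have := IHn v vn hv; rewrite vm -/m.
(* For [m = 0] the product would only be known to lie in [Lfilt 1]; there the remainder [r] itself
   is zero. *)
have [m0|m0] := posnP m; last by move=> H; have := LfiltM ha H; rewrite prednK.
have v0 : size v = 0%N by rewrite vm -/m m0.
by rewrite m0 (size0nil v0) /= lw_nil scale1r subrr mulr0 rpred0.
Qed.

Lemma lwj_symn n w : homL w -> (size w <= n)%N ->
  lwj w \in span [set y | exists w', homL w' /\ y = symn w'].
Proof.
elim: n w => [|n IHn] w hw wn.
  move: wn hw; rewrite leqn0 => /nilP-> _.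
  by apply: mem_span; exists [::]; rewrite symn_nil lw_nil.
have wF := Lfilt_symw hw.
have -> : lwj w = symn w - ((size w)`!%:R)^-1 *:
    (symw (size w) w - (size w)`!%:R *: lwj w).
  by rewrite scalerBr -/(symn w) scalerA mulVf ?factK // scale1r opprB addrC subrK.
apply: rpredB; first by apply: mem_span; exists w.
apply/rpredZ/(span_sub _ wF) => _ [w' [hw' wn' ->]]; apply: IHn => //.
by apply: leq_trans wn' _; case: (size w) wn.
Qed.

Lemma symn_span (x : T) :
  x \in span [set y | exists w, homL w /\ y = symn w].
Proof.
apply: span_sub (galg_gen gT x) => _ [w [hw ->]].
have [w' hw' ->] : exists2 w', homL w' & lw i w = lwj w'.
  elim: w hw => [_|l w IHw /andP[hl /IHw[w' hw' E]]].
    by exists [::]; rewrite ?lw_nil.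
  have [a ha E'] := j_gen hl.
  by exists ((l.1, a) :: w'); rewrite /= ?ha // !lw_cons E' E.
exact: lwj_symn (leqnn _).
Qed.

(** * The inverse of symmetrization: the Eulerian grading *)

Definition euler_gr (p : int) : submodClosed T :=
  span [set y | exists w, [/\ homL w, (size w)%:Z = p & y = symn w]].

Lemma symn_euler w : homL w -> symn w \in euler_gr (size w)%:Z.
Proof. by move=> hw; apply: mem_span; exists w. Qed.

(** The second Adams operation has eigenvalue 2^p on [euler_gr p], which gives directness. Lengths
    are taken as integers to reuse the results on gradings. *)
Lemma euler_graded : is_graded euler_gr.
Proof.
split.
  pose I := {w | homL w}.
  apply: (@graded_dec_span _ _ _ I (fun w => symn (sval w)) (fun w => (size (sval w))%:Z)).
    by case=> w hw; apply: symn_euler.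
  move=> x; apply: span_mono (symn_span x) => _ [w [hw ->]].
  by exists (exist _ w hw).
apply: (graded_free_eigen (P := cprod gT (idl T) (idl T)) (exp2z_inj K0)).
move=> p x; apply: (eq_lin_span (g := 2 ^ p \*: idl T)) => _ [w [hw <- ->]].
exact: adams_symn.
Qed.

Lemma euler_lin (Z : lmodType K) (f g : {linear T -> Z}) :
  (forall w, homL w -> f (symn w) = g (symn w)) -> f =1 g.
Proof.
by move=> fg x; apply: eq_lin_span (symn_span x) => _ [w [hw ->]]; apply: fg.
Qed.

(** The first Eulerian idempotent with values in [L]: the part of length 1 lies in the image of [j],
    which is inverted there by injectivity, and the other parts go to 0. *)
Lemma primpart_ex : exists E : {linear T -> L},
  forall w, homL w -> E (symn w) = if w is [:: l] then l.2 else 0.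
Proof.
have inv1 x : x \in euler_gr 1 -> exists a, j a = x.
  move: x; apply: span_ind => [|c x y [a <-] [b <-]|_ [w [_ + ->]]].
  - by exists 0; rewrite linear0.
  - by exists (c *: a + b); rewrite linearP.
  by case: w => [|l [|? ?]] // _; exists l.2; rewrite symn1.
pose G (p : int) x := if p == 1 then xget 0 [set a | j a = x] else 0.
have GE a : j a \in euler_gr 1 -> G 1 (j a) = a.
  rewrite /G eqxx => /inv1 ex; apply: j_inj.
  by have [b jb] := ex; apply: (xgetPex 0 ex).
have [E EG] : exists E : {linear T -> L}, forall p x, x \in euler_gr p -> E x = G p x.
  apply: (graded_lin_ex euler_graded) => p c x y; rewrite /G.
  case: eqP => [->|_ _ _]; last by rewrite scaler0 addr0.
  move=> xE yE; have [a Ea] := inv1 x xE; have [b Eb] := inv1 y yE.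
  have := GE (c *: a + b); rewrite /G eqxx linearP Ea Eb => ->; last first.
    by rewrite rpredD ?rpredZ.
  have := GE a; rewrite /G eqxx Ea => -> //.
  by have := GE b; rewrite /G eqxx Eb => ->.
exists E => w hw; rewrite (EG _ _ (symn_euler hw)) /G.
case: w hw => [|l [|m w]] //= hw.
have := GE l.2; rewrite /G eqxx symn1; apply.
by rewrite -symn1; apply: symn_euler.
Qed.

Section LeftInverse.
Variable E : {linear T -> L}.
Hypothesis EE : forall w, homL w -> E (symn w) = if w is [:: l] then l.2 else 0.

Let sE : {linear T -> S} := compl (mklin (galg_linear gS)) E.

(** Convolution powers of [sE]. The start [e] stands for the counit followed by the unit, the
    neutral element of convolution. *)
Fixpoint powE n : {linear T -> S} :=
  if n is n'.+1 then cprod gT sE (powE n') else e.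

Lemma powE_symn n w : homL w ->
  powE n (symn w) = if size w == n then n`!%:R *: lws w else 0.
Proof.
elim: n w => [|n IHn] w hw.
  case: w hw => [|l w] hw; first by rewrite /= symn_nil e1 lw_nil scale1r.
  have sw : ((size (l :: w))%:R : K) != 0 by apply: natfS_neq0.
  apply: (scalerI sw); rewrite scaler0 -linearZZ size_symnl conv_lin.
  apply: conv_eq0 => u v _; case: u => [|m [|? ?]]; rewrite /= ?mul0r ?linear0 //.
rewrite -[powE n.+1]/(cprod gT sE (powE n)) cprod_symn //.
transitivity (conv parL (fun u v =>
    (if size w == n.+1 then n`!%:R else 0) *: (single s u * lws v)) w).
  apply: eq_conv => u v uvw; have [hu hv] := homw_perm uvw hw.
  have -> : sE (symn u) = single s u.
    rewrite -[LHS]/(s (E _)) EE //; case: u {uvw hu} => [|l [|m u]] //=;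
      exact: (linear0 (mklin (galg_linear gS))).
  have [u1|/single_size->] := eqVneq (size u) 1%N; last by rewrite !mul0r scaler0.
  move/perm_size: uvw; rewrite size_cat u1 IHn // => <-; rewrite add1n eqSS.
  by case: eqP => _; rewrite ?mulr0 ?scale0r // scalerAr.
rewrite -conv_scale (single_lws gS) //; case: eqP => [->|_]; last by rewrite scale0r.
by rewrite scalerA factS natrM mulrC.
Qed.

End LeftInverse.

(** The convolution exponential of [sE]: on length n only its n-th term survives, so the series
    reduces to one term on each piece of the grading. *)
Lemma sympbw_ex : exists Q : {linear T -> S},
  forall w, homL w -> Q (symn w) = lws w.
Proof.
have [E EE] := primpart_ex.
have [Q QE] : exists Q : {linear T -> S}, forall p x, x \in euler_gr p ->
    Q x = ((absz p)`!%:R : K)^-1 *: powE E (absz p) x.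
  apply: (graded_lin_ex euler_graded) => p a x y _ _.
  by rewrite linearP scalerDr !scalerA mulrC.
exists Q => w hw; rewrite (QE _ _ (symn_euler hw)) powE_symn // eqxx.
by rewrite scalerA mulVf ?scale1r // factK.
Qed.

Definition pbwinv : {linear T -> S} := sval (cid sympbw_ex).

Lemma pbwinv_symn w : homL w -> pbwinv (symn w) = lws w.
Proof. exact: (svalP (cid sympbw_ex)). Qed.

Definition pbw : {linear S -> T} := glift gS symn_mlin (fun=> symn_msym).

Lemma pbw_lw w : homL w -> pbw (lws w) = symn w.
Proof. exact: gliftE. Qed.

Lemma pbwK : cancel pbw pbwinv.
Proof.
apply: (eq_galg gS (f := compl pbwinv pbw) (g := idl S)) => w hw.
by rewrite /= pbw_lw // pbwinv_symn.
Qed.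

Lemma pbwinvK : cancel pbwinv pbw.
Proof.
apply: (euler_lin (f := compl pbw pbwinv) (g := idl T)) => w hw.
by rewrite /= pbwinv_symn // pbw_lw.
Qed.

Local Notation grS := (word_gr grL s).
Local Notation grT := (word_gr gr i).

Lemma pbw_gr p x : x \in grS p -> pbw x \in grT p.
Proof.
apply: (word_gr_ind (f := pbw)) => w hw <-.
by rewrite pbw_lw //; apply: symn_gr.
Qed.

(** [pbw] carries the components of [pbwinv x] to those of [x]; directness in T leaves only the one
    of degree [p]. *)
Lemma pbwinv_gr p x : x \in grT p -> pbwinv x \in grS p.
Proof.
move=> xp; have [t [f d]] := (decomposesP grS).2 (galg_dec gS) (pbwinv x).
have [ut fg f0 E] := d.
have dT : decomposes grT x t (fun q => pbw (f q)).
  split=> // [q|q /f0->|]; [exact: pbw_gr|exact: linear0|].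
  by rewrite -linear_sum -E pbwinvK.
have fE := decomposes_uniq (galg_is_graded gT K0) dT (decomposes1 xp).
rewrite E; apply: rpred_sum => q _; have := fE q; case: (eqVneq q p) => [-> _|_ E0].
  exact: fg.
by rewrite -(pbwK (f q)) E0 linear0 rpred0.
Qed.

Lemma tau_pbwinv b x : pbwinv (tau gT b x) = tau gS b (pbwinv x).
Proof.
apply: (euler_lin (f := compl pbwinv (tau gT b)) (g := compl (tau gS b) pbwinv)) => w hw.
rewrite -[LHS]/(pbwinv (tau gT b _)) -[RHS]/(tau gS b (pbwinv _)).
rewrite (tau_gr gT _ (symn_gr hw)) pbwinv_symn // (tau_gr gS _ (lw_word_gr s hw)).
by rewrite lin_sg pbwinv_symn.
Qed.

Lemma coprod_pbwinv x :
  coprod gS (pbwinv x) = tmap pbwinv pbwinv (coprod gT x).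
Proof.
apply: (euler_lin (f := compl (coprod gS) pbwinv)
  (g := compl (tmap pbwinv pbwinv) (coprod gT))) => w hw.
rewrite -[LHS]/(coprod gS (pbwinv _)) -[RHS]/(tmap _ _ (coprod gT _)).
rewrite pbwinv_symn // coprod_lw // coprod_symn // conv_lin.
apply: eq_conv => u v /homw_perm/(_ hw)[hu hv].
by rewrite tmapE !pbwinv_symn.
Qed.

Section Transport.
Variable D : {linear T -> T}.

Definition transport : {linear S -> S} := compl pbwinv (compl D pbw).

Lemma transport_coder b : coder gT b D -> coder gS b transport.
Proof.
move=> cD x; rewrite -[transport x]/(pbwinv (D (pbw x))) coprod_pbwinv cD.
transitivity (dmap gS b transport (tmap pbwinv pbwinv (coprod gT (pbw x)))).
  move: (coprod gT (pbw x)).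
  apply: (eq_tens (f := compl (tmap pbwinv pbwinv) (dmap gT b D))
    (g := compl (dmap gS b transport) (tmap pbwinv pbwinv))) => y z.
  rewrite -[LHS]/(tmap _ _ (dmap gT b D _)) -[RHS]/(dmap gS b transport (tmap _ _ _)).
  rewrite dmapE linearD !tmapE dmapE -tau_pbwinv.
  by rewrite -![transport _]/(pbwinv (D (pbw _))) !pbwinvK.
by rewrite -coprod_pbwinv pbwK.
Qed.

Lemma transport_deg p : deg_map gr i p D -> deg_map grL s p transport.
Proof. by move=> dD q x xq; apply/pbwinv_gr/dD/pbw_gr. Qed.

End Transport.

End PBW.

(** * Coderivations of the symmetric coalgebra *)

Section SymmetricCoderivation.
Variables (K : fieldType) (K0 : [pchar K] =i pred0).
Variables (L : lmodType K) (grL : int -> submodClosed L).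
Variables (S : algType K) (s : L -> S) (gS : galg true grL s).
Local Notation homL := (homw grL).
Local Notation lws := (lw s).
Local Notation parL := (@par K L).
Local Notation grS := (word_gr grL s).

Let sl : {linear L -> S} := mklin (galg_linear gS).

Definition letter1 (w : seq (letter L)) : L := if w is [:: l] then l.2 else 0.

Lemma letter1_mlin : mlin grL letter1.
Proof.
move=> [|l u] [|m v] p a x y _ _ _ _ //=; rewrite ?scaler0 ?addr0 //.
by case: u => [|? ?]; rewrite /= scaler0 addr0.
by case: u => [|? ?]; rewrite /= scaler0 addr0.
Qed.

Lemma letter1_msym : msym grL letter1.
Proof.
by case=> [|l [|m u]] v a b _ _ _ _ //=; rewrite ?sg0 //; case: u => [|? ?] /=; rewrite sg0.
Qed.

Definition corestr : {linear S -> L} := glift gS letter1_mlin (fun=> letter1_msym).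

Lemma corestr_lw w : homL w -> corestr (lws w) = letter1 w.
Proof. exact: gliftE. Qed.

Lemma single_corestr w : homL w -> s (corestr (lws w)) = single s w.
Proof.
move=> hw; rewrite corestr_lw //.
by case: w {hw} => [|l [|m w]] //=; apply: (linear0 sl).
Qed.

Lemma corestr_gr p x : x \in grS p -> corestr x \in grL p.
Proof.
apply: (word_gr_ind (f := corestr)) => w hw <-; rewrite corestr_lw //.
case: w hw => [|l [|m w]] //= hw; try exact: rpred0.
by rewrite deg_cons deg_nil addr0; case/andP: hw.
Qed.

Fact unit_part_mlin : mlin grL (fun w => if w is [::] then 1 : S else 0).
Proof. by case=> [|? ?] v p a x y _ _ _ _ /=; rewrite scaler0 addr0. Qed.
Fact unit_part_msym : msym grL (fun w => if w is [::] then 1 : S else 0).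
Proof. by case=> [|? ?] v p a _ _ _ _ /=; rewrite sg0. Qed.

Definition unit_part : {linear S -> S} :=
  glift gS unit_part_mlin (fun=> unit_part_msym).

Lemma unit_part_lw w : homL w -> unit_part (lws w) = if w is [::] then 1 else 0.
Proof. exact: gliftE. Qed.

Fact size_inv_mlin :
  mlin grL (fun w => if w is [::] then 0 else ((size w)%:R : K)^-1 *: lws w).
Proof.
move=> u v p a x y hu hv hx hy; have := mlin_lw gS a hu hv hx hy => E.
case: u hu E => [|l u] hu E /=; rewrite ?size_cat /=.
  by rewrite [lws _]E scalerDr !scalerA mulrC.
by rewrite [lws _]E scalerDr !scalerA mulrC.
Qed.

Fact size_inv_msym :
  msym grL (fun w => if w is [::] then 0 else ((size w)%:R : K)^-1 *: lws w).
Proof.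
move=> u v l m hu hv hl hm; have E := lw_swap gS isT u v hl hm.
case: u hu E => [|n u] hu E /=; first by rewrite [lws _]E sgZ.
by rewrite !size_cat /= [lws _]E sgZ.
Qed.

(* size_inv inverts the length operator (corestr * id) on the positive part. *)
Definition size_inv : {linear S -> S} :=
  glift gS size_inv_mlin (fun=> size_inv_msym).

Definition size_op : {linear S -> S} :=
  cprod gS (compl sl corestr) (idl S).

Lemma size_op_lw w : homL w -> size_op (lws w) = (size w)%:R *: lws w.
Proof.
move=> hw; rewrite /size_op cprod_lw // -(single_lws gS hw).
apply: eq_conv => u v /homw_perm/(_ hw)[hu hv].
by rewrite -[compl _ _ _]/(s (corestr _)) single_corestr.
Qed.

Lemma size_invK x : size_inv (size_op x) + unit_part x = x.
Proof.
apply: (eq_galg gS (f := compl size_inv size_op \+ unit_part) (g := idl S)) => w hw.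
rewrite -[LHS]/(size_inv (size_op _) + unit_part _) size_op_lw // linearZZ.
rewrite unit_part_lw // gliftE //; case: w hw => [|l w] hw.
  by rewrite scaler0 add0r lw_nil.
by rewrite addr0 scalerA divff ?scale1r // natfS_neq0.
Qed.

Lemma size_op_inj x : size_op x = 0 -> unit_part x = 0 -> x = 0.
Proof. by move=> x0 x1; rewrite -(size_invK x) x0 x1 linear0 addr0. Qed.

Lemma gr_comm p q x y : x \in grL p -> y \in grS q ->
  s x * y = sg (oddz p && oddz q) (y * s x).
Proof.
move=> xp; rewrite sg_scale; move/word_grE.
apply: (eq_lin_span (f := lmul (s x)) (g := _ \*: rmul (s x))) => _ [w [hw <- ->]].
rewrite -[LHS]/(s x * lws w) -[RHS]/(_ *: (lws w * s x)) -sg_scale oddz_deg.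
elim: w hw => [_|l w IHw /andP[hl hw]].
  by rewrite lw_nil mulr1 mul1r pw_nil andbF.
rewrite lw_cons mulrA (galg_comm gS isT (l := (p, x)) xp hl).
rewrite sg_mull -!mulrA IHw // sg_mulr sg_sg pw_cons.
by rewrite /par /= -andb_addr.
Qed.

Variable D : {linear S -> S}.
Hypothesis D_deg : deg_map grL s 1 D.
Hypothesis D_coder : coder gS true D.
Hypothesis D_pos : forall x, unit_part (D x) = 0.

Local Notation lam u := (s (corestr (D (lws u)))).

Lemma lam_gr u : homL u -> corestr (D (lws u)) \in grL (1 + deg u).
Proof. by move=> hu; apply/corestr_gr/D_deg/lw_word_gr. Qed.

(* A coderivation is determined by its corestriction: compare both sides
   after applying the length operator, by induction on the length. *)
Lemma coder_corestr w : homL w ->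
  D (lws w) = conv parL (fun u v => lam u * lws v) w.
Proof.
have [n] := ubnP (size w); elim: n w => // n IHn w wn hw.
(* The length operator kills the unit, so it is checked separately that neither side has a unit
   component. *)
apply/eqP; rewrite -subr_eq0; apply/eqP/size_op_inj; last first.
  rewrite linearB D_pos conv_lin sub0r conv_eq0 ?oppr0 // => u v uvw.
  have [hu hv] := homw_perm uvw hw.
  have := unit_part_lw (w := (1 + deg u, corestr (D (lws u))) :: v).
  by rewrite /= lam_gr // lw_cons; apply.
apply/eqP; rewrite linearB subr_eq0; apply/eqP.
rewrite -[LHS]/(tmul (compl sl corestr) (idl S) (coprod gS (D (lws w)))).
rewrite D_coder coprod_lw // !conv_lin.
(* In the first sum [D] has acted on the left part. In the second, one letter is split off, [D] acts
   on the shorter rest by induction, and the letter is moved past the bracket. *)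
transitivity (conv parL (fun u v => lam u * lws v) w
  + conv parL (fun u v => conv parL (fun a b =>
      sg (pw parL u && pw parL a) (lam a * single s u * lws b)) v) w).
  rewrite -convD; apply: eq_conv => u v uvw; have [hu hv] := homw_perm uvw hw.
  rewrite dmapE (tau_lw gS _ hu) linearD sg_tpl lin_sg !tmulE.
  rewrite -![compl _ _ _]/(s (corestr _)) single_corestr //; congr (_ + _).
  have [u1|u1] := eqVneq (size u) 1%N; last first.
    rewrite single_size // mul0r sg0 conv_eq0 // => a b _.
    by rewrite mulr0 mul0r sg0.
  case: u u1 hu uvw => // l [] // _ hl uvw; rewrite [idl S _]/=.
  rewrite IHn //; last by move/perm_size: uvw wn => <-.
  rewrite -[_ * conv _ _ _]/(lmul _ _) conv_lin -conv_sg.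
  apply: eq_conv => a b /homw_perm/(_ hv)[ha hb].
  have hl1 : l.2 \in grL l.1 by case/andP: hl.
  rewrite -[lmul _ _]/(s l.2 * _) mulrA (gr_comm hl1 (letter_gr s (l := (_, _)) (lam_gr ha))).
  rewrite sg_mull sg_sg pw_cons pw_nil addbF oddzD oddz_deg; congr (sg _ _).
  by rewrite /par; case: oddz; case: pw.
rewrite convA; under [X in _ + X]eq_conv => c b _ do
  rewrite -(convC parL (fun a u => lam a * single s u * lws b)).
(* Each [lam u * lws v] occurs once from the first sum and [size v] times from the second; the total
   is its length. *)
rewrite -convA -convD; apply: eq_conv => u v uvw.
have [hu hv] := homw_perm uvw hw.
have := size_op_lw (w := (1 + deg u, corestr (D (lws u))) :: v).
rewrite /= lam_gr // lw_cons => -> //.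
rewrite -natr1 scalerDl scale1r addrC; congr (_ + _).
rewrite scalerAr -(single_lws gS hv) -[RHS]/(lmul _ _) conv_lin.
by apply: eq_conv => a b _; rewrite /= mulrA.
Qed.

End SymmetricCoderivation.

(** * Permutations and shuffles *)

Section LiftPerm.
Variable n : nat.

Lemma lift_perm_bijr (i : 'I_n.+1) :
  bijective (fun p : 'I_n.+1 * 'S_n => lift_perm i p.1 p.2).
Proof.
apply: inj_card_bij => [[k s] [k' s'] /= /permP E|].
  have Ek : k = k' by have := E i; rewrite !lift_perm_id.
  rewrite -Ek in E *; congr (_, _); apply/permP => j.
  by have := E (lift i j); rewrite !lift_perm_lift => /lift_inj.
by rewrite card_prod card_ord !card_Sn factS.
Qed.

Lemma lift_perm_bijl (k : 'I_n.+1) :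
  bijective (fun p : 'I_n.+1 * 'S_n => lift_perm p.1 k p.2).
Proof.
apply: inj_card_bij => [[i s] [i' s'] /= /permP E|].
  have Ei : i = i'.
    apply: (@perm_inj _ (lift_perm i k s)).
    by rewrite [in RHS]E !lift_perm_id.
  rewrite -Ei in E *; congr (_, _); apply/permP => j.
  by have := E (lift i j); rewrite !lift_perm_lift => /lift_inj.
by rewrite card_prod card_ord !card_Sn factS.
Qed.

Lemma sum_liftr (Z : nmodType) (i : 'I_n.+1) (G : 'S_n.+1 -> Z) :
  \sum_(s : 'S_n.+1) G s = \sum_(k < n.+1) \sum_(s : 'S_n) G (lift_perm i k s).
Proof.
rewrite (reindex _ (onW_bij _ (lift_perm_bijr i))) /=.
by rewrite [RHS]pair_big /=.
Qed.

Lemma sum_liftl (Z : nmodType) (k : 'I_n.+1) (G : 'S_n.+1 -> Z) :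
  \sum_(s : 'S_n.+1) G s = \sum_(i < n.+1) \sum_(s : 'S_n) G (lift_perm i k s).
Proof.
rewrite (reindex _ (onW_bij _ (lift_perm_bijl k))) /=.
by rewrite [RHS]pair_big /=.
Qed.

Lemma lift_perm_ex (i : 'I_n.+1) (s : 'S_n.+1) :
  exists s', s = lift_perm i (s i) s'.
Proof.
have [f _ fK] := lift_perm_bijr i; have := fK s; case: (f s) => k s' /= E.
by exists s'; rewrite -[in RHS]E lift_perm_id E.
Qed.

End LiftPerm.

Section Koszul.
Variable K : fieldType.

Definition ksg (p q : int) : K := (-1) ^ (p * q).

Lemma ksgC p q : ksg p q = ksg q p. Proof. by rewrite /ksg mulrC. Qed.

Definition del (T : Type) (k : nat) (x : seq T) := take k x ++ drop k.+1 x.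

Lemma nth_del (T : Type) (x0 : T) k x m :
  (k < size x)%N -> nth x0 (del k x) m = nth x0 x (bump k m).
Proof.
move=> kx; rewrite nth_cat size_takel; last exact: ltnW.
rewrite /bump; case: (ltnP m k) => [mk|km]; first by rewrite nth_take.
by rewrite nth_drop; congr nth; lia.
Qed.

Lemma size_del (T : Type) k (x : seq T) : (k < size x)%N -> size (del k x) = (size x).-1.
Proof. by move=> kx; rewrite size_cat size_drop size_takel; lia. Qed.

(** Only the pairs containing the new position matter: it is inverted with position [j] exactly when
    one, but not both, of [j < i] and [s j < k] holds. *)
Lemma koszul_lift n (i k : 'I_n.+1) (s : 'S_n) (e : seq int) :
  (k < size e)%N ->
  koszul (lift_perm i k s) e = koszul s (del k e) *
    \prod_(j < n) (if (j < i)%N (+) (s j < k)%N then ksg e`_k (del k e)`_(s j) else 1)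
  :> K.
Proof.
move=> ke; rewrite /koszul (bigD1_ord i) //= lift_perm_id.
rewrite big_mkcond (bigD1_ord i) //= ltnn mul1r.
under [X in _ * X]eq_bigr => j _.
  rewrite lift_perm_lift big_mkcond (bigD1_ord i) //= lift_perm_id.
  over.
rewrite big_split mulrA mulrC /=; congr (_ * _).
  apply: eq_bigr => j _; rewrite [RHS]big_mkcond /=; apply: eq_bigr => m _.
  by rewrite lift_perm_lift /= !ltnNge !leq_bump2 !(nth_del _ _ ke).
rewrite -big_split; apply: eq_bigr => j _ /=.
rewrite lift_perm_lift (nth_del _ _ ke) /= /bump.
have -> : (i < (i <= j) + j)%N = ~~ (j < i)%N by lia.
have -> : ((i <= j) + j < i)%N = (j < i)%N by lia.
have -> : ((k <= s j) + s j < k)%N = (s j < k)%N by lia.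
have -> : (k < (k <= s j) + s j)%N = ~~ (s j < k)%N by lia.
by case: ltnP => _; case: ltnP => _; rewrite /= ?mulr1 ?mul1r // ksgC.
Qed.

End Koszul.

Section WordPermutations.
Variables (K : fieldType) (V : lmodType K).
Implicit Types w u : seq (letter V).
Local Notation parV := (@par K V).
Local Notation l0 := ((0, 0) : letter V).

Definition permw n (s : 'S_n) w : seq (letter V) :=
  [seq nth l0 w (s i) | i <- enum 'I_n].

Lemma size_permw n (s : 'S_n) w : size (permw s w) = n.
Proof. by rewrite size_map size_enum_ord. Qed.

Lemma nth_permw n (s : 'S_n) w (i : 'I_n) :
  nth l0 (permw s w) i = nth l0 w (s i).
Proof.
by rewrite (nth_map i) ?size_enum_ord // nth_ord_enum.
Qed.

Lemma permute_unzip1 n (s : 'S_n) w : permute s (unzip1 w) = unzip1 (permw s w).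
Proof.
rewrite /permute /permw /unzip1 -[RHS]map_comp; apply: eq_map => i /=.
have [iw|iw] := ltnP (s i) (size w); first by rewrite (nth_map l0).
by rewrite !nth_default ?size_map.
Qed.

Lemma permute_unzip2 n (s : 'S_n) w : permute s (unzip2 w) = unzip2 (permw s w).
Proof.
rewrite /permute /permw /unzip2 -[RHS]map_comp; apply: eq_map => i /=.
have [iw|iw] := ltnP (s i) (size w); first by rewrite (nth_map l0).
by rewrite !nth_default ?size_map.
Qed.

Lemma permw_lift n (i k : 'I_n.+1) (s : 'S_n) w : size w = n.+1 ->
  let y := permw s (del k w) in
  permw (lift_perm i k s) w = take i y ++ nth l0 w k :: drop i y.
Proof.
move=> sw y; have sy : size y = n by apply: size_permw.
have kw : (k < size w)%N by rewrite sw.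
apply: (@eq_from_nth _ l0).
  rewrite size_permw size_cat /= size_drop size_takel sy; last by rewrite -ltnS.
  by have := ltn_ord i; lia.
rewrite size_permw => m mn; rewrite -[m]/(val (Ordinal mn)) nth_permw.
have iy : (i <= size y)%N by rewrite sy -ltnS.
case: (unliftP i (Ordinal mn)) => [m'|] ->.
  rewrite lift_perm_lift -(nth_del l0 _ kw) -nth_permw -/y nth_cat size_takel //.
  rewrite /= /bump; case: (leqP i m') => im.
    have -> : (1 + m' < i)%N = false by lia.
    have -> : (1 + m' - i = (m' - i).+1)%N by lia.
    by rewrite /= nth_drop subnKC.
  by rewrite add0n im nth_take.
by rewrite lift_perm_id nth_cat size_takel // ltnn subnn.
Qed.

Lemma prod_take (T : Type) (x0 : T) (F : T -> K) y i :
  \prod_(j < size y) (if (j < i)%N then F (nth x0 y j) else 1) =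
  \prod_(l <- take i y) F l.
Proof.
elim: y i => [|z y IHy] i; first by rewrite big_ord0 big_nil.
rewrite big_ord_recl; case: i => [|i] /=.
  by rewrite big_nil big1 ?mulr1.
rewrite big_cons -IHy; congr (_ * _).
Qed.

Lemma prod_ksg (Z : lmodType K) p u (z : Z) :
  \prod_(l <- u) ksg K p l.1 *: z = sg (oddz p && pw parV u) z.
Proof.
elim: u => [|l u IHu]; first by rewrite big_nil scale1r pw_nil andbF.
rewrite big_cons -scalerA IHu /ksg exprzM_sg sg_sg pw_cons -[oddz l.1]/(parV l).
by congr (sg _ _); case: oddz; case: parV; case: pw.
Qed.

Lemma unzip1_del k w : unzip1 (del k w) = del k (unzip1 w).
Proof. by rewrite /unzip1 map_cat map_take map_drop. Qed.

Lemma nth_unzip1 w k : (unzip1 w)`_k = (nth l0 w k).1.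
Proof.
have [kw|kw] := ltnP k (size w); first by rewrite (nth_map l0).
by rewrite !nth_default ?size_map.
Qed.

Lemma koszul_lift0l n (k : 'I_n.+1) (s : 'S_n) w (Z : lmodType K) (z : Z) :
  size w = n.+1 ->
  koszul (lift_perm ord0 k s) (unzip1 w) *: z =
  sg (parV (nth l0 w k) && pw parV (take k w)) (koszul s (unzip1 (del k w)) *: z).
Proof.
move=> sw; have kw : (k < size w)%N by rewrite sw.
rewrite koszul_lift ?size_map // -unzip1_del -scalerA sgZ; congr (_ *: _).
rewrite -prod_ksg; congr (_ *: _).
have tk : take k w = take k (del k w).
  by rewrite /del take_size_cat // size_takel // ltnW.
have sd : size (del k w) = n by rewrite size_del // sw.
rewrite tk -(prod_take l0) sd [RHS](reindex_inj (@perm_inj _ s)) /=.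
by apply: eq_bigr => j _; rewrite !nth_unzip1.
Qed.

Lemma koszul_lift0r n (i : 'I_n.+1) (s : 'S_n) l w (Z : lmodType K) (z : Z) :
  size w = n ->
  koszul (lift_perm i ord0 s) (unzip1 (l :: w)) *: z =
  sg (parV l && pw parV (take i (permw s w))) (koszul s (unzip1 w) *: z).
Proof.
move=> sw.
rewrite koszul_lift ?size_map // -unzip1_del /del take0 drop1 /=.
rewrite -scalerA sgZ; congr (_ *: _).
rewrite -prod_ksg; congr (_ *: _).
rewrite -(prod_take l0) size_permw; apply: eq_bigr => j _.
by rewrite addbF nth_unzip1 nth_permw.
Qed.

(** [shuffle] with the size of the permutation freed from the shape [p + q], as induction on [n]
    requires; both are convertible at [n = p + q]. *)
Definition shuf n (p : nat) (s : 'S_n) : bool :=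
  [forall i : 'I_n, forall j : 'I_n,
     (i < j)%N && ((j < p)%N || (p <= i)%N) ==> (s i < s j)%N].

Lemma shufP n p (s : 'S_n) :
  reflect (forall i j : 'I_n, (i < j)%N -> (j < p)%N || (p <= i)%N -> (s i < s j)%N)
    (shuf p s).
Proof.
apply: (iffP 'forall_forallP) => H i j.
  by move=> ij h; have := H i j; rewrite ij h.
by apply/implyP => /andP[ij h]; apply: H.
Qed.

Lemma shuf_lift0 n p (s : 'S_n) : shuf p.+1 (lift_perm ord0 ord0 s) = shuf p s.
Proof.
apply/shufP/shufP => H i j.
  move=> ij h; have := H (lift ord0 i) (lift ord0 j).
  by rewrite !lift_perm_lift /= /bump !add1n !ltnS; apply.
case: (unliftP ord0 i) => [i'|] ->; case: (unliftP ord0 j) => [j'|] -> //.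
  by rewrite !lift_perm_lift /= /bump !add1n !ltnS; apply: H.
by rewrite lift_perm_lift lift_perm_id.
Qed.

Lemma shuf_liftp n p (s : 'S_n) (i0 : 'I_n.+1) : i0 = p :> nat ->
  shuf p (lift_perm i0 ord0 s) = shuf p s.
Proof.
move=> ip; apply/shufP/shufP => H i j.
  move=> ij h; have := H (lift i0 i) (lift i0 j).
  rewrite !lift_perm_lift /= /bump !add1n !ltnS ip; apply; lia.
case: (unliftP i0 i) => [i'|] ->; case: (unliftP i0 j) => [j'|] ->.
- rewrite !lift_perm_lift /= /bump !add1n !ltnS ip => ij h; apply: H; lia.
- by rewrite lift_perm_id /= /bump ip; lia.
- by rewrite lift_perm_lift lift_perm_id.
by rewrite ltnn.
Qed.

(** Values increase along each block, so the least value sits at the head of a block. *)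
Lemma shuf_lift_pos n p (s : 'S_n) (i0 : 'I_n.+1) :
  shuf p (lift_perm i0 ord0 s) -> i0 = 0%N :> nat \/ i0 = p :> nat.
Proof.
move=> /shufP H; case: (posnP i0) => [|i_gt0]; first by left.
right; have [ip|pi|//] := ltngtP i0 p.
  by have := H ord0 i0 i_gt0; rewrite ip lift_perm_id => /(_ isT).
have pn : (p < n.+1)%N by apply: ltn_trans pi _.
have := H (Ordinal pn) i0 pi; rewrite /= leqnn orbT lift_perm_id.
by move=> /(_ isT).
Qed.

(** Bridge from the permutation sums of the definitions to [conv]. The first letter of [w] heads the
    first or the second block of a shuffle, and these are the two summands in the recursion of
    [conv]. *)
Lemma shuffle_sum (Z : lmodType K) n p w (F : seq (letter V) -> seq (letter V) -> Z) :
  (p <= n)%N -> size w = n ->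
  \sum_(s : 'S_n | shuf p s) koszul s (unzip1 w) *:
     F (take p (permw s w)) (drop p (permw s w)) =
  conv parV (fun u v => if size u == p then F u v else 0) w.
Proof.
elim: n p w F => [|n IHn] p w F pn sw.
  move: pn sw; rewrite leqn0 => /eqP-> /size0nil->.
  have s1 (s : 'S_0) : s = perm_one _ by apply/permP => -[].
  rewrite (big_pred1 (perm_one 'I_0)) => [|s]; last first.
    by rewrite [RHS](introT eqP (s1 s)); apply/shufP => -[].
  by rewrite /koszul big_ord0 scale1r /permw enum_ord0.
case: w sw => // l w [sw]; rewrite big_mkcond (sum_liftl ord0).
pose H p i (s : 'S_n) := if shuf p (lift_perm i ord0 s) then
  koszul (lift_perm i ord0 s) (unzip1 (l :: w)) *:
  F (take p (permw (lift_perm i ord0 s) (l :: w)))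
    (drop p (permw (lift_perm i ord0 s) (l :: w))) else 0.
have pwE (i : 'I_n.+1) (s : 'S_n) : permw (lift_perm i ord0 s) (l :: w) =
    take i (permw s w) ++ l :: drop i (permw s w).
  by rewrite permw_lift /= ?sw // /del take0 drop1.
have Hp q (i : 'I_n.+1) : i = q :> nat -> \sum_(s : 'S_n) H q i s =
    conv parV (fun u v => sg (parV l && pw parV u)
      (if size u == q then F u (l :: v) else 0)) w.
  move=> ip; have pn' : (q <= n)%N by rewrite -ip -ltnS.
  under eq_bigr => s _.
    rewrite /H shuf_liftp // koszul_lift0r // pwE ip.
    have st : size (take q (permw s w)) = q by rewrite size_takel ?size_permw.
    rewrite take_size_cat // drop_size_cat //.
    rewrite sgZ; over.
  rewrite -big_mkcond /=; apply: etrans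
    (IHn q w (fun u v => sg (parV l && pw parV u) (F u (l :: v))) pn' sw) _.
  by apply: eq_conv => u v _; case: eqP; rewrite ?sg0.
case: p pn => [|p] pn.
  rewrite big_ord_recl [X in _ + X]big1 => [|i _]; last first.
    rewrite big1 // => s _; case: ifP => // /shuf_lift_pos[]//.
  rewrite addr0; apply: etrans (Hp 0%N ord0 erefl) _.
  by rewrite [RHS]/= [X in X + _]conv_eq0 ?add0r.
rewrite big_ord_recl.
have -> : \sum_(i < n) \sum_(s : 'S_n) H p.+1 (lift ord0 i) s =
    conv parV (fun u v => sg (parV l && pw parV u)
      (if size u == p.+1 then F u (l :: v) else 0)) w.
  (* If the first block takes all letters, there is no position [p.+1]; the sum and its counterpart
     in [conv] both vanish. *)
  have [pn'|np] := ltnP p n.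
    rewrite (bigD1 (Ordinal pn')) //= Hp // big1 ?addr0 // => i ip.
    rewrite big1 // => s _; rewrite /H; case: ifP => // /shuf_lift_pos[]//= [E].
    by case/eqP: ip; apply: val_inj.
  rewrite big1 => [|i _].
    rewrite conv_eq0 // => u v /perm_size; rewrite size_cat sw => uv.
    case: eqP => [up|_]; rewrite ?sg0 //.
    by move: np; rewrite leqNgt -uv -up leq_addr.
  rewrite big1 // => s _; rewrite /H; case: ifP => // /shuf_lift_pos[]//= [E].
  by have := ltn_ord i; lia.
congr (_ + _).
under eq_bigr => s _.
  rewrite shuf_lift0 koszul_lift0r // pwE take0 drop0 pw_nil andbF /=.
  over.
rewrite -big_mkcond /=.
exact: (IHn p w (fun u v => F (l :: u) v)).
Qed.

Lemma conv_single_sum (Z : lmodType K) (G : letter V -> seq (letter V) -> Z) w :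
  conv parV (fun u v => if u is [:: l] then G l v else 0) w =
  \sum_(k < size w) sg (parV (nth l0 w k) && pw parV (take k w))
     (G (nth l0 w k) (del k w)).
Proof.
elim: w G => [|l w IHw] G; first by rewrite big_ord0.
rewrite [LHS]/= [size _]/= big_ord_recl; congr (_ + _).
  rewrite conv_nil => [|x u v]; last by [].
  by rewrite /= pw_nil andbF /del /= drop0.
pose G1 m v := sg (parV l && parV m) (G m (l :: v)).
transitivity (conv parV (fun u v => if u is [:: m] then G1 m v else 0) w).
  apply: eq_conv => -[|m [|? ?]] v _; rewrite ?sg0 //.
  by rewrite pw_cons pw_nil addbF.
rewrite IHw; apply: eq_bigr => k _; rewrite /G1 sg_sg.
rewrite -[nth _ (l :: w) _]/(nth l0 w k) -[take _ (l :: w)]/(l :: take k w).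
rewrite -[del _ (l :: w)]/(l :: del k w) pw_cons; congr (sg _ _).
by case: (parV l); case: parV; case: pw.
Qed.

(** A permutation is a choice of first letter followed by a permutation of the rest, and
    [koszul_lift0l] splits the sign accordingly. *)
Lemma perm_sum (A : algType K) (j : V -> A) n w : size w = n ->
  \sum_(s : 'S_n) koszul s (unzip1 w) *: lw j (permw s w) =
  iter n (fun F w => conv parV (fun u v => single j u * F v) w)
    (fun w => if w is [::] then 1 else 0) w.
Proof.
elim: n w => [|n IHn] w sw.
  rewrite (size0nil sw) (big_pred1 (perm_one 'I_0)) => [|s]; last first.
    by rewrite [RHS](introT eqP _) //; apply/permP => -[].
  by rewrite /koszul big_ord0 scale1r /permw enum_ord0 lw_nil.
rewrite (sum_liftr ord0) iterS.
set F := iter n _ _ in IHn *.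
transitivity (conv parV (fun u v => if u is [:: l] then j l.2 * F v else 0) w).
  rewrite conv_single_sum sw; apply: eq_bigr => k _.
  rewrite -IHn ?size_del ?sw // mulr_sumr sg_scale scaler_sumr.
  apply: eq_bigr => s _; rewrite koszul_lift0l // -sg_scale; congr (sg _ _).
  by rewrite permw_lift // take0 drop0 lw_cons scalerAr.
by apply: eq_conv => -[|l [|? ?]] v _; rewrite ?mul0r.
Qed.

Lemma lw_permw (gr : int -> submodClosed V) (A : algType K) (i : V -> A) n (s : 'S_n) w :
  galg true gr i -> homw gr w -> size w = n ->
  lw i w = koszul s (unzip1 w) *: lw i (permw s w).
Proof.
move=> gA; elim: n s w => [|n IHn] s w hw sw.
  by rewrite (size0nil sw) /koszul big_ord0 scale1r /permw enum_ord0.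
have [s' E] := lift_perm_ex ord0 s; rewrite E; set k := s ord0.
have kw : (k < size w)%N by rewrite sw.
have hk := allP hw _ (mem_nth l0 kw).
have hd : homw gr (del k w).
  by rewrite homw_cat; apply/andP; split; apply/allP => l lw; apply: (allP hw);
     [apply: mem_take lw|apply: mem_drop lw].
rewrite koszul_lift0l // permw_lift // take0 drop0 lw_cons scalerAr -IHn //; last first.
  by rewrite size_del // sw.
rewrite -{1}(cat_take_drop k w) (drop_nth l0 kw) !lw_cat lw_cons.
have ht : homw gr (take k w) by move: hd; rewrite homw_cat => /andP[].
rewrite !mulrA -sg_mull; congr (_ * _).
elim: (take k w) ht => [|l u IHu] /=; first by rewrite !lw_nil pw_nil andbF mulr1 mul1r.
move=> /andP[hl hu]; rewrite !lw_cons -mulrA IHu // sg_mulr mulrA.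
rewrite (galg_comm gA isT hl hk) sg_mull sg_sg mulrA pw_cons; congr (sg _ _).
by rewrite -/(par _); case: parV; case: parV; case: pw.
Qed.

End WordPermutations.

(** * Leibniz sums as sums over unshuffles *)

Lemma sum_triangle (Z : nmodType) N (A : nat -> nat -> Z) :
  \sum_(q < N) \sum_(p < N - q) A p q =
  \sum_(n < N) \sum_(p < n.+1) A p (n - p)%N.
Proof.
elim: N => [|N IHN]; first by rewrite !big_ord0.
rewrite [RHS]big_ord_recr /= -IHN.
transitivity (\sum_(q < N.+1) (\sum_(p < N - q) A p q + A (N - q)%N q)).
  apply: eq_bigr => q _; rewrite subSn; last by rewrite -ltnS.
  by rewrite big_ord_recr.
rewrite big_split /=; congr (_ + _).
  by rewrite big_ord_recr /= subnn big_ord0 addr0.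
rewrite (reindex_inj rev_ord_inj) /=; apply: eq_bigr => q _.
by rewrite subSS subKn // -ltnS.
Qed.

(** [M] is left open because the Leibniz identity and the formula for d write the upper bound
    differently; as natural numbers the two agree in the range of [k]. *)
Lemma sum_triangle1 (Z : nmodType) N (A : nat -> nat -> Z) M :
  (forall k, (0 < k <= N)%N -> M k = (N - k.-1)%N) ->
  \sum_(1 <= k < N.+1) \sum_(1 <= j < (M k).+1) A j.-1 k.-1 =
  \sum_(n < N) \sum_(p < n.+1) A p (n - p)%N.
Proof.
move=> ME; rewrite -sum_triangle big_add1 big_mkord; apply: eq_bigr => q _.
by rewrite big_add1 big_mkord ME //= ltn_ord.
Qed.

Section LeibnizSums.
Variables (K : fieldType) (V : lmodType K).
Implicit Types w u : seq (letter V).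
Local Notation parV := (@par K V).
Local Notation l0 := ((0, 0) : letter V).

Lemma permw_take n (s : 'S_n) w : permw s (take n w) = permw s w.
Proof.
by apply: eq_map => i; rewrite nth_take.
Qed.

Lemma koszul_take n (s : 'S_n) (e : seq int) :
  koszul s (take n e) = koszul s e :> K.
Proof.
by apply: eq_bigr => i _; apply: eq_bigr => j _; rewrite !nth_take.
Qed.

Lemma deg_unzip1 w : \sum_(d <- unzip1 w) d = deg w.
Proof. by rewrite big_map. Qed.

Lemma leib_shuffle_sum (Z : lmodType K) (G : seq V -> Z) (theta : seq V -> V) p q w :
  (p + q < size w)%N ->
  \sum_(s : 'S_(p + q) | shuffle s)
     leib_sign K s (unzip1 w) *: G (leib_word theta s (unzip2 w)) =
  conv parV (fun u v => if size u == p then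
      sg (pw parV u) (G (unzip2 u ++ theta (unzip2 (rcons v (nth l0 w (p + q))))
                          :: unzip2 (drop (p + q).+1 w))) else 0)
    (take (p + q) w).
Proof.
move=> pqw; have st : size (take (p + q) w) = (p + q)%N by rewrite size_takel // ltnW.
rewrite -(shuffle_sum (p := p) (fun u v => sg (pw parV u) (G (unzip2 u ++
  theta (unzip2 (rcons v (nth l0 w (p + q)))) :: unzip2 (drop (p + q).+1 w))))
  (leq_addr q p) st).
apply: eq_bigr => s _; rewrite /leib_sign permute_unzip1 /unzip1 -map_take.
rewrite -/(unzip1 _) deg_unzip1 mulrC -scalerA exprz_sg oddz_deg.
rewrite map_take koszul_take permw_take; congr (_ *: sg _ (G _)).
rewrite /leib_word permute_unzip2 /unzip2 -map_take -map_drop -map_drop map_rcons.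
by congr (_ ++ theta (rcons _ _) :: _); rewrite (nth_map l0).
Qed.

(** [n = p + q] is the position of the last argument of the inner bracket; summing over [p] at fixed
    [n] removes the condition on [size u]. With the word map for [G] this is the formula for d, with
    [theta] it is the Leibniz identity, which thus becomes the vanishing of the corestriction on the
    image of d. *)
Lemma leib_sum (Z : lmodType K) (G : seq V -> Z) (theta : seq V -> V) w M :
  (forall k, (0 < k <= size w)%N -> M k = (size w - k.-1)%N) ->
  \sum_(1 <= k < (size w).+1) \sum_(1 <= j < (M k).+1)
    \sum_(s : 'S_(j.-1 + k.-1) | shuffle s)
     leib_sign K s (unzip1 w) *: G (leib_word theta s (unzip2 w)) =
  \sum_(n < size w) conv parV (fun u v =>
      sg (pw parV u) (G (unzip2 u ++ theta (unzip2 (rcons v (nth l0 w n)))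
                          :: unzip2 (drop n.+1 w)))) (take n w).
Proof.
move=> ME.
rewrite (sum_triangle1 (fun p q => \sum_(s : 'S_(p + q) | shuffle s)
     leib_sign K s (unzip1 w) *: G (leib_word theta s (unzip2 w))) ME).
apply: eq_bigr => n _.
transitivity (\sum_(p < n.+1) conv parV (fun u v => if size u == p then
      sg (pw parV u) (G (unzip2 u ++ theta (unzip2 (rcons v (nth l0 w n)))
                          :: unzip2 (drop n.+1 w))) else 0)
    (take n w)).
  apply: eq_bigr => p _; have pn : (p + (n - p))%N = n by rewrite subnKC // -ltnS.
  by rewrite leib_shuffle_sum pn.
transitivity (conv parV (fun u v => \sum_(p < n.+1) if size u == p then
      sg (pw parV u) (G (unzip2 u ++ theta (unzip2 (rcons v (nth l0 w n)))
                          :: unzip2 (drop n.+1 w))) else 0) (take n w)).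
  by rewrite -conv_sum.
apply: eq_conv => u v /perm_size; rewrite size_cat size_takel; last exact: ltnW.
move=> uvn; have un : (size u < n.+1)%N by rewrite ltnS -uvn leq_addr.
rewrite (bigD1 (Ordinal un)) //= eqxx big1 ?addr0 // => p.
by rewrite -val_eqE /= eq_sym => /negPf->.
Qed.

End LeibnizSums.

(** * The tensor, symmetric and free Lie algebras *)

Section TensorInstance.
Variables (K : fieldType) (V : lmodType K) (gr : int -> submodClosed V).
Hypothesis grV : is_graded gr.

Lemma tens_galg : galg false gr (@tens_in K V).
Proof.
split=> //; first exact: tens_in_linear.
  exact: gen_hom grV (@tens_in_linear K V) (@tens_span K V).
move=> Z F mF _; have [h hm hF] := mlin_ext grV mF.
by exists (tlift hm) => w hw; rewrite [LHS]tlift_word hF.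
Qed.

End TensorInstance.

Section CommutatorIdeal.
Variables (K : fieldType) (V : lmodType K) (gr : int -> submodClosed V).
Variables (T : algType K) (i : V -> T) (gT : galg false gr i).

Lemma msym_ideal0 (Z : lmodType K) (F : seq (letter V) -> Z) (f : {linear T -> Z}) :
  msym gr F -> (forall w, homw gr w -> f (lw i w) = F w) ->
  forall p q a b x y, a \in gr p -> b \in gr q ->
    f (x * gcomm p q (i a) (i b) * y) = 0.
Proof.
move=> sF fF p q a b x y ha hb.
apply: lin_mul_span0 (galg_gen gT) _ x y => _ _ [u [hu ->]] [v [hv ->]].
have h2 l m : l.2 \in gr l.1 -> m.2 \in gr m.1 ->
    f (lw i u * (i l.2 * i m.2) * lw i v) = F (u ++ l :: m :: v).
  move=> hl hm; rewrite -fF; last by rewrite homw_cat /= hu hl hm.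
  by rewrite lw_cat !lw_cons !mulrA.
rewrite /gcomm exprzM_sg mulrBr mulrBl linearB sg_mulr sg_mull lin_sg.
rewrite (h2 (p, a) (q, b)) // (h2 (q, b) (p, a)) // sF //.
by rewrite subrr.
Qed.

End CommutatorIdeal.

Lemma gcomm_morph (K : fieldType) (A B : algType K) (f : {linear A -> B}) :
  {morph f : x y / x * y} ->
  forall p q a b, f (gcomm p q a b) = gcomm p q (f a) (f b).
Proof. by move=> fM p q a b; rewrite linearB linearZZ !fM. Qed.

Section QuotientGenerators.
Variables (K : fieldType) (L : lmodType K) (A : augAlgType K) (i : L -> A).
Hypothesis i_lin : linear i.
Hypothesis A_gen : forall x, x \in span [set y | exists s, y = word i s].
Variable R : relators A.
Local Notation qin := (fun a => qpi R (i a)).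

Lemma qpi_word s : word qin s = qpi R (word i s).
Proof. by rewrite [RHS](@word_rmorph _ _ _ _ _ (qpi R) (rmorph1 _) (rmorphM _)). Qed.

Lemma qpi_in_linear : linear qin.
Proof. by move=> a x y; rewrite i_lin; apply: (linearP (qpi R)). Qed.

Lemma qpi_span (x : quoalg R) : x \in span [set y | exists s, y = word qin s].
Proof.
rewrite -(qreprK x); move: (qrepr x) (A_gen (qrepr x)) => {x}.
apply: (span_lin (f := qpi R)) => _ [s ->].
by apply: mem_span; exists s; rewrite qpi_word.
Qed.

Lemma qpi_rel0 r : relset R r -> qpi R r = 0.
Proof.
move=> Rr; rewrite -(linear0 (qpi R)); apply/qpiP.
by rewrite subr0; apply: mem_span; exists 1, 1, r; rewrite mul1r mulr1.
Qed.

Lemma qpi_gcomm p q a b :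
  qpi R (gcomm p q (i a) (i b)) = gcomm p q (qin a) (qin b).
Proof. exact: (gcomm_morph (f := qpi R) (rmorphM _)). Qed.

End QuotientGenerators.

Section SymmetricInstance.
Variables (K : fieldType) (L : lmodType K) (gr : int -> submodClosed L).
Hypothesis grL : is_graded gr.
Local Notation S := (symalg gr).

Lemma sym_in_comm p q a b : a \in gr p -> b \in gr q ->
  gcomm p q (sym_in gr a) (sym_in gr b) = 0.
Proof.
move=> ha hb; rewrite -[LHS](qpi_gcomm tens_in (Relators (@aug_sym_rel K L gr))).
by apply: qpi_rel0; exists p, q, a, b.
Qed.

Lemma gcomm0_sg (A : algType K) p q (a b : A) :
  gcomm p q a b = 0 -> a * b = sg (oddz p && oddz q) (b * a).
Proof. by rewrite /gcomm exprzM_sg => /eqP; rewrite subr_eq0 => /eqP. Qed.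

Lemma sym_galg : galg true gr (sym_in gr).
Proof.
split=> //; first exact/qpi_in_linear/tens_in_linear.
- exact: gen_hom grL (qpi_in_linear (@tens_in_linear K L) _)
    (qpi_span (@tens_span K L) (R := _)).
- move=> _ l m hl hm; apply: gcomm0_sg; exact: sym_in_comm.
move=> Z F mF /(_ isT) sF; have gT := tens_galg grL.
have [f fF] := galg_univ gT mF (fun b => match notF b with end).
have f0 a b r : sym_rel gr r -> f (a * r * b) = 0.
  by case=> p [q [x [y [hx hy ->]]]]; apply: (msym_ideal0 gT sF fF).
exists (@qlift K _ (Relators (@aug_sym_rel K L gr)) Z f f0) => w hw.
rewrite -fF // /lw [word _ _](@qpi_word _ _ _ tens_in (Relators (@aug_sym_rel K L gr))).
exact: (@qlift_pi K _ (Relators (@aug_sym_rel K L gr))).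
Qed.

End SymmetricInstance.

Section LieSubalgebra.
Variables (K : fieldType) (K0 : [pchar K] =i pred0).
Variables (V : lmodType K) (gr : int -> submodClosed V).
Variables (T : augAlgType K) (i : V -> T) (gT : galg false gr i).
Hypothesis aug_i : forall v, aug (i v) = 0.
Local Notation grT := (word_gr gr i).
Variable LP : submodClosed T.
Hypothesis LP_gen : forall v, i v \in LP.
Hypothesis LP_br : forall p q a b, a \in grT p -> b \in grT q ->
  a \in LP -> b \in LP -> gcomm p q a b \in LP.
Hypothesis LP_ind : forall S : submodClosed T, (forall v, i v \in S) ->
  (forall p q a b, a \in grT p -> b \in grT q ->
     a \in S -> b \in S -> gcomm p q a b \in S) ->
  forall y, y \in LP -> y \in S.
Local Notation L := (subsp LP).
Local Notation grL := (sub_gr grT LP).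

Lemma gcomm_gr p q a b : a \in grT p -> b \in grT q ->
  gcomm p q a b \in grT (p + q).
Proof.
move=> ap bq; rewrite /gcomm; apply: rpredB; first exact: word_grM.
by rewrite addrC; apply/rpredZ/word_grM.
Qed.

(** Phrased through components because the induction principle of Lie(V) asks for a subspace, and
    Lie(V) is not yet known to be graded. It gives both the grading and the primitivity of
    homogeneous elements. *)
Definition hom_prim (y : T) : bool :=
  `[< forall p, proj gT p y \in LP /\ coder gT (oddz p) (lmul (proj gT p y)) >].

Lemma hom_prim_closed : GRing.submod_closed hom_prim.
Proof.
split=> [|a x y].
  apply/asboolP => p; rewrite linear0; split; [exact: rpred0|exact: coder_lmul0].
move=> /asboolP Hx /asboolP Hy; apply/asboolP => p.
have [xL cx] := Hx p; have [yL cy] := Hy p; rewrite linearP.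
by split; [rewrite rpredD ?rpredZ|apply: coder_lmul_lin].
Qed.

Lemma hom_primP p y : y \in grT p ->
  y \in LP -> coder gT (oddz p) (lmul y) -> hom_prim y.
Proof.
move=> yp yL cy; apply/asboolP => q; rewrite (proj_gr gT q yp).
by case: eqP => [<-|_]; split=> //; [exact: rpred0|exact: coder_lmul0].
Qed.

Lemma lie_hom_prim y : y \in LP -> hom_prim y.
Proof.
apply: (LP_ind (S := submod_of hom_prim_closed)) => [v|p q a b ap bq].
  have [t [f [fg ->]]] := graded_dec (galg_graded gT) v.
  have -> : i (\sum_(p <- t) f p) = \sum_(p <- t) i (f p).
    by rewrite -[i _]/(mklin (galg_linear gT) _) linear_sum.
  apply: rpred_sum => p _; apply: (hom_primP (p := p)).
  - exact: (letter_gr i (l := (p, f p)) (fg p)).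
  - exact: LP_gen.
  - exact: (coder_letter gT (l := (p, f p)) (fg p)).
move=> /asboolP/(_ p)[]; rewrite (proj_gr gT p ap) eqxx => aL ca.
move=> /asboolP/(_ q)[]; rewrite (proj_gr gT q bq) eqxx => bL cb.
apply: (hom_primP (gcomm_gr ap bq)); first exact: LP_br.
exact: coder_bracket.
Qed.

Fact lie_val_linear : linear (val : L -> T).
Proof. by move=> a x y; rewrite linearP. Qed.

Definition lie_val : {linear L -> T} := mklin lie_val_linear.

Lemma lie_val_inj : injective lie_val.
Proof. exact: val_inj. Qed.

Lemma lie_prim (l : letter (L)) :
  l.2 \in grL l.1 -> prim gT lie_val l.
Proof.
case: l => p [y yL] /= yp; split=> //=.
have /asboolP/(_ p)[_] := lie_hom_prim yL.
by rewrite (proj_gr gT p yp) eqxx.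
Qed.

Lemma lie_br p q a b : a \in grL p -> b \in grL q ->
  exists2 c, c \in grL (p + q) &
    lie_val c = gcomm p q (lie_val a) (lie_val b).
Proof.
move=> ap bq.
exists (exist (fun x => x \in LP) _ (LP_br ap bq (valP a) (valP b)) : L) => //.
exact: gcomm_gr.
Qed.

Lemma lie_gen p v : v \in gr p ->
  exists2 a, a \in grL p & lie_val a = i v.
Proof.
move=> vp; exists (exist (fun x => x \in LP) (i v) (LP_gen v) : L) => //.
exact: (letter_gr i (l := (p, v)) vp).
Qed.

Lemma lie_graded : is_graded (grL).
Proof.
have gTg := galg_is_graded gT K0; split.
  move=> [y yL]; have /asboolP hy := lie_hom_prim yL.
  have [t [f [ut fg f0 yE]]] := (decomposesP (grT)).2 (galg_dec gT) y.
  have fE p : proj gT p y = f p.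
    rewrite yE linear_sum; have [pt|pt] := boolP (p \in t).
      rewrite (bigD1_seq p) //= (proj_gr gT p (fg p)) eqxx big1 ?addr0 // => q qp.
      by rewrite (proj_gr gT p (fg q)) (negPf qp).
    rewrite (f0 p pt) big_seq big1 // => q qt; rewrite (proj_gr gT p (fg q)).
    by case: eqP => // qp; rewrite qp (negPf pt) in qt.
  have fL p : f p \in LP by rewrite -fE; have [] := hy p.
  exists t, (fun p => exist (fun x => x \in LP) (f p) (fL p) : L); split=> [p|].
    exact: fg.
  apply: lie_val_inj; rewrite linear_sum /=.
  by rewrite yE.
move=> s f us fg f0 p ps; apply: lie_val_inj; rewrite linear0.
apply: (graded_free gTg us (f := fun p => lie_val (f p))) ps => //.
by rewrite -linear_sum f0 linear0.
Qed.

Lemma aug_lie_val (a : L) : aug (lie_val a) = 0.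
Proof.
have aug0_closed : GRing.submod_closed (fun y : T => aug y == 0).
  split=> [|c x y]; first by rewrite -[_ \in _]/(aug (0 : T) == 0) raddf0.
  move=> /eqP x0 /eqP y0; apply/eqP.
  by rewrite [LHS](linearP (aug : {scalar T})) /= x0 y0 mulr0 addr0.
apply/eqP; case: a => y yL /=.
apply: (LP_ind (S := submod_of aug0_closed)) yL => [v|p q a b _ _ /eqP a0 /eqP b0].
  by rewrite -[_ \in _]/(aug _ == 0) aug_i.
rewrite -[_ \in _]/(aug _ == 0) /gcomm raddfB /= linearZ /= !rmorphM /= a0 b0.
by rewrite !mulr0 subrr.
Qed.

End LieSubalgebra.

Section AugmentationUnit.
Variables (K : fieldType) (A B : augAlgType K).

Fact aug_unit_linear : linear (fun x : A => aug x *: (1 : B)).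
Proof. by move=> a x y; rewrite linearP /= scalerDl scalerA. Qed.

(** The counit followed by the unit, neutral for convolution. As a linear map between algebras it
    lets statements on [aug] be proved by comparing linear maps on generators. *)
Definition aug_unit : {linear A -> B} := mklin aug_unit_linear.

End AugmentationUnit.
Arguments aug_unit {K} A B.

Section ReducedPart.
Variables (K : fieldType) (W : lmodType K) (A : augAlgType K) (i : W -> A).
Hypothesis aug_i : forall v, aug (i v) = 0.
Hypothesis A_gen : forall x, x \in span [set y | exists s, y = word i s].
Local Notation R := (subsp (reduced i)).

Lemma aug_word_cons v s : aug (word i (v :: s)) = 0.
Proof. by rewrite word_cons rmorphM /= aug_i mul0r. Qed.

Lemma aug_word s : aug (word i s) = (s == [::])%:R.
Proof.
case: s => [|v s]; last by rewrite aug_word_cons.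
by rewrite word_nil rmorph1.
Qed.

(** Subtracting [aug x] from [x] removes the empty word. Membership becomes a linear equation, by
    which the defaults of [rword] and [restrict] can be ruled out. *)
Lemma reducedP x : x \in reduced i <-> aug x = 0.
Proof.
split.
  move: x; apply: span_ind => [|a x y x0 y0|_ [s s0 ->]]; first exact: raddf0.
    by rewrite linearP /= x0 y0 mulr0 addr0.
  by rewrite aug_word (negPf s0).
suff H : x - aug x *: 1 \in reduced i by move=> x0; rewrite x0 scale0r subr0 in H.
move: x (A_gen x); apply: (span_lin (f := idl A \- aug_unit A A)) => _ [s ->].
rewrite -[X in X \in _]/(word i s - aug (word i s) *: 1) aug_word.
case: s => [|v s]; first by rewrite word_nil scale1r subrr rpred0.
by rewrite scale0r subr0; apply: mem_span; exists (v :: s).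
Qed.

Lemma rword_val s : s != [::] -> val (rword i s) = word i s.
Proof.
by move=> s0; rewrite val_insubd (iffRL (reducedP _)) // aug_word (negPf s0).
Qed.

Fact redp_subproof x : x - aug x *: 1 \in reduced i.
Proof.
by apply/reducedP; rewrite raddfB /= linearZ /= rmorph1 mulr1 subrr.
Qed.

Definition redp_fun x : R := exist (fun y => y \in reduced i) _ (redp_subproof x).

Fact redp_linear : linear redp_fun.
Proof.
move=> a x y; apply: val_inj; rewrite linearP /= linearP /=.
rewrite scalerBr scalerDl -scalerA opprD.
by rewrite [LHS](AC (2*2) (1*3*(2*4)))%AC.
Qed.

Definition redp : {linear A -> R} := mklin redp_linear.

Lemma redpE x : val (redp x) = x - aug x *: 1.
Proof. by []. Qed.

Lemma redp_aug0 x : aug x = 0 -> val (redp x) = x.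
Proof. by move=> x0; rewrite /= x0 scale0r subr0. Qed.

Lemma aug_val (x : R) : aug (val x) = 0.
Proof. exact/reducedP/valP. Qed.

Lemma redp_val (x : R) : redp (val x) = x.
Proof. by apply/val_inj/redp_aug0/aug_val. Qed.

Lemma redp1 : redp 1 = 0.
Proof.
apply: val_inj; rewrite /= rmorph1 scale1r subrr.
exact/esym/(raddf0 (val : {additive R -> A})).
Qed.

Lemma redp_word s : s != [::] -> redp (word i s) = rword i s.
Proof.
move=> s0; apply: val_inj; rewrite rword_val // redp_aug0 //.
by rewrite aug_word (negPf s0).
Qed.

Lemma eq_lin_reduced (gr : int -> submodClosed W) (c : bool) (gA : galg c gr i)
    (Z : lmodType K) (f g : {linear R -> Z}) :
  (forall e x, homog gr e x -> x != [::] -> f (rword i x) = g (rword i x)) ->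
  f =1 g.
Proof.
move=> fg x; rewrite -(redp_val x); move: (val x) => {}x.
apply: (eq_galg gA (f := compl f redp) (g := compl g redp)) => w hw.
rewrite -[LHS]/(f (redp _)) -[RHS]/(g (redp _)) /lw.
case: (eqVneq (unzip2 w) [::]) => [->|w0].
  by rewrite word_nil redp1 !linear0.
by rewrite redp_word // (fg (unzip1 w)) // homogE.
Qed.

End ReducedPart.

(** * The Leibniz differential and its transport *)

Section LeibnizDifferential.
Variables (K : fieldType) (K0 : [pchar K] =i pred0).
Variables (V : lmodType K) (gr : int -> submodClosed V) (theta : seq V -> V).
Hypothesis Ltheta : Leibniz_infty gr theta.
Variables (T : algType K) (i : V -> T) (gT : galg false gr i).
Local Notation homV := (homw gr).
Local Notation wd := (lw i).
Local Notation parV := (@par K V).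
Local Notation l0 := ((0, 0) : letter V).

Fact brackets_mlin :
  mlin gr (fun w => if unzip2 w is [::] then 0 else theta (unzip2 w)).
Proof.
move=> u v p a x y _ _ _ _; have := leib_multilinear Ltheta (unzip2 u) (unzip2 v) a x y.
rewrite /unzip2 !map_cat /= => E.
by case: (map snd u) E => [|? ?].
Qed.

Fact brackets_msym :
  false -> msym gr (fun w => if unzip2 w is [::] then 0 else theta (unzip2 w)).
Proof. by []. Qed.

(** [theta [::]] is unconstrained; the value 0 on the empty word keeps the corestriction of degree
    1. *)
Definition brackets : {linear T -> V} := glift gT brackets_mlin brackets_msym.

Lemma brackets_lw w : homV w -> w != [::] -> brackets (wd w) = theta (unzip2 w).
Proof. by move=> hw w0; rewrite [LHS]gliftE //; case: w w0 {hw}. Qed.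

Lemma brackets_deg : corestr_deg gr i 1 brackets.
Proof.
move=> q x; apply: (word_gr_ind (f := brackets)) => w hw <-.
have [->|w0] := eqVneq w [::].
  by rewrite [brackets _]gliftE // rpred0.
rewrite brackets_lw // addrC -deg_unzip1; apply: (leib_degree Ltheta).
  by rewrite homogE.
by case: w w0 {hw}.
Qed.

Definition leibd : {linear T -> T} := zcoder gT 1 brackets.

Lemma leibd_lw w : homV w -> leibd (wd w) =
  \sum_(n < size w) conv parV (fun u v =>
      sg (pw parV u) (word i (unzip2 u ++ theta (unzip2 (rcons v (nth l0 w n)))
                          :: unzip2 (drop n.+1 w)))) (take n w).
Proof.
move=> hw; rewrite [LHS]zcoder_lw_conv //; apply: eq_bigr => n _.
apply: eq_conv => u v uv; have hn : homV (rcons v (nth l0 w n)).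
  have ht : homV (take n w) by apply/allP => l /mem_take /(allP hw).
  have [_ hv] := homw_perm uv ht; rewrite /homw all_rcons; apply/andP; split=> //.
  exact/(allP hw)/mem_nth.
rewrite brackets_lw //; last by case: (v).
by rewrite word_cat word_cons mulrA.
Qed.

Let idx1 (m k : nat) : (0 < k <= m)%N -> (m + 1 - k)%N = (m - k.-1)%N.
Proof. lia. Qed.

Let idx2 (m k : nat) : (0 < k <= m)%N -> (m - k + 1)%N = (m - k.-1)%N.
Proof. lia. Qed.

Lemma leibd_word e x : homog gr e x -> x != [::] -> leibd (word i x) =
    \sum_(1 <= k < (size x).+1) \sum_(1 <= j < (size x + 1 - k).+1)
      \sum_(s : 'S_(j.-1 + k.-1) | shuffle s)
        leib_sign K s e *: word i (leib_word theta s x).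
Proof.
move=> /homog_zip[]; set w := zip e x => hw <- <- _ _.
rewrite [LHS](leibd_lw hw) /unzip1 !size_map.
rewrite -(leib_sum (word i) theta (M := fun k => (size w + 1 - k)%N)) //.
exact: idx1.
Qed.

Lemma brackets_leibd w : homV w -> brackets (leibd (wd w)) = 0.
Proof.
move=> hw; have [->|w0] := eqVneq w [::].
  by rewrite lw_nil [leibd 1]zcoder1 linear0.
have x0 : unzip2 w != [::] by case: w w0 {hw}.
have hw' : homog gr (unzip1 w) (unzip2 w) by rewrite homogE.
rewrite -[RHS](leib_identity Ltheta hw' x0) [leibd _](leibd_lw hw) linear_sum.
rewrite size_map (leib_sum theta theta (M := fun k => (size w - k + 1)%N)); last first.
  exact: idx2.
apply: eq_bigr => n _; rewrite conv_lin; apply: eq_conv => u v uv.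
have ht : homV (take n w) by apply/allP => l /mem_take /(allP hw).
have [hu hv] := homw_perm uv ht.
have hn : homV (rcons v (nth l0 w n)).
  by rewrite /homw all_rcons; apply/andP; split=> //; apply/(allP hw)/mem_nth.
rewrite lin_sg; congr (sg _ _).
pose x := (deg (rcons v (nth l0 w n)) + 1, theta (unzip2 (rcons v (nth l0 w n)))).
have := @brackets_lw (u ++ x :: drop n.+1 w).
rewrite /lw /unzip2 map_cat /= -/(unzip2 _) => -> //; last by case: (u).
rewrite homw_cat hu /=; apply/andP; split.
  rewrite -deg_unzip1; apply: (leib_degree Ltheta); first by rewrite homogE.
  by case: (v).
by apply/allP => l /mem_drop /(allP hw).
Qed.

Lemma leibd_deg : deg_map gr i 1 leibd.
Proof. exact/zcoder_deg/brackets_deg. Qed.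

Lemma leibd_coder : coder gT true leibd.
Proof. exact: (zcoder_coder gT brackets_deg). Qed.

Lemma leibd_square x : leibd (leibd x) = 0.
Proof. exact: (@zcoder_square _ _ _ _ _ gT brackets K0 brackets_deg brackets_leibd x). Qed.

End LeibnizDifferential.

(** * The reduced symmetric coalgebra and its brackets *)

Section SymmetricCodifferential.
Variables (K : fieldType) (K0 : [pchar K] =i pred0).
Variables (L : lmodType K) (grL : int -> submodClosed L).
Variables (S : augAlgType K) (s : L -> S) (gS : galg true grL s).
Hypothesis aug_s : forall a, aug (s a) = 0.
Hypothesis S_gen : forall x, x \in span [set y | exists z, y = word s z].
Local Notation homL := (homw grL).
Local Notation lws := (lw s).
Local Notation parL := (@par K L).
Local Notation grS := (word_gr grL s).
Local Notation RS := (subsp (reduced s)).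
Local Notation red := (redp aug_s S_gen).

Lemma shuffle_sums (Z : lmodType K) m1 m2 w
    (F : seq (letter L) -> seq (letter L) -> Z) :
  (m2 <= (size w).+1)%N ->
  \sum_(m1 <= k < m2) \sum_(t : 'S_(k + (size w - k)) | shuffle t)
     koszul t (unzip1 w) *: F (take k (permw t w)) (drop k (permw t w)) =
  conv parL (fun u v => if (m1 <= size u < m2)%N then F u v else 0) w.
Proof.
move=> m2w.
transitivity (\sum_(m1 <= k < m2)
   conv parL (fun u v => if size u == k then F u v else 0) w).
  apply: eq_big_nat => k /andP[_ km]; have kw : (k <= size w)%N.
    by rewrite -ltnS; apply: leq_trans km m2w.
  by rewrite -(shuffle_sum (n := k + (size w - k)) (p := k)) ?leq_addr ?subnKC.
rewrite -conv_sum; apply: eq_conv => u v _; rewrite -big_mkcond /=.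
under eq_bigl => k do rewrite eq_sym.
by rewrite big_nat1_eq.
Qed.

Definition rcoprod_formula (f : RS -> tprod RS RS) : Prop :=
  forall e x, homog grL e x -> x != [::] ->
    f (rword s x) =
    \sum_(1 <= i < size x) \sum_(t : 'S_(i + (size x - i)) | shuffle t)
      koszul t e *: tpure (rword s (take i (permute t x)))
                          (rword s (drop i (permute t x))).

Fact red2_l a v v' w : tpure (red (a *: v + v')) (red w) =
  a *: tpure (red v) (red w) + tpure (red v') (red w).
Proof. by rewrite linearP tpurePl. Qed.
Fact red2_r a v w w' : tpure (red v) (red (a *: w + w')) =
  a *: tpure (red v) (red w) + tpure (red v) (red w').
Proof. by rewrite linearP tpurePr. Qed.

Definition red2 : {linear tens S S -> tprod RS RS} := tens_lift red2_l red2_r.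

Lemma red2E x y : red2 (tp x y) = tpure (red x) (red y).
Proof. exact: tens_liftE. Qed.

(** Projecting both factors to the positive part discards the terms with an empty word, which is the
    passage to the reduced coproduct. *)
Definition rcoprod (x : RS) : tprod RS RS := red2 (coprod gS (val x)).

Lemma rcoprod_linear : linear rcoprod.
Proof. by move=> a x y; rewrite /rcoprod !linearP. Qed.

Lemma rcoprodP : rcoprod_formula rcoprod.
Proof.
move=> e x /homog_zip[]; set w := zip e x => hw <- <- _ x0.
rewrite /rcoprod (rword_val aug_s S_gen x0) -/(lw s w) coprod_lw // conv_lin.
rewrite size_map; under eq_bigr => k _ do under eq_bigr => t _ do
  rewrite permute_unzip2 -[take _ (unzip2 _)]map_take -[drop _ (unzip2 _)]map_drop.
rewrite (shuffle_sums _ (fun u v => tpure (rword s (unzip2 u)) (rword s (unzip2 v)))) //.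
apply: eq_conv => u v /perm_size uvw; rewrite red2E.
case: (eqVneq u [::]) uvw => [->|u0] uvw.
  by rewrite lw_nil redp1 -[LHS]/(tpurel _ _ _) linear0.
case: (eqVneq v [::]) uvw => [->|v0] uvw.
  rewrite lw_nil redp1 -[LHS]/(tpurer _ _ _) linear0 -uvw cats0 ltnn andbF.
  by [].
rewrite /lw !redp_word; [|by case: (v) v0|by case: (u) u0].
rewrite -uvw size_cat; case: (u) u0 => // l u' _; case: (v) v0 => // m v' _ /=.
by rewrite addnS ltnS leq_addr.
Qed.

Variable D : {linear S -> S}.
Hypothesis D_deg : deg_map grL s 1 D.
Hypothesis D_coder : coder gS true D.
Hypothesis D_square : forall x, D (D x) = 0.
Hypothesis D_aug : forall x, aug (D x) = 0.
Hypothesis D1 : D 1 = 0.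

Lemma unit_partE x : unit_part gS x = aug x *: 1.
Proof.
apply: (eq_galg gS (g := aug_unit S S)) => w hw; rewrite unit_part_lw //.
rewrite -[RHS]/(aug (word s (unzip2 w)) *: 1) aug_word //.
by case: w hw => [|l w] _; rewrite ?scale1r ?scale0r.
Qed.

Lemma D_pos x : unit_part gS (D x) = 0.
Proof. by rewrite unit_partE D_aug scale0r. Qed.

Definition linf_bracket (x : seq L) : L := corestr gS (D (word s x)).

Lemma linf_coder e x : homog grL e x ->
  D (word s x) =
    \sum_(1 <= i < (size x).+1) \sum_(t : 'S_(i + (size x - i)) | shuffle t)
      koszul t e *:
        word s (linf_bracket (take i (permute t x)) :: drop i (permute t x)).
Proof.
move=> /homog_zip[]; set w := zip e x => hw <- <- _.
rewrite [LHS](coder_corestr K0 D_deg D_coder D_pos hw).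
rewrite size_map; under eq_bigr => k _ do under eq_bigr => t _ do
  rewrite permute_unzip2 -[take _ (unzip2 _)]map_take -[drop _ (unzip2 _)]map_drop.
rewrite (shuffle_sums _ (fun u v => word s (linf_bracket (unzip2 u) :: unzip2 v))) //.
apply: eq_conv => u v /perm_size uvw; rewrite word_cons.
(* [D 1 = 0] kills the splitting with [u] empty, so the brackets start at arity 1. *)
case: (eqVneq u [::]) uvw => [->|u0] uvw.
  rewrite lw_nil D1 linear0 -[s 0]/(mklin (galg_linear gS) 0) linear0.
  by rewrite mul0r.
rewrite -uvw size_cat ltnS leq_addr andbT.
by case: (u) u0.
Qed.

(** Multilinearity and graded symmetry come for free, the brackets being linear functions of the
    product of their arguments in S. *)
Lemma linf_Linfty : Linfty grL linf_bracket.
Proof.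
split.
- exact: galg_graded gS.
- move=> s1 s2 a x y; rewrite /linf_bracket (word_multilinear (galg_linear gS)).
  by rewrite !linearP.
- move=> e x /homog_zip[]; set w := zip e x => hw <- <- _ _.
  rewrite deg_unzip1 addrC; apply: corestr_gr; apply: D_deg.
  exact: lw_word_gr.
- move=> e x t /homog_zip[]; set w := zip e x => hw <- E2 sw _.
  have : word s (unzip2 w) = koszul t (unzip1 w) *: word s (permute t (unzip2 w)).
    by rewrite permute_unzip2; apply: (lw_permw t gS hw sw).
  by rewrite E2 /linf_bracket => ->; rewrite !linearZZ.
move=> e x hx x0; have := D_square (word s x); rewrite (linf_coder hx) => E.
rewrite -[RHS](linear0 (corestr gS)) -{}E !linear_sum; apply: eq_bigr => k _.
rewrite !linear_sum; apply: eq_bigr => t _.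
by rewrite !linearZZ.
Qed.

Variable Db : RS -> RS.
Hypothesis DbE : forall x, val (Db x) = D (val x).

Lemma rcoder_of e x : homog grL e x -> x != [::] ->
    Db (rword s x) =
    \sum_(1 <= i < (size x).+1) \sum_(t : 'S_(i + (size x - i)) | shuffle t)
      koszul t e *:
        rword s (linf_bracket (take i (permute t x)) :: drop i (permute t x)).
Proof.
move=> hx x0; apply: val_inj; rewrite DbE rword_val // (linf_coder hx).
rewrite -[RHS]/(lie_val (reduced s) _) linear_sum; apply: eq_bigr => k _.
rewrite linear_sum; apply: eq_bigr => t _.
by rewrite linearZZ -[lie_val _ _]/(val _) rword_val.
Qed.

Lemma Db_linear : linear Db.
Proof.
move=> a x y; apply: val_inj; rewrite DbE -[RHS]/(lie_val (reduced s) _).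
rewrite -[val (_ + _)]/(lie_val (reduced s) _) !linearP.
by rewrite -![lie_val _ (Db _)]/(val (Db _)) !DbE.
Qed.

Lemma Db_red x : Db (red x) = red (D x).
Proof.
apply: val_inj; rewrite DbE (redp_aug0 _ _ (D_aug x)) redpE linearB linearZZ D1.
by rewrite scaler0 subr0.
Qed.

Let taub : {linear RS -> RS} := compl red (compl (tau gS true) (lie_val (reduced s))).

Let taub_red x : taub (red x) = red (tau gS true x).
Proof.
rewrite -[taub _]/(red (tau gS true (val (red x)))) redpE [tau _ _ _]linearB linearZZ.
have -> : tau gS true 1 = 1.
  by have := tau_lw gS true (w := [::]) isT; rewrite lw_nil pw_nil.
by rewrite linearB linearZZ redp1 scaler0 subr0.
Qed.

Fact Dmap_l a x x' y :
  tpure (Db (a *: x + x')) y + tpure (taub (a *: x + x')) (Db y) =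
  a *: (tpure (Db x) y + tpure (taub x) (Db y))
    + (tpure (Db x') y + tpure (taub x') (Db y)).
Proof. by rewrite Db_linear linearP !tpurePl scalerDr addrACA. Qed.

Fact Dmap_r a x y y' :
  tpure (Db x) (a *: y + y') + tpure (taub x) (Db (a *: y + y')) =
  a *: (tpure (Db x) y + tpure (taub x) (Db y))
    + (tpure (Db x) y' + tpure (taub x) (Db y')).
Proof. by rewrite Db_linear !tpurePr scalerDr addrACA. Qed.

Let Dmap : {linear tprod RS RS -> tprod RS RS} := tprod_lift Dmap_l Dmap_r.

(** Stated through the linear map [Dmap] on the tensor square, so that it can be evaluated on any
    presentation of the coproduct in Sweedler notation. *)
Lemma rcoprod_coder x : rcoprod (Db x) = Dmap (rcoprod x).
Proof.
rewrite /rcoprod DbE D_coder; move: (coprod gS (val x)).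
apply: eq_tens_comp => y z; rewrite dmapE.
rewrite linearD !red2E tprod_liftE !Db_red.
by rewrite taub_red.
Qed.

Lemma rsym_codifferential : codifferential (sub_gr grS (reduced s)) rcoprod Db.
Proof.
split.
- exact: Db_linear.
- move=> p x xp; rewrite -[_ \in _]/(val (Db x) \in grS (p + 1)) DbE addrC.
  exact: D_deg.
- by move=> x; apply: val_inj; rewrite !DbE D_square -[RHS]/(val (0 : RS)) raddf0.
move=> x c hc E; rewrite rcoprod_coder E linear_sum; rewrite !big_seq.
apply: eq_bigr => q qc; rewrite [LHS]tprod_liftE; congr (_ + _).
have := hc q qc; rewrite -[_ \in _]/(val q.1.2 \in grS q.1.1) => hq.
rewrite exprz_sg -[RHS](lin_sg (tpurel _ _)) /=; congr tpure.
rewrite -[LHS]/(red (tau gS true (val q.1.2))) (tau_gr gS true hq) lin_sg.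
by rewrite redp_val.
Qed.

End SymmetricCodifferential.

(** * Transport of the differential along symmetrization *)

Section AugmentedPBW.
Variables (K : fieldType) (K0 : [pchar K] =i pred0).
Variables (V : lmodType K) (gr : int -> submodClosed V) (theta : seq V -> V).
Hypothesis Ltheta : Leibniz_infty gr theta.
Variables (T : augAlgType K) (i : V -> T) (gT : galg false gr i).
Hypothesis aug_i : forall v, aug (i v) = 0.
Variables (L : lmodType K) (grL : int -> submodClosed L).
Variables (S : augAlgType K) (s : L -> S) (gS : galg true grL s).
Hypothesis aug_s : forall a, aug (s a) = 0.
Variable j : {linear L -> T}.
Hypothesis j_inj : injective j.
Hypothesis j_prim : forall l : letter L, l.2 \in grL l.1 -> prim gT j l.
Hypothesis j_br : forall p q a b, a \in grL p -> b \in grL q ->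
  exists2 c, c \in grL (p + q) & j c = gcomm p q (j a) (j b).
Hypothesis j_gen : forall p v, v \in gr p ->
  exists2 a, a \in grL p & j a = i v.
Hypothesis aug_j : forall a, aug (j a) = 0.

Fact aug_unit1 : aug_unit T S 1 = 1.
Proof. by rewrite -[LHS]/(aug 1 *: 1) rmorph1 scale1r. Qed.
Fact aug_unit_j a t : aug_unit T S (j a * t) = 0.
Proof. by rewrite -[LHS]/(aug (j a * t) *: 1) rmorphM /= aug_j mul0r scale0r. Qed.

Local Notation pbwi := (pbwinv K0 gS j_inj j_prim j_br j_gen aug_unit1 aug_unit_j).

Lemma aug_eq0 (A B : augAlgType K) (x : A) : aug_unit A B x = 0 -> aug x = 0.
Proof.
move=> E; have := congr1 aug E; rewrite -[aug_unit A B x]/(aug x *: 1).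
by rewrite linearZ /= rmorph1 mulr1 raddf0.
Qed.

Lemma aug_symn w : aug (symn j w) = (w == [::])%:R.
Proof.
case: w => [|l w]; first by rewrite symn_nil rmorph1.
apply: (@aug_eq0 T T).
have sw : ((size (l :: w))%:R : K) != 0 by apply: natfS_neq0.
apply: (scalerI sw); rewrite -linearZZ scaler0 (size_symnl K0 j (l :: w)) [LHS]conv_lin.
rewrite conv_eq0 // => u v _.
rewrite -[aug_unit _ _ _]/(aug _ *: 1) rmorphM /=.
case: u => [|m [|? ?]]; rewrite /= ?linear0 ?mul0r ?scale0r //.
by rewrite aug_j mul0r scale0r.
Qed.

Lemma aug_pbwinv t : aug (pbwi t) = aug t.
Proof.
suff E : aug_unit S S (pbwi t) = aug_unit T S t.
  have := congr1 aug E; rewrite -[aug_unit S S _]/(aug _ *: 1) -[aug_unit T S _]/(aug _ *: 1).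
  by rewrite !linearZ /= !rmorph1 !mulr1.
move: t; apply: (euler_lin K0 gT j_br j_gen (f := compl (aug_unit S S) pbwi)) => w hw.
rewrite -[LHS]/(aug_unit S S (pbwi _)) pbwinv_symn //.
rewrite -[LHS]/(aug (word s (unzip2 w)) *: 1) -[RHS]/(aug (symn j w) *: 1).
by rewrite aug_word // aug_symn; case: (w).
Qed.

Lemma aug_pbw x : aug (pbw gS j x) = aug x.
Proof. by rewrite -aug_pbwinv pbwK. Qed.

Lemma aug_leibd t : aug (leibd Ltheta gT t) = 0.
Proof.
suff E : aug_unit T T (leibd Ltheta gT t) = 0.
  exact: aug_eq0 E.
rewrite -[RHS](scale0r t); move: t.
apply: (eq_galg gT (f := compl (aug_unit T T) (leibd Ltheta gT)) (g := 0 \*: idl T)) => w hw.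
rewrite -[LHS]/(aug_unit T T (leibd _ _ _)) -[RHS]/(0 *: _) scale0r leibd_lw //.
rewrite linear_sum big1 // => n _; rewrite conv_lin conv_eq0 // => u v _.
rewrite lin_sg -[aug_unit T T _]/(aug _ *: 1) aug_word //.
by case: (unzip2 u) => [|? ?]; rewrite scale0r sg0.
Qed.

Definition sdiff : {linear S -> S} :=
  transport K0 gS j_inj j_prim j_br j_gen aug_unit1 aug_unit_j (leibd Ltheta gT).

Lemma sdiffE x : sdiff x = pbwi (leibd Ltheta gT (pbw gS j x)).
Proof. by []. Qed.

Lemma sdiff_deg : deg_map grL s 1 sdiff.
Proof. exact/transport_deg/leibd_deg. Qed.

Lemma sdiff_coder : coder gS true sdiff.
Proof. exact/transport_coder/leibd_coder. Qed.

Lemma sdiff_square x : sdiff (sdiff x) = 0.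
Proof. by rewrite !sdiffE pbwinvK leibd_square // linear0. Qed.

Lemma aug_sdiff x : aug (sdiff x) = 0.
Proof. by rewrite sdiffE aug_pbwinv aug_leibd. Qed.

Lemma sdiff1 : sdiff 1 = 0.
Proof.
have p1 : pbw gS j 1 = 1.
  by have := pbw_lw gS j (w := [::]) isT; rewrite lw_nil symn_nil.
by rewrite sdiffE p1 [leibd _ _ 1]zcoder1 linear0.
Qed.

End AugmentedPBW.

Lemma word_morphism (K : fieldType) (W : lmodType K) (A B : algType K)
    (i : W -> A) (k : W -> B) (f : {linear A -> B}) :
  (forall x, x \in span [set y | exists s, y = word i s]) ->
  (forall s, f (word i s) = word k s) -> {morph f : x y / x * y}.
Proof.
move=> A_gen fE x y; apply/eqP; rewrite -subr_eq0; apply/eqP.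
move: x (A_gen x); apply: span_ind => [|c x x' Hx Hx'|_ [s ->]].
- by rewrite !(mul0r, linear0) addr0.
- rewrite mulrDl -scalerAl !linearP mulrDl -scalerAl.
  by rewrite opprD addrACA -scalerBr Hx Hx' scaler0 addr0.
move: y (A_gen y); apply: span_ind => [|c y y' Hy Hy'|_ [t ->]].
- by rewrite !(mulr0, linear0) addr0.
- rewrite mulrDr -scalerAr !linearP mulrDr -scalerAr.
  by rewrite opprD addrACA -scalerBr Hy Hy' scaler0 addr0.
by rewrite -word_cat !fE word_cat subrr.
Qed.

(** * The enveloping algebra of the free Lie algebra *)

Section EnvelopingAlgebra.
Variables (K : fieldType) (V : lmodType K) (gr : int -> submodClosed V).
Variables (T : augAlgType K) (i : V -> T).
Hypothesis i_lin : linear i.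
Hypothesis T_gen : forall x, x \in span [set y | exists s, y = word i s].
Local Notation grT := (word_gr gr i).
Variable LP : submodClosed T.
Hypothesis LP_ind : forall S : submodClosed T, (forall v, i v \in S) ->
  (forall p q a b, a \in grT p -> b \in grT q ->
     a \in S -> b \in S -> gcomm p q a b \in S) ->
  forall y, y \in LP -> y \in S.
Local Notation L := (subsp LP).
Local Notation grL := (sub_gr grT LP).
Local Notation j := (lie_val LP).
Variables (U : augAlgType K) (u : {linear L -> U}) (vL : V -> L).
Hypothesis vLE : forall v, j (vL v) = i v.
Hypothesis U_gen : forall x, x \in span [set y | exists s, y = word u s].
Hypothesis u_br : forall p q a b c, a \in grL p -> b \in grL q ->
  j c = gcomm p q (j a) (j b) -> u c = gcomm p q (u a) (u b).
Hypothesis LP_br : forall p q a b, a \in grT p -> b \in grT q ->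
  a \in LP -> b \in LP -> gcomm p q a b \in LP.
Variables (theta : {linear U -> T}) (phi : {linear T -> U}).
Hypothesis thetaE : forall s, theta (word u s) = word j s.
Hypothesis phiE : forall s, phi (word i s) = word u (map vL s).

Lemma theta_phi x : theta (phi x) = x.
Proof.
move: (T_gen x).
apply: (eq_lin_span (f := compl theta phi) (g := idl T)) => _ [s ->].
rewrite -[LHS]/(theta (phi _)) phiE thetaE word_map /=.
by rewrite /word; apply: eq_bigr => v _; apply: vLE.
Qed.

Lemma phiM : {morph phi : x y / x * y}.
Proof.
by apply: (word_morphism (k := u \o vL) T_gen) => s; rewrite phiE word_map.
Qed.

Lemma phi1 : phi 1 = 1.
Proof. by have := phiE [::]; rewrite !word_nil. Qed.

Fact phi_lie_closed :
  GRing.submod_closed (fun y => `[< exists2 a, j a = y & phi y = u a >]).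
Proof.
split=> [|c x y]; first by apply/asboolP; exists 0; rewrite !linear0.
move=> /asboolP [a ax pa] /asboolP [b bx pb]; apply/asboolP.
by exists (c *: a + b); rewrite !linearP ?ax ?bx ?pa ?pb.
Qed.

(** Induction over Lie(V): on generators this is the formula for [phi], and the relations of U turn
    brackets into commutators. Hence [phi] inverts on both sides the map [theta], which here goes
    from U to T. *)
Lemma phi_lie a : phi (j a) = u a.
Proof.
suff: j a \in submod_of phi_lie_closed.
  by case/asboolP => b /(lie_val_inj (LP := LP)) ->.
case: a => t tL; apply: (LP_ind (S := submod_of phi_lie_closed)) tL.
  move=> v; apply/asboolP; exists (vL v); rewrite ?vLE //.
  by have := phiE [:: v]; rewrite !word1.
move=> p q y z yp zq /asboolP [a ay pa] /asboolP [b bz pb].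
rewrite -ay in yp pa *; rewrite -bz in zq pb *.
have [c cp cE] := lie_br LP_br (a := a) (b := b) yp zq.
apply/asboolP; exists c => //.
by rewrite (gcomm_morph phiM) (u_br yp zq cE) pa pb.
Qed.

Lemma phi_word s : phi (word j s) = word u s.
Proof.
rewrite (word_rmorph _ phi1 phiM) /word.
by apply: eq_bigr => a _; apply: phi_lie.
Qed.

Lemma phi_theta x : phi (theta x) = x.
Proof.
move: (U_gen x).
apply: (eq_lin_span (f := compl phi theta) (g := idl U)) => _ [s ->].
by rewrite -[LHS]/(phi (theta _)) thetaE phi_word.
Qed.

End EnvelopingAlgebra.

Lemma symn_perm (K : fieldType) (L : lmodType K) (T : algType K)
    (j : {linear L -> T}) (w : seq (letter L)) :
  symn j w = ((size w)`!%:R : K)^-1 *: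
    \sum_(s : 'S_(size w)) koszul s (unzip1 w) *: word j (permute s (unzip2 w)).
Proof.
rewrite /symn; congr (_ *: _).
under eq_bigr => s _ do rewrite permute_unzip2 -/(lw j (permw s w)).
rewrite (perm_sum j (erefl (size w))); move: (size w) => n.
move: w; elim: n => //= n IH w.
by apply: eq_conv => a b _; rewrite IH.
Qed.

Section ReducedMaps.
Variables (K : fieldType) (W W' : lmodType K).

Lemma restrict_val (A B : augAlgType K) (i : W -> A) (k : W' -> B) (f : A -> B) :
  (forall v, aug (i v) = 0) ->
  (forall x, x \in span [set y | exists s, y = word i s]) ->
  (forall v, aug (k v) = 0) ->
  (forall x, x \in span [set y | exists s, y = word k s]) ->
  (forall x, aug (f x) = aug x) ->
  forall x, val (restrict (reduced i) (reduced k) f x) = f (val x).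
Proof.
move=> aug_i A_gen aug_k B_gen f_aug x; rewrite val_insubd.
by rewrite (iffRL (reducedP aug_k B_gen _)) // f_aug (aug_val aug_i A_gen).
Qed.

Lemma restrict_surj (A B : augAlgType K) (i : W -> A) (k : W' -> B)
    (f : A -> B) (f' : B -> A) :
  (forall v, aug (i v) = 0) ->
  (forall x, x \in span [set y | exists s, y = word i s]) ->
  (forall v, aug (k v) = 0) ->
  (forall x, x \in span [set y | exists s, y = word k s]) ->
  (forall x, aug (f x) = aug x) -> cancel f' f ->
  set_surj setT setT (restrict (reduced i) (reduced k) f).
Proof.
move=> aug_i A_gen aug_k B_gen f_aug f'K y _.
have xr : f' (val y) \in reduced i.
  by apply/(reducedP aug_i A_gen); rewrite -f_aug f'K (aug_val aug_k B_gen).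
exists (exist (fun x => x \in reduced i) _ xr) => //; apply: val_inj.
by rewrite (restrict_val aug_i A_gen aug_k B_gen f_aug) /= f'K.
Qed.

End ReducedMaps.

(** Surjectivity provides right inverses only, so the value is described through its image under
    [f]; injectivity enters in [conj_val]. *)
Lemma conj_pinv (X Y Z : Type) (x0 : Z -> X) (y0 : Z -> Y) (f : X -> Z)
    (g : Y -> Z) (d : Y -> Y) x :
  set_surj setT setT f -> set_surj setT setT g ->
  exists2 y, g y = f x &
    f (('pinv_x0 setT f \o g \o d \o 'pinv_y0 setT g \o f) x) = g (d y).
Proof.
move=> sf sg; exists ('pinv_y0 setT g (f x)).
  by rewrite (surjpK y0 sg) // in_setT.
by rewrite /= (surjpK x0 sf) // in_setT.
Qed.

Section ReducedLeibniz.
Variables (K : fieldType) (V : lmodType K) (gr : int -> submodClosed V).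
Variables (theta : seq V -> V) (Ltheta : Leibniz_infty gr theta).
Variables (T : augAlgType K) (i : V -> T) (gT : galg false gr i).
Hypothesis aug_i : forall v, aug (i v) = 0.
Hypothesis T_gen : forall x, x \in span [set y | exists s, y = word i s].
Local Notation RT := (subsp (reduced i)).

Definition leibd_formula (f : RT -> RT) : Prop :=
  forall e x, homog gr e x -> x != [::] ->
    f (rword i x) =
    \sum_(1 <= k < (size x).+1) \sum_(1 <= j < (size x + 1 - k).+1)
      \sum_(s : 'S_(j.-1 + k.-1) | shuffle s)
        leib_sign K s e *: rword i (leib_word theta s x).

Definition rleibd : {linear RT -> RT} :=
  compl (redp aug_i T_gen) (compl (leibd Ltheta gT) (lie_val (reduced i))).

Lemma rleibd_val x : val (rleibd x) = leibd Ltheta gT (val x).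
Proof. exact/redp_aug0/aug_leibd. Qed.

Lemma leib_word_neq0 p q (s : 'S_(p + q)) x : leib_word theta s x != [::].
Proof. by rewrite -size_eq0 size_cat /= addnS. Qed.

Lemma rleibdP : leibd_formula rleibd.
Proof.
move=> e x hx x0; rewrite -[LHS]/(redp aug_i T_gen (leibd Ltheta gT (val _))).
rewrite (rword_val aug_i T_gen x0) (leibd_word Ltheta gT hx x0).
rewrite linear_sum; apply: eq_bigr => k _; rewrite linear_sum.
apply: eq_bigr => n _; rewrite linear_sum; apply: eq_bigr => s _.
by rewrite linearZZ redp_word // leib_word_neq0.
Qed.

Lemma leibd_formula_val f : linear f -> leibd_formula f ->
  forall x, val (f x) = leibd Ltheta gT (val x).
Proof.
move=> fl fP x; rewrite -rleibd_val; congr val.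
apply: (eq_lin_reduced aug_i T_gen gT (f := mklin fl) (g := rleibd)) => e {}x hx x0.
by rewrite [RHS](rleibdP hx x0) -[LHS]/(f _) (fP e).
Qed.

End ReducedLeibniz.

Lemma lin_word_rel (K : fieldType) (W : lmodType K) (A B : algType K)
    (i : W -> A) (k : W -> B) (f : {linear A -> B}) :
  (forall x, x \in span [set y | exists s, y = word i s]) ->
  (forall s, f (word i s) = word k s) ->
  forall p q a b c x y, k c = gcomm p q (k a) (k b) ->
    f (x * (gcomm p q (i a) (i b) - i c) * y) = 0.
Proof.
move=> A_gen fE p q a b c x y kc; have fM := word_morphism A_gen fE.
have fi v : f (i v) = k v by have := fE [:: v]; rewrite !word1.
by rewrite !fM linearB (gcomm_morph fM) !fi kc subrr mulr0 mul0r.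
Qed.

Section FreeLie.
Variables (K : fieldType) (V : lmodType K) (gr : int -> submodClosed V).
Local Notation LP := (submod_of (freelie_closed gr)).
Local Notation grT := (tens_gr gr).
Local Notation L := (freelie gr).
Local Notation grL := (freelie_gr gr).
Local Notation RU := (Relators (@aug_uea_rel K V gr)).

Lemma freelie_ind (S : submodClosed (tensalg V)) : (forall v, tens_in v \in S) ->
  (forall p q a b, a \in grT p -> b \in grT q ->
     a \in S -> b \in S -> gcomm p q a b \in S) ->
  forall y, y \in LP -> y \in S.
Proof. by move=> SV Sbr y /asboolP; apply. Qed.

Lemma freelie_br p q a b : a \in grT p -> b \in grT q ->
  a \in LP -> b \in LP -> gcomm p q a b \in LP.
Proof.
move=> ap bq /asboolP aL /asboolP bL; apply/asboolP => S SV Sbr.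
exact: Sbr ap bq (aL S SV Sbr) (bL S SV Sbr).
Qed.

Lemma lie_in_linear : linear (lie_in gr).
Proof. by move=> a x y; apply: val_inj; rewrite /= tens_in_linear. Qed.

Definition uea_lin : {linear L -> uea gr} :=
  mklin (qpi_in_linear (@tens_in_linear K L) RU).

Lemma uea_span (x : uea gr) :
  x \in span [set y | exists s, y = word (uea_in gr) s].
Proof. exact: (qpi_span (@tens_span K L) (R := RU)). Qed.

Lemma aug_uea_in a : aug (uea_in gr a) = 0.
Proof. by rewrite [LHS]qaug_pi aug_tens_in. Qed.

Lemma aug_sym_in a : aug (sym_in grL a) = 0.
Proof. by rewrite [LHS]qaug_pi aug_tens_in. Qed.

Lemma uea_br p q (a b c : L) : a \in grL p -> b \in grL q ->
  val c = gcomm p q (val a) (val b) ->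
  uea_in gr c = gcomm p q (uea_in gr a) (uea_in gr b).
Proof.
move=> ap bq cE.
have : qpi RU (gcomm p q (tens_in a) (tens_in b) - tens_in c) = 0.
  by apply: qpi_rel0; exists p, q, a, b, c.
rewrite linearB => /eqP; rewrite subr_eq0 => /eqP E.
exact: etrans (esym E) (qpi_gcomm (@tens_in K L) RU p q a b).
Qed.

Definition thetaT : {linear tensalg L -> tensalg V} :=
  tlift (word_multilinear (lie_val_linear (LP := LP))).

Fact thetaT_rel0 x y r : relset RU r -> thetaT (x * r * y) = 0.
Proof.
case=> p [q [a [b [c [ap bq cE ->]]]]].
apply: (lin_word_rel (@tens_span K L) (k := lie_val LP)) cE => s.
exact: tlift_word.
Qed.

(** Induced by the inclusion of Lie(V) in T(V), where brackets are commutators; it is the inverse of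
    [Phi]. *)
Definition thetaU : {linear uea gr -> tensalg V} := qlift thetaT_rel0.

Lemma thetaU_word s : thetaU (word (uea_in gr) s) = word (lie_val LP) s.
Proof.
rewrite [word (uea_in gr) s](@qpi_word _ _ _ (@tens_in K L) RU).
rewrite [LHS](@qlift_pi _ _ RU).
exact: tlift_word.
Qed.

Lemma PhiP : is_Phi (Phi gr).
Proof.
apply: xgetPex.
have m : multilinear (fun x => word (uea_in gr) (map (lie_in gr) x)).
  move=> s1 s2 a x y; rewrite !map_cat /= lie_in_linear.
  exact: word_multilinear (linearP uea_lin) _ _ _ _ _.
by exists (tlift m : tensalg V -> uea gr); split=> [|x]; [exact: linearP | exact: tlift_word].
Qed.

End FreeLie.

Section Symmetrization.
Variables (K : fieldType) (L : lmodType K) (gr : int -> submodClosed L).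
Variables (S T U : algType K) (s : L -> S) (gS : galg true gr s).
Variables (j : {linear L -> T}) (u : L -> U) (phi : {linear T -> U}).
Hypothesis phi_word : forall x, phi (word j x) = word u x.

Definition symm_formula (f : S -> U) : Prop := forall e x, homog gr e x ->
  f (word s x) = ((size x)`!%:R : K)^-1 *:
    \sum_(t : 'S_(size x)) koszul t e *: word u (permute t x).

Definition pbwU : {linear S -> U} := compl phi (pbw gS j).

Lemma pbwU_formula : symm_formula pbwU.
Proof.
move=> e x /homog_zip[]; set w := zip e x => hw <- <- _.
rewrite -[LHS]/(phi (pbw gS j (lw s w))) pbw_lw // symn_perm size_map.
rewrite linearZZ linear_sum; congr (_ *: _); apply: eq_bigr => t _.
by rewrite linearZZ phi_word.
Qed.

Lemma symm_formula_pbw f : linear f -> symm_formula f -> f =1 pbwU.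
Proof.
move=> fl fE; apply: (eq_galg gS (f := mklin fl) (g := pbwU)) => w hw.
have hw' : homog gr (unzip1 w) (unzip2 w) by rewrite homogE.
by rewrite [RHS](pbwU_formula hw'); apply: fE.
Qed.

End Symmetrization.

Section Conjugation.
Variables (K : fieldType) (V L : lmodType K) (S T U : augAlgType K).
Variables (s : L -> S) (i : V -> T) (u : L -> U).
Hypothesis aug_s : forall a, aug (s a) = 0.
Hypothesis S_gen : forall x, x \in span [set y | exists z, y = word s z].
Hypothesis aug_i : forall a, aug (i a) = 0.
Hypothesis T_gen : forall x, x \in span [set y | exists z, y = word i z].
Hypothesis aug_u : forall a, aug (u a) = 0.
Hypothesis U_gen : forall x, x \in span [set y | exists z, y = word u z].
Variables (f : S -> U) (g : {linear T -> U}) (g' : U -> T).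
Variables (p : S -> T) (p' : T -> S) (h : V -> L).
Hypothesis fE : forall x, f x = g (p x).
Hypotheses (gK : cancel g g') (g'K : cancel g' g).
Hypotheses (pK : cancel p p') (p'K : cancel p' p).
Hypothesis g_word : forall z, g (word i z) = word u (map h z).
Hypothesis aug_p : forall x, aug (p x) = aug x.
Variables (d : T -> T) (dr : subsp (reduced i) -> subsp (reduced i)).
Hypothesis drE : forall x, val (dr x) = d (val x).
Local Notation rf := (restrict (reduced s) (reduced u) f).
Local Notation rg := (restrict (reduced i) (reduced u) g).

Lemma aug_g x : aug (g x) = aug x.
Proof.
have E : aug_unit U U (g x) = aug_unit T U x.
  move: (T_gen x).
  apply: (eq_lin_span (f := compl (aug_unit U U) g) (g := aug_unit T U)) => _ [z ->].
  rewrite -[LHS]/(aug (g _) *: 1) -[RHS]/(aug _ *: 1) g_word !aug_word //.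
  by case: z.
apply/eqP; rewrite -subr_eq0; apply/eqP.
have := congr1 (fun z => aug z) E.
rewrite -[aug_unit U U _]/(aug _ *: 1) -[aug_unit T U _]/(aug _ *: 1).
by rewrite !linearZ /= !rmorph1 !mulr1 => ->; rewrite subrr.
Qed.

Lemma aug_f x : aug (f x) = aug x.
Proof. by rewrite fE aug_g aug_p. Qed.

(** As [f] factors through the bijection [g], the algebra U drops out and only conjugation by the
    symmetrization [p] remains. *)
Lemma conj_val x0 y0 x :
  val (('pinv_x0 setT rf \o rg \o dr \o 'pinv_y0 setT rg \o rf) x) =
  p' (d (p (val x))).
Proof.
have sf : set_surj setT setT rf.
  apply: (restrict_surj (f' := fun z => p' (g' z)) aug_s S_gen aug_u U_gen aug_f).
  by move=> z; rewrite fE p'K g'K.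
have sg : set_surj setT setT rg.
  exact: (restrict_surj aug_i T_gen aug_u U_gen aug_g g'K).
have [y yE] := conj_pinv x0 y0 dr x sf sg; move: (_ x) => z zE.
have rfE w : val (rf w) = g (p (val w)).
  by rewrite (restrict_val aug_s S_gen aug_u U_gen aug_f) fE.
have rgE w : val (rg w) = g (val w).
  by rewrite (restrict_val aug_i T_gen aug_u U_gen aug_g).
have yp : val y = p (val x).
  by apply: (can_inj gK); rewrite -rgE yE rfE.
by rewrite -yp -drE -[LHS]pK; congr p'; apply: (can_inj gK); rewrite -rfE zE rgE.
Qed.

End Conjugation.

Lemma rcoprod_uniq (K : fieldType) (L : lmodType K) (gr : int -> submodClosed L)
    (S : augAlgType K) (s : L -> S) (gS : galg true gr s)
    (aug_s : forall a, aug (s a) = 0)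
    (S_gen : forall x, x \in span [set y | exists z, y = word s z]) f :
  linear f -> rcoprod_formula gr f -> f = rcoprod gS aug_s S_gen.
Proof.
move=> fl fE; apply: funext.
apply: (eq_lin_reduced aug_s S_gen gS (f := mklin fl)
  (g := mklin (rcoprod_linear gS aug_s S_gen))) => e x hx x0.
by rewrite -[LHS]/(f _) -[RHS]/(rcoprod _ _ _ _) (fE e) // (rcoprodP gS aug_s S_gen hx).
Qed.

Definition rcoder_formula (K : fieldType) (L : lmodType K)
    (gr : int -> submodClosed L) (S : algType K) (s : L -> S) (l : seq L -> L)
    (D : subsp (reduced s) -> subsp (reduced s)) : Prop :=
  forall e x, homog gr e x -> x != [::] ->
    D (rword s x) =
    \sum_(1 <= i < (size x).+1) \sum_(t : 'S_(i + (size x - i)) | shuffle t)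
      koszul t e *: rword s (l (take i (permute t x)) :: drop i (permute t x)).

(** * Codifferential and brackets on Lie(V) *)

Section LeibnizSymmetrization.
Variables (K : fieldType) (K0 : [pchar K] =i pred0).
Variables (V : lmodType K) (gr : int -> submodClosed V) (theta : seq V -> V).
Hypothesis Ltheta : Leibniz_infty gr theta.
Variables (T : augAlgType K) (i : V -> T) (gT : galg false gr i).
Hypothesis aug_i : forall v, aug (i v) = 0.
Hypothesis T_gen : forall x, x \in span [set y | exists z, y = word i z].
Local Notation grT := (word_gr gr i).
Variable LP : submodClosed T.
Hypothesis LP_gen : forall v, i v \in LP.
Hypothesis LP_br : forall p q a b, a \in grT p -> b \in grT q ->
  a \in LP -> b \in LP -> gcomm p q a b \in LP.
Hypothesis LP_ind : forall R : submodClosed T, (forall v, i v \in R) ->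
  (forall p q a b, a \in grT p -> b \in grT q ->
     a \in R -> b \in R -> gcomm p q a b \in R) ->
  forall y, y \in LP -> y \in R.
Local Notation L := (subsp LP).
Local Notation grL := (sub_gr grT LP).
Local Notation j := (lie_val LP).
Variables (S : augAlgType K) (s : L -> S).
Hypothesis sym_gS : is_graded grL -> galg true grL s.
Hypothesis aug_s : forall a, aug (s a) = 0.
Hypothesis S_gen : forall x, x \in span [set y | exists z, y = word s z].
Variables (U : augAlgType K) (u : L -> U).
Hypothesis u_lin : linear u.
Hypothesis aug_u : forall a, aug (u a) = 0.
Hypothesis U_gen : forall x, x \in span [set y | exists z, y = word u z].
Hypothesis u_br : forall p q a b c, a \in grL p -> b \in grL q ->
  j c = gcomm p q (j a) (j b) -> u c = gcomm p q (u a) (u b).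
Variables (Theta : {linear U -> T}) (phi : T -> U) (vL : V -> L).
Hypothesis ThetaE : forall z, Theta (word u z) = word j z.
Hypothesis phi_lin : linear phi.
Hypothesis phiE : forall z, phi (word i z) = word u (map vL z).
Hypothesis vLE : forall v, j (vL v) = i v.
Variables (psi : S -> U) (d : subsp (reduced i) -> subsp (reduced i)).
Variable Delta : subsp (reduced s) -> tprod (subsp (reduced s)) (subsp (reduced s)).
Hypothesis psiP : (exists f : S -> U, linear f /\ symm_formula grL s u f) ->
  linear psi /\ symm_formula grL s u psi.
Hypothesis dP :
  (exists f : subsp (reduced i) -> subsp (reduced i), linear f /\ leibd_formula gr theta (i := i) f) ->
  linear d /\ leibd_formula gr theta (i := i) d.
Hypothesis DeltaP :
  (exists f : subsp (reduced s) -> tprod (subsp (reduced s)) (subsp (reduced s)),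
    linear f /\ rcoprod_formula grL (s := s) f) ->
  linear Delta /\ rcoprod_formula grL (s := s) Delta.
Variables (x0 : subsp (reduced u) -> subsp (reduced s)).
Variables (y0 : subsp (reduced u) -> subsp (reduced i)).
Local Notation rpsi := (restrict (reduced s) (reduced u) psi).
Local Notation rphi := (restrict (reduced i) (reduced u) phi).
Variable dS : subsp (reduced s) -> subsp (reduced s).
Hypothesis dSE :
  dS = 'pinv_x0 setT rpsi \o rphi \o d \o 'pinv_y0 setT rphi \o rpsi.

Let gS := sym_gS (lie_graded K0 gT LP_gen LP_br LP_ind).
Let jP := lie_prim gT LP_gen LP_br LP_ind.
Let j_br := lie_br LP_br.
Let j_gen := lie_gen (gr := gr) LP_gen.
Let aug_j := aug_lie_val aug_i LP_ind.
Let D := sdiff K0 Ltheta (gT := gT) gS (@lie_val_inj _ _ LP) jP j_br j_gen aug_j.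
Let ul := mklin u_lin.
Let phil := mklin phi_lin.

Fact phil_word z : phil (word j z) = word u z.
Proof. exact: (phi_word T_gen LP_ind (u := ul) (phi := phil) vLE u_br LP_br phiE). Qed.

Fact dE x : val (d x) = leibd Ltheta gT (val x).
Proof.
have [dl df] : linear d /\ leibd_formula gr theta (i := i) d.
  apply: dP; exists (rleibd Ltheta gT aug_i T_gen).
  by split; [exact: linearP | exact: rleibdP].
exact: (leibd_formula_val Ltheta gT aug_i T_gen dl df).
Qed.

Fact psiE x : psi x = phil (pbw gS j x).
Proof.
have [pl pf] : linear psi /\ symm_formula grL s u psi.
  apply: psiP; exists (pbwU gS j phil).
  by split; [exact: linearP | exact: (pbwU_formula gS phil_word)].
exact: (symm_formula_pbw gS phil_word pl pf).
Qed.

Fact DeltaE : Delta = rcoprod gS aug_s S_gen.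
Proof.
have [Dl Df] : linear Delta /\ rcoprod_formula grL (s := s) Delta.
  apply: DeltaP; exists (rcoprod gS aug_s S_gen).
  by split; [exact: rcoprod_linear | exact: rcoprodP].
exact: rcoprod_uniq.
Qed.

Lemma dS_val x : val (dS x) = D (val x).
Proof.
rewrite dSE; apply: (conj_val (g := phil) (g' := Theta) aug_s S_gen aug_i T_gen aug_u U_gen psiE
  _ _ _ _ phiE _ dE).
- exact: (theta_phi T_gen (u := ul) (phi := phil) vLE ThetaE phiE).
- exact: (phi_theta T_gen LP_ind (u := ul) (phi := phil) vLE U_gen u_br LP_br ThetaE phiE).
- exact: pbwK.
- exact: pbwinvK.
- exact: (aug_pbw K0 gS aug_s (@lie_val_inj _ _ LP) jP j_br j_gen aug_j).
Qed.

Let D_deg : deg_map grL s 1 D.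
Proof. exact: sdiff_deg. Qed.
Let D_coder : coder gS true D.
Proof. exact: sdiff_coder. Qed.
Let D_square x : D (D x) = 0.
Proof. exact: sdiff_square. Qed.
Let D_aug x : aug (D x) = 0.
Proof. exact: aug_sdiff. Qed.
Let D1 : D 1 = 0.
Proof. exact: sdiff1. Qed.

(** The theorem for abstract T, S and U. Maps defined by choice enter through hypotheses saying that
    they satisfy their formula as soon as some map does; [dE], [psiE] and [DeltaE] supply such a map
    and its uniqueness. *)
Lemma leibniz_symmetrization :
  codifferential (sub_gr (word_gr grL s) (reduced s)) Delta dS /\
  exists l : seq L -> L, Linfty grL l /\ rcoder_formula grL l dS.
Proof.
split.
  rewrite DeltaE.
  exact: (rsym_codifferential aug_s S_gen D_deg D_coder D_square D_aug D1 dS_val).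
exists (linf_bracket gS D); split.
  exact: (linf_Linfty K0 aug_s D_deg D_coder D_square D_aug D1).
exact: (rcoder_of K0 aug_s S_gen D_deg D_coder D_aug D1 dS_val).
Qed.

End LeibnizSymmetrization.

(** * The concrete algebras and the chosen maps *)

Lemma leib_dP (K : fieldType) (V : lmodType K) (gr : int -> submodClosed V)
    (theta : seq V -> V) :
  (exists f, is_leib_d gr theta f) -> is_leib_d gr theta (leib_d gr theta).
Proof. exact: xgetPex. Qed.

Section SymmetricCoalgebra.
Variables (K : fieldType) (L : lmodType K) (gr : int -> submodClosed L).
Local Notation S := (symalg gr : augAlgType K).
Local Notation R := (subsp (@reduced K L S (sym_in gr))).

Lemma rsym_coprod_spec :
  (exists f, @is_rsym_coprod K L gr f) -> is_rsym_coprod (rsym_coprod gr).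
Proof. exact: xgetPex. Qed.

Lemma rsym_coprodP :
  (exists f : R -> tprod R R, linear f /\ @rcoprod_formula K L gr S (sym_in gr) f) ->
  linear (rsym_coprod gr : R -> tprod R R) /\
  @rcoprod_formula K L gr S (sym_in gr) (rsym_coprod gr).
Proof.
(* The two sides differ only in the path to the algebra structure of symalg;
   the kernel converts them at once where tactic unification diverges. *)
exact_no_check rsym_coprod_spec.
Qed.

Lemma codifferential_rsym (d : R -> R) :
  @codifferential K R (sub_gr (@word_gr K L gr S (sym_in gr)) (reduced (sym_in gr)))
    (rsym_coprod gr) d ->
  codifferential (rsym_gr gr) (rsym_coprod gr) d.
Proof. by []. Qed.

Lemma coder_of_rsym (d : R -> R) (l : seq L -> L) :
  @rcoder_formula K L gr S (sym_in gr) l d ->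
  coder_of l d.
Proof. by []. Qed.

End SymmetricCoalgebra.

Lemma PsiP (K : fieldType) (V : lmodType K) (gr : int -> submodClosed V) :
  (exists f, @is_Psi K V gr f) -> is_Psi (Psi gr).
Proof. exact: xgetPex. Qed.

Section Transported.
Variables (K : fieldType) (V : lmodType K) (gr : int -> submodClosed V).
Variable theta : seq V -> V.
Local Notation T := (tensalg V : augAlgType K).
Local Notation S := (symalg (freelie_gr gr) : augAlgType K).
Local Notation U := (uea gr : augAlgType K).
Local Notation L := (subsp (submod_of (freelie_closed gr))).
Local Notation redS := (@reduced K L S (sym_in (freelie_gr gr))).
Local Notation redT := (@reduced K V T tens_in).
Local Notation redU := (@reduced K L U (uea_in gr)).
Local Notation rpsi := (@restrict K S U redS redU (Psi gr)).
Local Notation rphi := (@restrict K T U redT redU (Phi gr)).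

(** [transported] with its type written through the [augAlgType] structure of the symmetric algebra,
    the form in which [leibniz_symmetrization] applies. *)
Definition rtransported : subsp redS -> subsp redS := transported gr theta.

Lemma transportedE : rtransported =
  'pinv_(fun=> 0) setT rpsi \o rphi \o leib_d gr theta
    \o 'pinv_(fun=> 0) setT rphi \o rpsi.
Proof. exact_no_check (erefl (transported gr theta)). Qed.

End Transported.

Theorem theorem6p17 (K : fieldType) (charK0 : [pchar K] =i pred0)
    (G : lmodType K) (gr : int -> submodClosed G) (theta : seq G -> G)
    (Gtheta : Leibniz_infty gr theta) :
  codifferential (rsym_gr (freelie_gr gr)) (rsym_coprod (freelie_gr gr))
    (transported gr theta) /\
  exists l : seq (freelie gr) -> freelie gr,
    Linfty (freelie_gr gr) l /\ coder_of l (transported gr theta).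
Proof.
have S_gen := @qpi_span K _ _ _ (@tens_span K (freelie gr))
  (Relators (@aug_sym_rel K (freelie gr) (freelie_gr gr))).
(* The [erefl] says that the Lie element of [v] is [tens_in v]; the two functions [fun=> 0] are the
   defaults of the partial inverses. *)
have [DS [l [l_inf l_D]]] := @leibniz_symmetrization K charK0 G gr theta Gtheta
  (tensalg G) (@tens_in K G) (tens_galg (leib_graded Gtheta)) (@aug_tens_in K G)
  (@tens_span K G) (submod_of (freelie_closed gr)) (@tens_in_freelie K G gr)
  (@freelie_br K G gr) (@freelie_ind K G gr)
  (symalg (freelie_gr gr)) (sym_in (freelie_gr gr))
  (@sym_galg K (freelie gr) (freelie_gr gr)) (@aug_sym_in K G gr) S_gen
  (uea gr) (uea_in gr) (linearP (uea_lin gr)) (@aug_uea_in K G gr)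
  (@uea_span K G gr) (@uea_br K G gr) (thetaU gr) (Phi gr) (lie_in gr)
  (@thetaU_word K G gr) (proj1 (PhiP gr)) (proj2 (PhiP gr)) (fun=> erefl)
  (Psi gr) (leib_d gr theta) (rsym_coprod (freelie_gr gr))
  (@PsiP K G gr) (@leib_dP K G gr theta)
  (@rsym_coprodP K (freelie gr) (freelie_gr gr)) (fun=> 0) (fun=> 0)
  (@rtransported K G gr theta) (@transportedE K G gr theta).
split; first exact: codifferential_rsym DS.
exists l; split; first exact: l_inf.
exact: (@coder_of_rsym K (freelie gr) (freelie_gr gr) (@rtransported K G gr theta) l l_D).
Qed.
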